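(* There is an absolute constant $C>0$ with the following property. Let $L\ge 4$ be an integer divisible by $4$, let $n\ge 1$, let $I\subseteq[n]$ with $|I|$ odd, and let $f\colon \Gamma_L^n\to\Sigma^2$ be an equivariant simplicial map such that $j\circ|f|\colon T^n\to Y$ is equivariantly homotopic to the monomial map $m_I\colon (z_1,\dots,z_n)\mapsto j\big(\iota(\prod_{i\in I} z_i)\big)$. Then $|I|\le C L^2$.
   Context: Simplicial sets: a relational simplicial set has a finite vertex set $X_0$ and $n$-simplices $X_n\subseteq X_0^{n+1}$ (written $[u_0,\dots,u_n]$), closed under omitting/repeating entries while preserving order; a simplicial map is a vertex map sending simplices to simplices. Products are taken componentwise ($(X\times Y)_n=X_n\times Y_n$). A $\mathbb Z_2$-action is a simplicial involution $\nu$; a map is equivariant if it commutes with the involutions; products carry the diagonal action. $\Sigma^2$: vertices are two colours, blue and yellow; simplices are all tuples of these colours with at most $2$ alternations between consecutive entries; the action swaps the colours; $\Sigma^1\subset\Sigma^2$ consists of tuples with at most one alternation. $|\Sigma^2|\cong S^2$ and $|\Sigma^1|\cong S^1$ equivariantly with antipodal actions. $\Gamma_L$ ($4\mid L$): the order complex of the poset on $\mathbb Z_L$ where $a\prec b$ iff $a$ even, $b$ odd, $a-b\equiv\pm1 \pmod L$ (simplices are weakly increasing chains); the action is $x\mapsto x+L/2$. Its geometric realization is a circle, identified equivariantly with $S^1=\{z\in\mathbb C:|z|=1\}$ with action $z\mapsto -z$, and $|\Gamma_L^n|$ with the torus $T^n=(S^1)^n$ with the diagonal action. $\iota\colon S^1\to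 S^2$ is the equivariant inclusion $|\Sigma^1|\subset|\Sigma^2|$. $Y$ is a $\mathbb Z_2$-CW complex obtained from $|\Sigma^2|\cong S^2$ (antipodal action) by equivariantly attaching cells of dimension $\ge 4$ (in pairs swapped by the action) so that $\pi_i(Y)=0$ for all $i\ne 2$ and the inclusion $j\colon S^2\to Y$ induces an isomorphism on $\pi_2$; in particular its $1$- and $2$-skeleta are $|\Sigma^1|$ and $|\Sigma^2|$. Equivariant homotopy means a homotopy through equivariant maps. *)

(* Defs.v *)
From HB Require Import structures.
From mathcomp Require Import all_boot all_order all_algebra.
From mathcomp Require Import generic_quotient.
From mathcomp Require Import all_classical all_reals all_analysis.
From mathcomp Require Import complex lra.
From Stdlib Require Import Relation_Operators.

Set Implicit Arguments.
Unset Strict Implicit.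
Unset Printing Implicit Defensive.

Import Order.TTheory GRing.Theory Num.Theory.
Import numFieldNormedType.Exports.

Local Open Scope ring_scope.
Local Open Scope quotient_scope.

(* An [n]-simplex [u_0, ..., u_n] is the function i |-> u_i.  "Closed under
   omitting and repeating entries while preserving order" is closure under
   precomposition with weakly monotone maps. *)
Record relSSet := RelSSet {
  vert : finType;
  simp : forall n, {set {ffun 'I_n.+1 -> vert}};
  simp_vert : forall u : {ffun 'I_1 -> vert}, u \in simp 0%N;
  simp_reindex : forall m n (th : 'I_m.+1 -> 'I_n.+1)
    (u : {ffun 'I_n.+1 -> vert}),
    {homo th : i j / (i <= j)%N} -> u \in simp n ->
    [ffun i => u (th i)] \in simp m }.

Record simplicialMap (X Y : relSSet) := SimplicialMap {
  vmap :> vert X -> vert Y;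
  vmap_simp : forall n (u : {ffun 'I_n.+1 -> vert X}),
    u \in simp X n -> [ffun i => vmap (u i)] \in simp Y n }.

Record Z2SSet := MkZ2SSet {
  sset :> relSSet;
  act : simplicialMap sset sset;
  actK : involutive act }.

Definition equivariant (A B : Type) (nuA : A -> A) (nuB : B -> B)
  (f : A -> B) : Prop := forall a, f (nuA a) = nuB (f a).

Section Power.
Variables (n : nat) (X : Z2SSet).

Definition power_simp m : {set {ffun 'I_m.+1 -> {ffun 'I_n -> vert X}}} :=
  [set u : {ffun 'I_m.+1 -> {ffun 'I_n -> vert X}} |
    [forall k, [ffun i => u i k] \in simp X m]].

Lemma power_simp_vert (u : {ffun 'I_1 -> {ffun 'I_n -> vert X}}) :
  u \in power_simp 0.
Proof. by rewrite inE; apply/forallP => k; apply: simp_vert. Qed.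

Lemma power_simp_reindex m p (th : 'I_m.+1 -> 'I_p.+1)
    (u : {ffun 'I_p.+1 -> {ffun 'I_n -> vert X}}) :
  {homo th : i j / (i <= j)%N} -> u \in power_simp p ->
  [ffun i => u (th i)] \in power_simp m.
Proof.
move=> th_homo; rewrite !inE => /forallP uP; apply/forallP => k.
have -> : [ffun i => [ffun i => u (th i)] i k] =
          [ffun i => [ffun i => u i k] (th i)].
  by apply/ffunP => i; rewrite !ffunE.
exact: simp_reindex.
Qed.

Definition power_sset : relSSet := RelSSet power_simp_vert power_simp_reindex.

Definition power_act_fun (v : vert power_sset) : vert power_sset :=
  [ffun k => act X (v k)].

Lemma power_act_simp m (u : {ffun 'I_m.+1 -> vert power_sset}) :
  u \in simp power_sset m ->
  [ffun i => power_act_fun (u i)] \in simp power_sset m.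
Proof.
rewrite !inE => /forallP uP; apply/forallP => k.
have -> : [ffun i => [ffun i => power_act_fun (u i)] i k] =
          [ffun i => act X ([ffun i => u i k] i)].
  by apply/ffunP => i; rewrite !ffunE.
exact: vmap_simp.
Qed.

Definition power_act := SimplicialMap power_act_simp.

Lemma power_actK : involutive power_act.
Proof. by move=> v; apply/ffunP => k; rewrite !ffunE actK. Qed.

Definition power : Z2SSet := MkZ2SSet power_actK.
End Power.

Section ProjectionMap.
Variables (n : nat) (X : Z2SSet) (k : 'I_n).

Lemma proj_simp m (u : {ffun 'I_m.+1 -> vert (power n X)}) :
  u \in simp (power n X) m -> [ffun i => u i k] \in simp X m.
Proof. by rewrite inE => /forallP. Qed.

Definition proj : simplicialMap (power n X) X :=
  @SimplicialMap (power n X) X (fun v => v k) proj_simp.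
End ProjectionMap.

(* Colours: [true] is blue, [false] is yellow. *)
Definition alternations n (u : 'I_n.+1 -> bool) : nat :=
  \sum_(i < n) (u (inord i) != u (inord i.+1)).

Lemma alternations_reindex m n (th : 'I_m.+1 -> 'I_n.+1)
    (u : 'I_n.+1 -> bool) : {homo th : i j / (i <= j)%N} ->
  (alternations (fun i => u (th i)) <= alternations u)%N.
Proof.
move=> th_homo; pose w (j : nat) := u (inord j).
pose a p q := (\sum_(p <= j < q) (w j != w j.+1))%N.
have aP p q : (p <= q)%N -> ((w p != w q) <= a p q)%N.
  move=> /subnKC <-; elim: (q - p)%N => [|d IH]; first by rewrite addn0 eqxx.
  rewrite /a addnS big_nat_recr ?leq_addr//=.
  apply: leq_trans (leq_add IH (leqnn _)).
  by case: (w p); case: (w (p + d)%N); case: (w (p + d).+1).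
have a0 : alternations u = a 0%N n by rewrite /alternations /a big_mkord.
pose t (i : nat) := th (inord i) : nat.
have tw i : u (th (inord i)) = w (t i) by rewrite /w /t inord_val.
have th_mono i : (i < m)%N -> (t i <= t i.+1)%N.
  by move=> im; apply: th_homo; rewrite !inordK// ltnS// ltnW.
have sumP q : (q <= m)%N ->
    (\sum_(i < q) (w (t i) != w (t i.+1)) <= a (t 0) (t q))%N /\
    (t 0 <= t q)%N.
  elim: q => [|q IH] qm; first by rewrite big_ord0.
  have [IH1 IH2] := IH (ltnW qm); split; last first.
    exact: leq_trans IH2 (th_mono _ qm).
  rewrite big_ord_recr /= /a (@big_cat_nat _ _ _ (t q)) ?th_mono//=.
  by rewrite leq_add// aP// th_mono.
rewrite a0; apply: (@leq_trans (a (t 0) (t m))).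
  by have [+ _] := sumP m (leqnn m); rewrite /alternations; under eq_bigr do rewrite -!tw.
have [_ t0m] := sumP m (leqnn m).
have tmn : (t m <= n)%N by rewrite -ltnS /t ltn_ord.
rewrite /a [leqRHS](@big_cat_nat _ _ _ (t 0))//=; last exact: leq_trans tmn.
by rewrite [X in (_ + X)%N](@big_cat_nat _ _ _ (t m))//= addnCA leq_addr.
Qed.

Section Sigma.
Variable k : nat.

Definition Sigma_simp n : {set {ffun 'I_n.+1 -> bool}} :=
  [set u : {ffun 'I_n.+1 -> bool} | (alternations u <= k)%N].

Lemma Sigma_simp_vert (u : {ffun 'I_1 -> bool}) : u \in Sigma_simp 0.
Proof. by rewrite inE /alternations big_ord0. Qed.

Lemma Sigma_simp_reindex m n (th : 'I_m.+1 -> 'I_n.+1)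
    (u : {ffun 'I_n.+1 -> bool}) :
  {homo th : i j / (i <= j)%N} -> u \in Sigma_simp n ->
  [ffun i => u (th i)] \in Sigma_simp m.
Proof.
move=> th_homo; rewrite !inE; apply: leq_trans.
apply: leq_trans (alternations_reindex u th_homo).
by rewrite /alternations leq_sum// => i _; rewrite !ffunE.
Qed.

Definition Sigma_sset : relSSet := RelSSet Sigma_simp_vert Sigma_simp_reindex.

Lemma Sigma_act_simp n (u : {ffun 'I_n.+1 -> vert Sigma_sset}) :
  u \in simp Sigma_sset n -> [ffun i => ~~ u i] \in simp Sigma_sset n.
Proof.
rewrite !inE; apply: leq_trans; rewrite /alternations leq_sum// => i _.
by rewrite !ffunE (inj_eq negb_inj).
Qed.

Definition Sigma : Z2SSet :=
  @MkZ2SSet Sigma_sset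
    (@SimplicialMap Sigma_sset Sigma_sset negb Sigma_act_simp) negbK.
End Sigma.

Lemma Sigma_incl_simp n (u : {ffun 'I_n.+1 -> vert (Sigma 1)}) :
  u \in simp (Sigma 1) n -> [ffun i => u i : bool] \in simp (Sigma 2) n.
Proof.
rewrite !inE => u1; apply: leq_trans (leqW u1).
by rewrite /alternations leq_sum// => i _; rewrite !ffunE.
Qed.

Definition Sigma_incl : simplicialMap (Sigma 1) (Sigma 2) :=
  @SimplicialMap (Sigma 1) (Sigma 2) id Sigma_incl_simp.

Definition Gamma_prec L (a b : 'Z_L) : bool :=
  [&& ~~ odd a, odd b & (a - b == 1) || (a - b == -1)].

Section Gamma.
Variable L : nat.

Definition Gamma_simp n : {set {ffun 'I_n.+1 -> 'Z_L}} :=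
  [set u : {ffun 'I_n.+1 -> 'Z_L} |
    [forall i : 'I_n.+1, forall j : 'I_n.+1,
       (i <= j)%N ==> (u i == u j) || Gamma_prec (u i) (u j)]].

Lemma Gamma_simp_vert (u : {ffun 'I_1 -> 'Z_L}) : u \in Gamma_simp 0.
Proof.
by rewrite inE; apply/'forall_forallP => i j; rewrite (ord1 i) (ord1 j) eqxx.
Qed.

Lemma Gamma_simp_reindex m n (th : 'I_m.+1 -> 'I_n.+1)
    (u : {ffun 'I_n.+1 -> 'Z_L}) :
  {homo th : i j / (i <= j)%N} -> u \in Gamma_simp n ->
  [ffun i => u (th i)] \in Gamma_simp m.
Proof.
move=> th_homo; rewrite !inE => /'forall_forallP uP.
apply/'forall_forallP => i j; apply/implyP => ij; rewrite !ffunE.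
exact: (implyP (uP _ _) (th_homo _ _ ij)).
Qed.

Definition Gamma_sset : relSSet := RelSSet Gamma_simp_vert Gamma_simp_reindex.

Hypothesis L4 : (4 %| L)%N.

Definition Gamma_act_fun (a : 'Z_L) : 'Z_L := a + L./2%:R.

Lemma odd_Gamma_act (a : 'Z_L) : odd (Gamma_act_fun a) = odd a.
Proof.
have [k Lk] : exists k, L = (4 * k)%N.
  by case/dvdnP: L4 => k ->; exists k; rewrite mulnC.
have L2 : L./2 = (2 * k)%N by rewrite Lk -divn2 (_ : 4 = 2 * 2)%N// -mulnA mulKn.
case: (posnP k) => [k0|k0]; first by rewrite /Gamma_act_fun L2 k0 muln0 addr0.
have L1 : (1 < L)%N by rewrite Lk (leq_trans (_ : 1 < 4 * 1)%N)// leq_mul2l.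
have trL : (Zp_trunc L).+2 = L by rewrite Zp_cast.
have odL : odd L = false by rewrite Lk oddM.
have odmod x : odd (x %% L) = odd x.
  by rewrite [in RHS](divn_eq x L) oddD oddM odL andbF.
rewrite /Gamma_act_fun L2 -[a]natr_Zp -natrD !val_Zp_nat//.
by rewrite !odmod oddD oddM addbF.
Qed.

Lemma Gamma_act_simp n (u : {ffun 'I_n.+1 -> vert Gamma_sset}) :
  u \in simp Gamma_sset n ->
  [ffun i => Gamma_act_fun (u i) : vert Gamma_sset] \in simp Gamma_sset n.
Proof.
rewrite !inE => /'forall_forallP uP; apply/'forall_forallP => i j.
rewrite !ffunE /Gamma_prec !odd_Gamma_act (inj_eq (addIr _)).
rewrite /Gamma_act_fun opprD addrACA subrr addr0; exact: uP.
Qed.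

Lemma Gamma_actK : involutive Gamma_act_fun.
Proof.
move=> a; rewrite /Gamma_act_fun -addrA -natrD addnn.
have -> : (L./2).*2 = L.
  by rewrite -[RHS]odd_double_half; case/dvdnP: L4 => k ->; rewrite oddM andbF.
case: (ltnP 1 L) => [L1|]; first by rewrite pchar_Zp// addr0.
by move: L4; case: (L) a => [|[|//]]// a _ _; rewrite addr0.
Qed.

Definition Gamma : Z2SSet :=
  @MkZ2SSet Gamma_sset
    (@SimplicialMap Gamma_sset Gamma_sset Gamma_act_fun Gamma_act_simp)
    Gamma_actK.
End Gamma.

Local Open Scope classical_set_scope.

Section Simplex.
Variable R : realType.

Definition Delta_set n : set 'rV[R]_n.+1 :=
  [set t | (forall i, 0 <= t 0 i) /\ \sum_i t 0 i = 1].

Definition Delta n : topologicalType := set_type (@Delta_set n).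

Definition pushforward_row m n (th : 'I_m.+1 -> 'I_n.+1) (t : 'rV[R]_m.+1) :
  'rV[R]_n.+1 := \row_j \sum_(i | th i == j) t 0 i.

Lemma pushforward_row_Delta m n (th : 'I_m.+1 -> 'I_n.+1) (t : Delta m) :
  pushforward_row th (val t) \in @Delta_set n.
Proof.
case: t => t /= /set_mem[t0 t1]; apply/mem_set; split=> [j|].
  by rewrite mxE sumr_ge0.
under eq_bigr do rewrite mxE.
rewrite -[RHS]t1 [RHS](partition_big th xpredT)//=.
Qed.

Definition pushforward m n (th : 'I_m.+1 -> 'I_n.+1) (t : Delta m) : Delta n :=
  exist _ (pushforward_row th (val t)) (pushforward_row_Delta th t).
End Simplex.
Arguments Delta : clear implicits.

Section Realization.
Variables (R : realType) (X : relSSet).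

Definition nsimplex n := {u : {ffun 'I_n.+1 -> vert X} | u \in simp X n}.

Definition reindex m n (th : 'I_m.+1 -> 'I_n.+1)
    (hth : {homo th : i j / (i <= j)%N}) (u : nsimplex n) : nsimplex m :=
  exist _ [ffun i => val u (th i)] (simp_reindex hth (valP u)).

Definition precell : topologicalType :=
  {s : {n : nat & nsimplex n} & Delta R (tag s)}.

Definition mkcell n (u : nsimplex n) (t : Delta R n) : precell :=
  existT (fun s : {n : nat & nsimplex n} => Delta R (tag s))
    (existT nsimplex n u) t.

(* The face and degeneracy identifications of the coproduct of the
   X_n * Delta^n. *)
Inductive glue : precell -> precell -> Prop :=
  Glue m n (th : 'I_m.+1 -> 'I_n.+1) (hth : {homo th : i j / (i <= j)%N})
    (u : nsimplex n) (t : Delta R m) :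
    glue (mkcell (reindex hth u) t) (mkcell u (pushforward th t)).

Definition glueb (x y : precell) : bool :=
  `[< clos_refl_sym_trans precell glue x y >].

Lemma glueb_equiv : equiv_class_of glueb.
Proof.
split=> [x|x y|y x z].
- exact/asboolP/rst_refl.
- by apply: asbool_equiv_eq; split; apply: rst_sym.
- by move=> /asboolP xy /asboolP yz; apply/asboolP; apply: rst_trans xy yz.
Qed.

Canonical glueb_equiv_rel := EquivRelPack glueb_equiv.

Definition realization : topologicalType :=
  quotient_topology {eq_quot glueb_equiv_rel}.

Definition point_of (x : precell) : realization := \pi_realization x.

Lemma point_ofP x y :
  point_of x = point_of y <-> clos_refl_sym_trans precell glue x y.
Proof.
have h := @eqmodP _ glueb_equiv_rel x y.
by split=> [/h /asboolP//|/asboolP/h].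
Qed.

Lemma repr_point_of x : clos_refl_sym_trans precell glue (repr (point_of x)) x.
Proof. by apply/point_ofP; rewrite /point_of reprK. Qed.
End Realization.

Section RealizationMap.
Variables (R : realType) (X Y : relSSet) (f : simplicialMap X Y).

Definition map_nsimplex n (u : nsimplex X n) : nsimplex Y n :=
  exist _ [ffun i => f (val u i)] (vmap_simp f (valP u)).

Definition map_precell (x : precell R X) : precell R Y :=
  mkcell (map_nsimplex (tagged (tag x))) (tagged x).

Definition realization_map (p : realization R X) : realization R Y :=
  point_of (map_precell (repr p)).

Lemma map_precell_glue x y :
  clos_refl_sym_trans _ (@glue R X) x y ->
  clos_refl_sym_trans _ (@glue R Y) (map_precell x) (map_precell y).
Proof.
elim=> [a b [m n th hth u t]|a|a b _|a b c _ IH1 _].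
- apply: rst_step; rewrite /map_precell /=.
  have -> : map_nsimplex (reindex hth u) = reindex hth (map_nsimplex u).
    by apply: val_inj; apply/ffunP => i /=; rewrite !ffunE.
  exact: Glue.
- exact: rst_refl.
- exact: rst_sym.
- exact: rst_trans IH1.
Qed.

Lemma realization_mapE (x : precell R X) :
  realization_map (point_of x) = point_of (map_precell x).
Proof. exact/point_ofP/map_precell_glue/repr_point_of. Qed.
End RealizationMap.
Arguments realization_map R {X Y} f p.

Section Circle.
Variable R : realType.
Local Open Scope complex_scope.

Definition circle := {z : R[i] | `|z| == 1}.

Lemma circle1_subproof : `|1 : R[i]| == 1. Proof. by rewrite normr1. Qed.
Definition circle1 : circle := exist _ 1 circle1_subproof.

Lemma circle_prod_subproof n (I : {set 'I_n}) (z : 'I_n -> circle) :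
  `|\prod_(i in I) val (z i)| == 1.
Proof. by rewrite normr_prod big1// => i _; exact/eqP/(valP (z i)). Qed.

Definition circle_prod n (I : {set 'I_n}) (z : 'I_n -> circle) : circle :=
  exist _ (\prod_(i in I) val (z i)) (circle_prod_subproof I z).

(* [|Gamma_L|] is the boundary of the regular [L]-gon with vertices
   exp (2 i pi a / L), which is projected radially onto the unit circle. *)
Definition polygon_vertex L (a : 'Z_L) : R[i] :=
  cos (2 * pi * a%:R / L%:R) +i* sin (2 * pi * a%:R / L%:R).

Definition polygon_point L (x : precell R (Gamma_sset L)) : R[i] :=
  \sum_i ((val (tagged x)) 0 i)%:C * polygon_vertex (val (tagged (tag x)) i).

(* The default value of [insubd] is never used for [4 <= L]: the polygon then
   avoids the origin. *)
Definition Gamma_circle L (p : realization R (Gamma_sset L)) : circle :=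
  let z := polygon_point (repr p) in insubd circle1 (z / `|z|).

Lemma polygon_point_glue L x y :
  clos_refl_sym_trans _ (@glue R (Gamma_sset L)) x y ->
  polygon_point x = polygon_point y.
Proof.
elim=> [a b [m n th hth u t]|//|//|a b c _ -> _ -> //].
rewrite /polygon_point /=; under [RHS]eq_bigr => j _.
  rewrite mxE rmorph_sum mulr_suml/=; over.
rewrite [LHS](partition_big th xpredT)//=.
by apply: eq_bigr => j _; apply: eq_bigr => i /eqP<-; rewrite ffunE.
Qed.

Lemma Gamma_circleE L (x : precell R (Gamma_sset L)) :
  Gamma_circle (point_of x) =
  insubd circle1 (polygon_point x / `|polygon_point x|).
Proof.
by rewrite /Gamma_circle (polygon_point_glue (repr_point_of x)).
Qed.

(* The equivariant homeomorphism from [|Gamma_L^n|] to the torus [(S^1)^n]. *)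
Definition Gamma_torus n L (L4 : (4 %| L)%N)
    (p : realization R (power n (Gamma L4))) (k : 'I_n) : circle :=
  Gamma_circle (realization_map R (proj (Gamma L4) k) p).

Definition segment_row (s : R) : 'rV[R]_2 :=
  \row_(i < 2) (if i == 0 then 1 - s else s).

Lemma segment_row_Delta s : 0 <= s <= 1 -> segment_row s \in @Delta_set R 1.
Proof.
move=> /andP[s0 s1]; apply/mem_set; split=> [i|].
  by rewrite mxE; case: ifP => // _; rewrite subr_ge0.
by rewrite big_ord_recl big_ord1 !mxE/= subrK.
Qed.

Definition segment s (hs : 0 <= s <= 1) : Delta R 1 :=
  exist _ (segment_row s) (segment_row_Delta hs).

Definition edge_fun (c : bool) : {ffun 'I_2 -> vert (Sigma 1)} :=
  [ffun i : 'I_2 => if i == 0 then c else ~~ c].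

Lemma edge_simp c : edge_fun c \in simp (Sigma 1) 1.
Proof. by rewrite inE /alternations big_ord1 leq_b1. Qed.

Definition edge (c : bool) : nsimplex (Sigma 1) 1 :=
  exist _ (edge_fun c) (edge_simp c).

Definition edge_point (c : bool) s (hs : 0 <= s <= 1) :
  realization R (Sigma 1) := point_of (mkcell (edge c) (segment hs)).

Lemma circle_weight_subproof (z : circle) (c : bool) :
  0 <= (1 - (-1) ^+ (~~ c) * complex.Re (val z)) / 2 <= 1.
Proof.
have : `|complex.Re (val z)| <= 1.
  by rewrite -lecR (le_trans (normc_ge_Re _))// (eqP (valP z)).
rewrite ler_norml => /andP[h1 h2].
by case: c; rewrite /= ?expr0 ?expr1 ?mul1r ?mulN1r ?opprK; apply/andP; split;
  rewrite ?divr_ge0 ?ler_pdivrMr ?mul1r ?subr_ge0//;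
  lra.
Qed.

(* The equivariant homeomorphism S^1 ~ |Sigma^1|: the upper half circle goes to
   the edge [blue, yellow] and the lower one to [yellow, blue], both
   parametrized by the real part; 1 goes to blue and -1 to yellow. *)
Definition circle_Sigma1 (z : circle) : realization R (Sigma 1) :=
  edge_point (0 <= complex.Im (val z))
    (circle_weight_subproof z (0 <= complex.Im (val z))).

Definition iota (z : circle) : realization R (Sigma 2) :=
  realization_map R Sigma_incl (circle_Sigma1 z).
End Circle.

Section Homotopy.
Variable R : realType.

Definition is_homotopy (X Y : topologicalType) (f g : X -> Y)
    (H : X * R -> Y) : Prop :=
  [/\ {within [set: X] `*` `[0, 1], continuous H},
      forall x, H (x, 0) = f x & forall x, H (x, 1) = g x].

Definition equivariantly_homotopic (X Y : topologicalType) (nu : X -> X)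
    (tau : Y -> Y) (f g : X -> Y) : Prop :=
  exists H : X * R -> Y, is_homotopy f g H /\
    forall t, 0 <= t <= 1 -> equivariant nu tau (fun x => H (x, t)).

Definition cube n : topologicalType :=
  set_type [set s : 'rV[R]_n | forall i, 0 <= s 0 i <= 1].

Definition cube_boundary n (s : cube n) : Prop :=
  exists i, (val s) 0 i = 0 \/ (val s) 0 i = 1.

Section HomotopyGroup.
Variables (n : nat) (X : topologicalType) (x0 : X).

Definition sphere_map : set (cube n -> X) :=
  [set a | continuous a /\ forall s, cube_boundary s -> a s = x0].

Definition sphere_homotopic (a b : cube n -> X) : Prop :=
  exists H : cube n * R -> X, is_homotopy a b H /\
    forall s t, cube_boundary s -> 0 <= t <= 1 -> H (s, t) = x0.

Definition sphere_class (a : cube n -> X) : set (cube n -> X) :=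
  [set b | sphere_map b /\ sphere_homotopic a b].

(* The underlying set of pi_n(X, x0); for [n = 0], the cube is a point with
   empty boundary and this is the set of path components of X. *)
Definition homotopy_group : set (set (cube n -> X)) :=
  [set sphere_class a | a in sphere_map].

Definition trivial_homotopy_group : Prop :=
  homotopy_group = [set sphere_class (fun=> x0)].
End HomotopyGroup.
Arguments homotopy_group n {X} x0 _.
Arguments trivial_homotopy_group n {X} x0.

Definition homotopy_group_map n (X Y : topologicalType) (x0 : X) (j : X -> Y)
    (c : set (cube n -> X)) : set (cube n -> Y) :=
  [set b | exists2 a, c a & sphere_class (j x0) (j \o a) b].

(* The map induced on pi_n (n >= 1) by a continuous map is a group morphism,
   hence an isomorphism exactly when it is bijective. *)
Definition iso_on_homotopy_group n (X Y : topologicalType) (j : X -> Y) : Prop :=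
  forall x0 : X, set_bij (homotopy_group n x0) (homotopy_group n (j x0))
    (homotopy_group_map x0 j).

Definition disk k : topologicalType :=
  set_type [set x : 'rV[R]_k | \sum_i x 0 i ^+ 2 <= 1].

Definition disk_boundary k (x : disk k) : Prop := \sum_i (val x) 0 i ^+ 2 = 1.

(* [B] is the pushout of the closed subspace [A] of [Y] and the disks
   [E * D^k] along the restrictions of the characteristic maps [Phi e] to the
   boundary spheres; the last clause says that [B] carries the quotient
   topology (and is closed in [Y]). *)
Definition attaches_cells k (Y : topologicalType) (E : Type)
    (Phi : E -> disk k -> Y) (A B : set Y) : Prop :=
  [/\ forall e, continuous (Phi e),
      forall e x, disk_boundary x -> A (Phi e x),
      forall e x, ~ disk_boundary x ->
        ~ A (Phi e x) /\
        (forall e' x', Phi e x = Phi e' x' -> e = e' /\ x = x'),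
      B = A `|` \bigcup_e range (Phi e)
    & forall Z : set Y, Z `<=` B ->
        (closed Z <->
         closed (Z `&` A) /\ forall e, closed (Phi e @^-1` Z))].

(* [Y] is obtained from [X] by attaching cells of dimension at least [d], in
   pairs [(e, true)], [(e, false)] swapped by the involution; [sk m] is the
   relative skeleton of dimension [d + m - 1]. *)
Definition Z2_cell_extension d (X Y : topologicalType) (nu : X -> X)
    (tau : Y -> Y) (j : X -> Y) : Prop :=
  [/\ continuous tau, involutive tau, equivariant nu tau j,
      [/\ continuous j, injective j &
          forall A : set X, closed A -> closed (j @` A)]
    & exists (E : nat -> Type)
        (Phi : forall m, E m * bool -> disk (d + m) -> Y) (sk : nat -> set Y),
      [/\ sk 0%N = range j,
          forall m, attaches_cells (Phi m) (sk m) (sk m.+1),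
          forall m e b x, Phi m (e, ~~ b) x = tau (Phi m (e, b) x),
          \bigcup_m sk m = [set: Y]
        & forall Z : set Y, closed Z <-> forall m, closed (Z `&` sk m)]].

Definition Sigma2_extension (Y : topologicalType) (tau : Y -> Y)
    (j : realization R (Sigma 2) -> Y) : Prop :=
  [/\ Z2_cell_extension 4 (realization_map R (act (Sigma 2))) tau j,
      forall i (y0 : Y), i != 2%N -> trivial_homotopy_group i y0
    & iso_on_homotopy_group 2 j].
End Homotopy.

Definition monomial_map (R : realType) (Y : Type)
    (j : realization R (Sigma 2) -> Y) n (I : {set 'I_n})
    (z : 'I_n -> circle R) : Y :=
  j (iota (circle_prod I z)).

(* Main.v *)
(* Along an increasing chain of Gamma_L^n the colour given by f changes at most twice.  Hence, summed over i, the
   average number of bichromatic edges in direction i at random vertices whose coordinates before i are uniform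
   and whose coordinates after i are uniform and even (or odd before i and uniform after i) is at most a
   constant times L.  Such vertices form antipodally closed edge paths of length 2 L, so if |I| > 8 L^2 then for
   some i in I and some path, f does not depend on the coordinate i over the path.  On the torus
   (path) x (circle of the coordinate i), the map j o |f| is then constant in the second variable while the
   monomial map winds once around the equator, and the homotopy between them is an equivariant map from the
   join S^3 to Y.  As j is an isomorphism on pi_2, it can be replaced by an equivariant map S^3 -> |Sigma^2|,
   which contradicts the Borsuk-Ulam theorem.

   The latter follows from a parity count: a point of |Sigma^2| is a step function on [0, 1] with at most two
   jumps, and a vertex of a fine cubical grid with r odd coordinates is coloured by the majority colour of its
   image on [r/4, (r+1)/4]; small cells then have no flag coloured blue-yellow-blue-yellow, whereas the
   antipodality on the boundary makes the number of such flags odd. *)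
Require Import Defs.
From mathcomp Require Import all_boot all_order all_algebra.
From mathcomp Require Import all_classical all_reals all_analysis.
From mathcomp Require Import complex lra ring zify.
From Stdlib Require Import Relation_Operators.
Set Implicit Arguments.
Unset Strict Implicit.
Unset Printing Implicit Defensive.
Import Order.TTheory GRing.Theory Num.Theory.
Import numFieldNormedType.Exports.

(** * Parity of alternating flags in a grid *)

(** The constant 8 is 2 * 2 * 2: a chain has at most two colour changes, the edges at even and at
    odd coordinates need separate chains, and a path has two kinds of vertices. The factor L^2 comes
    from the L shifts along a path and the L edges of the circle. The contradiction is an equation
    modulo 2. Half of the path sweeps out a based sphere [a] in Y, and the homotopy deforms [a] into
    its antipode surrounded by a sphere of odd degree. As the involution acts by -1 on the second
    homotopy group, this would say 2[a] is odd. To avoid degrees, surjectivity on the second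
    homotopy group replaces [a] by a sphere in |Sigma^2| and injectivity does the same for the
    deformation, which then becomes half of an antipodal map of S^3. The oddness of |I| enters
    because half of the path turns every coordinate except [i] by half a turn: the direction of the
    monomial map returns to itself when |I| - 1 is even. *)

Definition evn i := if odd i then i.+1 else i.
(** With [evn], the two ends of the edge from [i] to [i.+1], named by parity instead of size. *)
Definition odn i := if odd i then i else i.+1.

Lemma evn_le i n : i < n -> ~~ odd n -> evn i <= n.
Proof. by rewrite /evn; case: ifP => // oi; lia. Qed.

Lemma odn_le i n : i < n -> odn i <= n.
Proof. by rewrite /odn; case: ifP => // _; apply: ltnW. Qed.

Lemma xor_telescope (F : nat -> bool) n :
  \big[addb/false]_(i < n) (F i (+) F i.+1) = F 0 (+) F n.
Proof.
elim: n => [|n IH]; first by rewrite big_ord0 addbb.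
by rewrite big_ord_recr /= IH addbA addbK.
Qed.

Lemma xor_exchange n m (F : nat -> nat -> bool) :
  \big[addb/false]_(i < n) \big[addb/false]_(j < m) F i j =
  \big[addb/false]_(j < m) \big[addb/false]_(i < n) F i j.
Proof. exact: exchange_big. Qed.

Definition alternating4 (a b c d : bool) := [&& a (+) b, b (+) c & c (+) d].

(* Colours are booleans, [true] is blue.  A square has a lowest and a highest vertex and two flags; this is
   the number modulo 2 of its flags coloured blue-yellow-blue. *)
Definition sq_count (lo m1 m2 hi : bool) := [&& lo, hi & m1 (+) m2].

(* Coboundary of the cochain of blue-yellow-blue flags: it vanishes on a cube without alternating flags. *)
Lemma cube_count (x000 x100 x010 x001 x110 x101 x011 x111 : bool) :
  ~~ alternating4 x000 x100 x110 x111 -> ~~ alternating4 x000 x100 x101 x111 ->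
  ~~ alternating4 x000 x010 x110 x111 -> ~~ alternating4 x000 x010 x011 x111 ->
  ~~ alternating4 x000 x001 x101 x111 -> ~~ alternating4 x000 x001 x011 x111 ->
  (sq_count x000 x010 x001 x011 (+) sq_count x100 x110 x101 x111) (+)
  (sq_count x000 x100 x001 x101 (+) sq_count x010 x110 x011 x111) (+)
  (sq_count x000 x100 x010 x110 (+) sq_count x001 x101 x011 x111) = false.
Proof.
by case: x000; case: x100; case: x010; case: x001; case: x110; case: x101;
   case: x011; case: x111.
Qed.

(* The flags blue-yellow-blue and yellow-blue-yellow together are the coboundary of the blue-yellow edges. *)
Lemma sq_countN lo m1 m2 hi :
  sq_count lo m1 m2 hi (+) sq_count (~~ lo) (~~ m1) (~~ m2) (~~ hi) =
  ((lo && ~~ m1) (+) (m2 && ~~ hi)) (+) ((lo && ~~ m2) (+) (m1 && ~~ hi)).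
Proof. by case: lo; case: m1; case: m2; case: hi. Qed.

Definition ntype (v : nat * nat * nat) := odd v.1.1 + odd v.1.2 + odd v.2.
Definition in_cell i j k (v : nat * nat * nat) :=
  [&& i <= v.1.1 <= i.+1, j <= v.1.2 <= j.+1 & k <= v.2 <= k.+1].

(* In the cell structure of the grid a vertex lies below its neighbours obtained by moving even coordinates to
   odd ones, so a maximal flag of a cell has vertices with 0, 1, 2, 3 odd coordinates. *)
Section Grid.
Variables (Q P : nat) (c : nat * nat * nat -> bool).
Hypothesis Peven : ~~ odd P.
Hypothesis c_noalt : forall i j k, i < 4 * Q -> j < 4 * Q -> k < P ->
  forall v0 v1 v2 v3, all (in_cell i j k) [:: v0; v1; v2; v3] ->
  ntype v0 = 0 -> ntype v1 = 1 -> ntype v2 = 2 -> ntype v3 = 3 ->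
  ~~ alternating4 (c v0) (c v1) (c v2) (c v3).
(** The sides of the box are yellow; bottom and top agree outside the middle square and are
    antipodal on it. Glued accordingly, the box is a ball with an antipodal colouring of its
    boundary sphere. *)
Hypothesis c_bnd : forall i j k, i <= 4 * Q -> j <= 4 * Q -> k <= P ->
  [|| i == 0, i == 4 * Q, j == 0 | j == 4 * Q] -> c (i, j, k) = false.
Hypothesis c_out : forall i j, i <= 4 * Q -> j <= 4 * Q ->
  [|| i <= Q, 3 * Q <= i, j <= Q | 3 * Q <= j] -> c (i, j, 0) = c (i, j, P).
Hypothesis c_in : forall i j, Q <= i <= 3 * Q -> Q <= j <= 3 * Q ->
  c (i, j, P) = ~~ c (4 * Q - i, 4 * Q - j, 0).

Let qz i j k := sq_count (c (evn i, evn j, k)) (c (odn i, evn j, k))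
  (c (evn i, odn j, k)) (c (odn i, odn j, k)).
Let qy i j k := sq_count (c (evn i, j, evn k)) (c (odn i, j, evn k))
  (c (evn i, j, odn k)) (c (odn i, j, odn k)).
Let qx i j k := sq_count (c (i, evn j, evn k)) (c (i, odn j, evn k))
  (c (i, evn j, odn k)) (c (i, odn j, odn k)).

Let Q4even : ~~ odd (4 * Q). Proof. by rewrite oddM. Qed.

Let swap_evn (F : nat -> bool) i : F (evn i) (+) F (odn i) = F i (+) F i.+1.
Proof. by rewrite /evn /odn; case: odd => //; rewrite addbC. Qed.

(** The corner with even coordinates is the lowest and the one with odd coordinates the highest,
    wherever the cube lies. Sums modulo 2 ignore the order of opposite faces, so [swap_evn] returns
    to consecutive ones. *)
Let cube_sum i j k : i < 4 * Q -> j < 4 * Q -> k < P ->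
  (qx i j k (+) qx i.+1 j k) (+) (qy i j k (+) qy i j.+1 k) (+)
  (qz i j k (+) qz i j k.+1) = false.
Proof.
move=> iQ jQ kP.
rewrite -(swap_evn (fun i => qx i j k)) -(swap_evn (fun j => qy i j k)).
rewrite -(swap_evn (fun k => qz i j k)).
have H := c_noalt iQ jQ kP.
by apply: cube_count; apply: H; rewrite /= /in_cell /ntype /evn /odn /=;
  case oi: (odd i); case oj: (odd j); case ok: (odd k);
  rewrite /= ?oi ?oj ?ok ?leqnn ?leqnSn.
Qed.

Let xor3_split (X Y Z : nat -> nat -> nat -> bool) n m p :
  (forall i j k, i < n -> j < m -> k < p -> X i j k (+) Y i j k (+) Z i j k = false) ->
  (\big[addb/false]_(i < n) \big[addb/false]_(j < m) \big[addb/false]_(k < p) X i j k) (+)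
  (\big[addb/false]_(i < n) \big[addb/false]_(j < m) \big[addb/false]_(k < p) Y i j k) (+)
  (\big[addb/false]_(i < n) \big[addb/false]_(j < m) \big[addb/false]_(k < p) Z i j k) = false.
Proof.
move=> XYZ0; rewrite -!big_split big1//= => i _; rewrite -!big_split big1//= => j _.
by rewrite -!big_split big1//= => k _; rewrite XYZ0.
Qed.

(** In the sum over all cubes inner faces cancel in pairs and the yellow sides count nothing, so
    only bottom and top remain. *)
Let slices_eq :
  \big[addb/false]_(i < 4 * Q) \big[addb/false]_(j < 4 * Q) (qz i j 0 (+) qz i j P) = false.
Proof.
have := xor3_split cube_sum; set SX := (X in X (+) _ (+) _).
set SY := (X in _ (+) X (+) _).
have -> : SX = false.
  rewrite /SX (xor_exchange _ _ (fun i j => \big[addb/false]_(k < P) (qx i j k (+) qx i.+1 j k))) big1//= => j _; rewrite (xor_exchange _ _ (fun i k => (qx i j k (+) qx i.+1 j k))) big1//= => k _.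
  rewrite (xor_telescope (fun i => qx i j k)) /qx /sq_count.
  by rewrite !(c_bnd (i := 0)) ?(c_bnd (i := 4 * Q)) ?eqxx ?orbT ?evn_le ?odn_le.
have -> : SY = false.
  rewrite /SY big1//= => i _; rewrite (xor_exchange _ _ (fun j k => (qy i j k (+) qy i j.+1 k))) big1//= => k _.
  rewrite (xor_telescope (fun j => qy i j k)) /qy /sq_count.
  by rewrite !(c_bnd (j := 0)) ?(c_bnd (j := 4 * Q)) ?eqxx ?orbT ?evn_le ?odn_le.
rewrite !addFb => H; rewrite -[RHS]H; apply: eq_bigr => i _; apply: eq_bigr => j _.
by rewrite (xor_telescope (fun k => qz i j k)).
Qed.

Let xor_mid (F : nat -> bool) : (forall i, i < 4 * Q -> (i < Q) || (3 * Q <= i) -> F i = false) ->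
  \big[addb/false]_(i < 4 * Q) F i = \big[addb/false]_(i < 2 * Q) F (Q + i).
Proof.
move=> F0; rewrite -(big_mkord xpredT F) (@big_cat_nat _ _ _ Q)//=; last by rewrite leq_pmull.
rewrite [X in X (+) _]big1_seq ?addFb; last first.
  by move=> i /= /[!mem_index_iota] iQ; rewrite F0//; lia.
rewrite (@big_cat_nat _ _ _ (3 * Q))//=; try lia.
rewrite [X in _ (+) X]big1_seq ?addbF; last first.
  by move=> i /= /[!mem_index_iota] iQ; rewrite F0//; lia.
rewrite -{1}[Q]add0n big_addn (_ : 3 * Q - Q = 2 * Q); last by lia.
by rewrite big_mkord; apply: eq_bigr => i _; rewrite addnC.
Qed.

Let evn_itv i : i <= evn i <= i.+1.
Proof. by rewrite /evn; case: ifP; rewrite ?leqnSn ?leqnn. Qed.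

Let odn_itv i : i <= odn i <= i.+1.
Proof. by rewrite /odn; case: ifP; rewrite ?leqnSn ?leqnn. Qed.

Let qz_out i j : i < 4 * Q -> j < 4 * Q ->
  [|| i < Q, 3 * Q <= i, j < Q | 3 * Q <= j] -> qz i j 0 (+) qz i j P = false.
Proof.
move=> iQ jQ ij; have := (evn_itv i, odn_itv i, evn_itv j, odn_itv j).
by move=> [[[/andP[? ?] /andP[? ?]] /andP[? ?]] /andP[? ?]];
  rewrite /qz !c_out ?addbb//; lia.
Qed.

Let inner_sum : \big[addb/false]_(i < 2 * Q) \big[addb/false]_(j < 2 * Q)
   (qz (Q + i) (Q + j) 0 (+) qz (Q + i) (Q + j) P) = false.
Proof.
rewrite -[RHS]slices_eq.
rewrite (xor_mid (F := fun i => \big[addb/false]_(j < 4 * Q) (qz i j 0 (+) qz i j P))).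
  apply: eq_bigr => i _.
  rewrite (xor_mid (F := fun j => qz (Q + i) j 0 (+) qz (Q + i) j P))// => j jQ jo.
  by rewrite qz_out//; move: (ltn_ord i) jo; lia.
by move=> i iQ io; rewrite big1// => j _; rewrite qz_out//; move: io; lia.
Qed.

(** The reflection of the middle square preserves parity because [4 * Q] is even, so it carries even
    ends of edges to even ends. *)
Let evn_rev i : i < 2 * Q -> 4 * Q - evn (Q + i) = evn (Q + (2 * Q - i.+1)).
Proof.
move=> iQ; rewrite /evn; have -> : odd (Q + (2 * Q - i.+1)) = ~~ odd (Q + i).
  by rewrite !oddD oddB// oddM /= addbN.
by case: ifP => _ /=; lia.
Qed.

Let odn_rev i : i < 2 * Q -> 4 * Q - odn (Q + i) = odn (Q + (2 * Q - i.+1)).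
Proof.
move=> iQ; rewrite /odn; have -> : odd (Q + (2 * Q - i.+1)) = ~~ odd (Q + i).
  by rewrite !oddD oddB// oddM /= addbN.
by case: ifP => _ /=; lia.
Qed.

Let xor_rev (F : nat -> bool) :
  \big[addb/false]_(i < 2 * Q) F i = \big[addb/false]_(i < 2 * Q) F (2 * Q - i.+1).
Proof. by rewrite (reindex_inj rev_ord_inj). Qed.

Let mid_itv i : i < 2 * Q -> (Q <= evn (Q + i) <= 3 * Q) * (Q <= odn (Q + i) <= 3 * Q).
Proof.
move=> iQ; have := (evn_itv (Q + i), odn_itv (Q + i)).
by move=> [/andP[? ?] /andP[? ?]]; split; lia.
Qed.

Let c0 i j := c (i, j, 0).

(** By [c_in] the blue-yellow-blue flags of the top are the reflected yellow-blue-yellow flags of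
    the bottom. *)
Let inner_sumN : \big[addb/false]_(i < 2 * Q) \big[addb/false]_(j < 2 * Q)
   (sq_count (c0 (evn (Q + i)) (evn (Q + j))) (c0 (odn (Q + i)) (evn (Q + j)))
             (c0 (evn (Q + i)) (odn (Q + j))) (c0 (odn (Q + i)) (odn (Q + j))) (+)
    sq_count (~~ c0 (evn (Q + i)) (evn (Q + j))) (~~ c0 (odn (Q + i)) (evn (Q + j)))
     (~~ c0 (evn (Q + i)) (odn (Q + j))) (~~ c0 (odn (Q + i)) (odn (Q + j)))) = false.
Proof.
rewrite -[RHS]inner_sum; under eq_bigr => i _ do rewrite big_split /=.
under [RHS]eq_bigr => i _ do rewrite big_split /=.
rewrite !big_split /=; congr (_ (+) _).
pose G i j := qz (Q + i) (Q + j) P.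
rewrite [RHS](xor_rev (fun i => \big[addb/false]_(j < 2 * Q) G i j)).
apply: eq_bigr => i _; rewrite [RHS](xor_rev (G _)).
apply: eq_bigr => j _; have iQ := ltn_ord i; have jQ := ltn_ord j.
rewrite /G /qz -!(evn_rev iQ, odn_rev iQ, evn_rev jQ, odn_rev jQ).
have [/andP[? ?] /andP[? ?]] := mid_itv iQ.
have [/andP[? ?] /andP[? ?]] := mid_itv jQ.
by rewrite !c_in ?subKn//; lia.
Qed.

(** On the rim of the middle square both [c_out] and [c_in] apply. *)
Let bnd_antipode i j : Q <= i <= 3 * Q -> Q <= j <= 3 * Q ->
  [|| i == Q, i == 3 * Q, j == Q | j == 3 * Q] -> c0 (4 * Q - i) (4 * Q - j) = ~~ c0 i j.
Proof.
move=> iQ jQ ij; rewrite /c0 (c_out (i := i)) ?c_in ?negbK//; lia.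
Qed.

(** The coboundary formula leaves the blue-yellow edges on the rim. Opposite sides are antipodal, so
    together they count the colour changes along one side. The two sides that meet at (Q, Q) then
    compare the colours of (3Q, Q) and (Q, 3Q), which are antipodal and hence different, whereas the
    sum vanishes. *)
Lemma grid_parity : 0 < Q -> False.
Proof.
move=> Q0; move: inner_sumN.
under eq_bigr => i _ do under eq_bigr => j _ do rewrite sq_countN.
pose ex i j := c0 (evn i) j && ~~ c0 (odn i) j.
pose ey i j := c0 i (evn j) && ~~ c0 i (odn j).
have -> : \big[addb/false]_(i < 2 * Q) \big[addb/false]_(j < 2 * Q)
  ((ex (Q + i) (evn (Q + j)) (+) ex (Q + i) (odn (Q + j))) (+)
   (ey (evn (Q + i)) (Q + j) (+) ey (odn (Q + i)) (Q + j))) =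
  \big[addb/false]_(i < 2 * Q) (ex (Q + i) Q (+) ex (Q + i) (3 * Q)) (+)
  \big[addb/false]_(j < 2 * Q) (ey Q (Q + j) (+) ey (3 * Q) (Q + j)).
  under eq_bigr => i _ do rewrite big_split /=.
  rewrite big_split /=; congr (_ (+) _).
    apply: eq_bigr => i _; under eq_bigr => j _.
      rewrite (swap_evn (ex (Q + i))) -addnS; over.
    by rewrite (xor_telescope (fun j => ex (Q + i) (Q + j))) addn0 -mulSn.
  rewrite (xor_exchange _ _ (fun i j => ey (evn (Q + i)) (Q + j) (+) ey (odn (Q + i)) (Q + j))).
  apply: eq_bigr => j _; under eq_bigr => i _.
    rewrite (swap_evn (fun i => ey i (Q + j))) -addnS; over.
  by rewrite (xor_telescope (fun i => ey (Q + i) (Q + j))) addn0 -mulSn.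
have Q3 : Q + 2 * Q = 3 * Q by lia.
have Qi : 4 * Q - Q = 3 * Q by lia.
have -> : \big[addb/false]_(i < 2 * Q) (ex (Q + i) Q (+) ex (Q + i) (3 * Q)) =
  c0 Q Q (+) c0 (3 * Q) Q.
  rewrite big_split /= (xor_rev (fun i => ex (Q + i) (3 * Q))) -big_split /=.
  have := xor_telescope (fun i => c0 (Q + i) Q) (2 * Q); rewrite addn0 Q3 => <-.
  apply: eq_bigr => i _; have iQ := ltn_ord i.
  rewrite addnS -(swap_evn (fun i => c0 i Q)) /ex -evn_rev// -odn_rev// -Qi.
  have [? ?] := mid_itv iQ.
  by rewrite !bnd_antipode//; [case: c0; case: c0|lia..].
have -> : \big[addb/false]_(j < 2 * Q) (ey Q (Q + j) (+) ey (3 * Q) (Q + j)) =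
  c0 Q Q (+) c0 Q (3 * Q).
  rewrite big_split /= (xor_rev (fun j => ey (3 * Q) (Q + j))) -big_split /=.
  have := xor_telescope (fun j => c0 Q (Q + j)) (2 * Q); rewrite addn0 Q3 => <-.
  apply: eq_bigr => i _; have iQ := ltn_ord i.
  rewrite addnS -(swap_evn (c0 Q)) /ey -evn_rev// -odn_rev// -Qi.
  have [? ?] := mid_itv iQ.
  by rewrite !bnd_antipode//; [case: c0; case: c0|lia..].
have : c0 (4 * Q - Q) (4 * Q - 3 * Q) = ~~ c0 Q (3 * Q) by apply: bnd_antipode; lia.
rewrite Qi (_ : 4 * Q - 3 * Q = Q); last by lia.
by move=> ->; case: c0; case: c0.
Qed.
End Grid.

(** * Insensitive coordinates *)


Local Open Scope ring_scope.
Section EvenCycle.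
Variable L : nat.
Hypotheses (L4 : (4 %| L)%N) (L_ge4 : (4 <= L)%N).

Definition gle (a b : 'Z_L) := (a == b) || Gamma_prec a b.

Lemma Zp_truncK : (Zp_trunc L).+2 = L.
Proof. by rewrite Zp_cast// (leq_trans _ L_ge4). Qed.

Lemma card_ZL : #|{: 'Z_L}| = L.
Proof. by rewrite card_ord Zp_truncK. Qed.

Lemma evenL : odd L = false.
Proof. by case/dvdnP: L4 => k ->; rewrite oddM andbF. Qed.

Lemma odd_modL x : odd (x %% L) = odd x.
Proof. by rewrite [in RHS](divn_eq x L) oddD oddM evenL andbF. Qed.

Lemma odd_ZpD (a b : 'Z_L) : odd (a + b)%R = odd a (+) odd b.
Proof. by rewrite /= [X in (_ %% X)%N]Zp_truncK odd_modL oddD. Qed.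

Lemma odd_ZpS (a : 'Z_L) : odd (a + 1)%R = ~~ odd a.
Proof. by rewrite odd_ZpD /= addbT. Qed.

Lemma odd_ZpP (a : 'Z_L) : odd (a - 1)%R = ~~ odd a.
Proof. by rewrite -[in RHS](subrK 1 a) odd_ZpS negbK. Qed.

(** Rounding down to an even and up to an odd residue. Both [evz a] and [evz (a + 1)] lie below [a],
    and [odz a] lies above [a] and [a + 1]; this makes consecutive vertices of the edge path
    comparable. *)
Definition evz (a : 'Z_L) : 'Z_L := if odd a then a - 1 else a.
Definition odz (a : 'Z_L) : 'Z_L := if odd a then a else a + 1.

Lemma gle_refl a : gle a a. Proof. by rewrite /gle eqxx. Qed.

Lemma gle_evz a : gle (evz a) a.
Proof.
rewrite /gle /evz /Gamma_prec; case: ifP => oa; rewrite ?eqxx//.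
by rewrite odd_ZpP ?oa/= addrAC subrr sub0r eqxx !orbT.
Qed.

Lemma gle_evzS a : gle (evz (a + 1)) a.
Proof.
rewrite /gle /evz /Gamma_prec odd_ZpS; case: ifP => oa; rewrite ?addrK ?eqxx//.
by move/negbFE: oa => oa; rewrite odd_ZpS ?oa/= addrAC subrr add0r eqxx !orbT.
Qed.

Lemma gle_odz a : gle a (odz a).
Proof.
rewrite /gle /odz /Gamma_prec; case: ifP => oa; rewrite ?eqxx//.
by rewrite ?oa odd_ZpS ?oa/= opprD addNKr eqxx !orbT.
Qed.

Lemma gle_odzS a : gle (a + 1) (odz a).
Proof.
rewrite /gle /odz /Gamma_prec; case: ifP => oa; rewrite ?eqxx//.
by rewrite odd_ZpS ?oa/= addrAC subrr add0r eqxx !orbT.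
Qed.

Lemma evzD (a b : 'Z_L) : ~~ odd b -> evz (a + b) = evz a + b.
Proof.
by move=> ob; rewrite /evz odd_ZpD (negbTE ob) addbF; case: ifP => // _; rewrite addrAC.
Qed.

Lemma odzD (a b : 'Z_L) : ~~ odd b -> odz (a + b) = odz a + b.
Proof.
by move=> ob; rewrite /odz odd_ZpD (negbTE ob) addbF; case: ifP => // _; rewrite addrAC.
Qed.

Section Count.
Variables (n : nat) (f : simplicialMap (power n (Gamma L4)) (Sigma 2)).

Notation V := {ffun 'I_n -> 'Z_L}.
Let fv (x : V) : bool := f x.

(** The vertices [c k] raise one coordinate at a time, so they form a simplex of the product, and
    its image in [Sigma 2] alternates at most twice. *)
Lemma chain_alternations (lo hi : 'I_n -> 'Z_L) : (forall j, gle (lo j) (hi j)) ->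
  let c (k : nat) : V := [ffun j : 'I_n => if (j < k)%N then hi j else lo j] in
  is_true (\sum_(i < n) (fv (c i) != fv (c i.+1)) <= 2)%N.
Proof.
move=> lohi c; pose u : {ffun 'I_n.+1 -> vert (power n (Gamma L4))} := [ffun k : 'I_n.+1 => c k].
have uP : u \in simp (power n (Gamma L4)) n.
  rewrite inE; apply/forallP => j; rewrite inE; apply/'forall_forallP => k k'.
  apply/implyP => kk'; rewrite !ffunE /=.
  have := lohi j; rewrite /gle; case: ifP => jk; case: ifP => jk'; rewrite ?eqxx//.
  by rewrite (leq_trans jk kk') in jk'.
have := vmap_simp f uP; rewrite inE /alternations; apply: leq_trans.
apply: leq_sum => i _; rewrite !ffunE !inordK// ltnS; first exact: ltn_ord.
exact: ltnW.
Qed.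

Section Half.
Variables (l h : 'Z_L -> 'Z_L) (d1 d2 t : 'Z_L) (P : pred 'Z_L).
Hypothesis lh : forall a, gle (l a) (h a).
Hypothesis edge : forall a, P a ->
  (l (a + t) = a /\ h (a + t) = a + 1) \/ (l (a + t) = a + 1 /\ h (a + t) = a).

Definition wpoint (l0 h0 : 'Z_L -> 'Z_L) (i : 'I_n) (s : V) (w : 'Z_L) : V :=
  [ffun j : 'I_n => if (j < i)%N then h0 (s j) else if j == i then w else l0 (s j)].

(* In a chain raising the coordinates one after the other, the step at [i] is the edge in direction [i] at the
   vertex whose coordinates are raised before [i] and not yet raised after [i]; the shifts [d1], [d2], [t] of
   the coordinates do not change the average over [s]. *)
Lemma half_count (l0 h0 : 'Z_L -> 'Z_L) :
  (forall a, l0 a = l (a + d1)) -> (forall a, h0 a = h (a + d2)) ->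
  (\sum_i \sum_(s : V | P (s i))
    (fv (wpoint l0 h0 i s (s i)) != fv (wpoint l0 h0 i s (s i + 1)%R))
   <= 2 * L ^ n)%N.
Proof.
move=> l0E h0E.
pose c (s : V) (k : nat) : V := [ffun j : 'I_n => if (j < k)%N then h (s j) else l (s j)].
apply: (@leq_trans (\sum_(i < n) \sum_(s : V) (fv (c s i) != fv (c s i.+1)))%N).
  apply: leq_sum => i _.
  pose sh (s : V) : V := [ffun j : 'I_n => s j + if (j < i)%N then d2 else if j == i then t else d1].
  have sh_inj : injective sh.
    by move=> s s' /ffunP ss'; apply/ffunP => j; have := ss' j; rewrite !ffunE => /addIr.
  rewrite [leqRHS](reindex_inj sh_inj) /= [leqRHS](bigID (fun s : V => P (s i))) /=.
  apply: leq_trans (leq_addr _ _); apply: leq_sum => s Ps.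
  have c1 : c (sh s) i = wpoint l0 h0 i s (l (s i + t)).
    apply/ffunP => j; rewrite !ffunE l0E h0E; have [ji|ij]//= := ltnP j i.
    by have [->|] := eqVneq j i.
  have c2 : c (sh s) i.+1 = wpoint l0 h0 i s (h (s i + t)).
    apply/ffunP => j; rewrite !ffunE l0E h0E ltnS leq_eqVlt.
    by case: (ltngtP j i) => [//|ji|/val_inj->] /=; rewrite ?eqxx//; case: eqP ji => // ->; rewrite ltnn.
  by rewrite c1 c2; case: (edge Ps) => -[-> ->]//; rewrite eq_sym.
rewrite exchange_big /=.
apply: (@leq_trans (\sum_(s : V) 2)).
  apply: leq_sum => s _; apply: (@chain_alternations (l \o s) (h \o s)).
  by move=> j; exact: lh.
by rewrite sum_nat_const card_ffun card_ZL card_ord mulnC.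
Qed.
End Half.

Let sens (l0 h0 : 'Z_L -> 'Z_L) (i : 'I_n) (s : V) w :=
  fv (wpoint l0 h0 i s w) != fv (wpoint l0 h0 i s (w + 1)).

(** The edge from [s i] to [s i + 1] goes up if [s i] is even and down if it is odd. The step of a
    chain at [i] yields only one of the two kinds, so two chains are used, each contributing
    [2 * L ^ n]. *)
Lemma sensitivity_evz :
  (\sum_i \sum_(s : V) sens evz id i s (s i) <= 4 * L ^ n)%N.
Proof.
rewrite (eq_bigr _ (fun i _ => bigID (fun s : V => ~~ odd (s i)) _ _)) big_split /=.
rewrite (_ : 4 = 2 + 2)%N// mulnDl leq_add//.
  apply: (@half_count evz id 0 0 1 (fun a => ~~ odd a)) => [a|a oa|a|a]; rewrite ?addr0//.
    exact: gle_evz.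
  by left; rewrite /evz odd_ZpS oa addrK.
rewrite (eq_bigr _ (fun i _ => eq_bigl _ _ (fun s : V => negbK _))).
apply: (@half_count (fun a => evz (a + 1)) id (-1) 0 0 (fun a : 'Z_L => odd a)) => [a|a oa|a|a]; rewrite ?addr0 ?subrK//.
  exact: gle_evzS.
by right; rewrite /evz odd_ZpS oa.
Qed.

Lemma sensitivity_odz :
  (\sum_i \sum_(s : V) sens id odz i s (s i) <= 4 * L ^ n)%N.
Proof.
rewrite (eq_bigr _ (fun i _ => bigID (fun s : V => ~~ odd (s i)) _ _)) big_split /=.
rewrite (_ : 4 = 2 + 2)%N// mulnDl leq_add//.
  apply: (@half_count id odz 0 0 0 (fun a => ~~ odd a)) => [a|a oa|a|a]; rewrite ?addr0//.
    exact: gle_odz.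
  by left; rewrite /odz (negbTE oa).
rewrite (eq_bigr _ (fun i _ => eq_bigl _ _ (fun s : V => negbK _))).
apply: (@half_count id (fun a => odz (a - 1)) 0 1 1 (fun a : 'Z_L => odd a)) => [a|a oa|a|a]; rewrite ?addr0 ?addrK//.
  by rewrite -{1}[a](subrK 1); exact: gle_odzS.
by right; rewrite /odz oa.
Qed.

(** The diagonal shift by [m] and the shift of the coordinate [i] alone permute the vertices, and
    [sens] does not see the coordinate [i] of its vertex; hence all [L ^ 2] pairs contribute
    equally. *)
Lemma sum_sens_all (l0 h0 : 'Z_L -> 'Z_L) i :
  (\sum_(s : V) \sum_(m : 'Z_L) \sum_(w : 'Z_L) sens l0 h0 i [ffun j => (s j + m)%R] w =
   L ^ 2 * \sum_(s : V) sens l0 h0 i s (s i))%N.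
Proof.
rewrite exchange_big /=.
rewrite (eq_bigr (fun _ => \sum_(s : V) \sum_(w : 'Z_L) sens l0 h0 i s w))%N; last first.
  move=> m _; rewrite [RHS](reindex_inj (h := fun s : V => [ffun j => s j + m] : V))//=.
  by move=> s s' /ffunP ss'; apply/ffunP => j; have := ss' j; rewrite !ffunE => /addIr.
rewrite sum_nat_const card_ZL expnS expn1 -mulnA; congr (_ * _)%N.
transitivity (\sum_(s : V) \sum_(w : 'Z_L) sens l0 h0 i s (s i + w)%R)%N.
  by apply: eq_bigr => s _; rewrite (reindex_inj (addrI (s i))).
rewrite exchange_big /= (eq_bigr (fun _ => \sum_(s : V) sens l0 h0 i s (s i)))%N; last first.
  move=> w _; pose sh (s : V) : V := [ffun j : 'I_n => if j == i then s j + w else s j].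
  rewrite [RHS](reindex_inj (h := sh))/=; last first.
    move=> s s' /ffunP ss'; apply/ffunP => j; have := ss' j; rewrite !ffunE.
    by case: ifP => // _ /addIr.
  apply: eq_bigr => s _; rewrite /sens ffunE eqxx.
  have E x : wpoint l0 h0 i (sh s) x = wpoint l0 h0 i s x.
    apply/ffunP => j; rewrite !ffunE; case: eqP => [->|//].
    by rewrite ltnn.
  by rewrite !E.
by rewrite sum_nat_const card_ZL.
Qed.

Definition evpoint := wpoint evz id.
Definition odpoint := wpoint id odz.

Lemma Zp_step_const (T : eqType) (g : 'Z_L -> T) :
  (forall w, g w = g (w + 1)) -> forall w w', g w = g w'.
Proof.
move=> gS; have g0 w : g w = g 0.
  rewrite -[w]natr_Zp; elim: (w : nat) => [//|k IH].
  by rewrite -IH mulrS addrC -gS.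
by move=> w w'; rewrite !g0.
Qed.

(** The shifts [m] of a single [s] give all the vertices of a path, which alternates between
    [evpoint] and [odpoint]. *)
Lemma insensitive_direction (I : {set 'I_n}) : (8 * L ^ 2 < #|I|)%N ->
  exists2 i, i \in I & exists s : V, forall m w w',
    fv (evpoint i [ffun j => s j + m] w) = fv (evpoint i [ffun j => s j + m] w') /\
    fv (odpoint i [ffun j => s j + m] w) = fv (odpoint i [ffun j => s j + m] w').
Proof.
move=> bigI.
pose bad l0 h0 i (s : V) := (\sum_(m : 'Z_L) \sum_(w : 'Z_L) sens l0 h0 i [ffun j => (s j + m)%R] w)%N.
pose tot i s := (bad evz id i s + bad id odz i s)%N.
have bad0 l0 h0 i s : bad l0 h0 i s = 0%N -> forall m w w',
    fv (wpoint l0 h0 i [ffun j => s j + m] w) = fv (wpoint l0 h0 i [ffun j => s j + m] w').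
  move=> /eqP; rewrite sum_nat_eq0 => /forallP b0 m.
  apply: (Zp_step_const (g := fun w => fv (wpoint l0 h0 i [ffun j => s j + m] w))) => w.
  by have := b0 m; rewrite sum_nat_eq0 => /forallP/(_ w); rewrite /sens eqb0 negbK => /eqP.
have [/existsP[i /andP[iI /existsP[s /eqP]]]|] := boolP [exists i, (i \in I) && [exists s : V, tot i s == 0%N]].
  move=> /eqP; rewrite addn_eq0 => /andP[/eqP b1 /eqP b2].
  by exists i => //; exists s => m w w'; split; apply: bad0.
rewrite negb_exists => /forallP nex; exfalso.
(* If no pair works, every [i] in [I] and every [s] account for at least one bichromatic edge. *)
have ge1 : (#|I| * L ^ n <= \sum_(i in I) \sum_(s : V) tot i s)%N.
  rewrite -sum_nat_const; apply: leq_sum => i iI.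
  rewrite -[X in (X <= _)%N]mul1n -{1}card_ZL -[X in (_ ^ X)%N](card_ord n) -card_ffun mulnC.
  rewrite -sum_nat_const; apply: leq_sum => s _; rewrite lt0n.
  by have := nex i; rewrite iI negb_exists => /forallP.
have le8 : (\sum_(i in I) \sum_(s : V) tot i s <= 8 * L ^ 2 * L ^ n)%N.
  apply: (@leq_trans (\sum_i \sum_(s : V) tot i s)%N).
    by rewrite [leqRHS](bigID (mem I)) leq_addr.
  under eq_bigr => i _ do rewrite big_split /= !sum_sens_all -mulnDr.
  rewrite -big_distrr /= big_split /= (_ : 8 = 4 + 4)%N// -mulnA [(_ * (L ^ 2 * _))%N]mulnCA leq_mul2l.
  by rewrite mulnDl leq_add ?orbT ?sensitivity_evz ?sensitivity_odz.
have := leq_trans ge1 le8; rewrite leq_pmul2r ?expn_gt0; last by rewrite (leq_trans _ L_ge4).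
by rewrite leqNgt bigI.
Qed.

End Count.
End EvenCycle.

(** * Pasting of continuous maps *)


Local Open Scope classical_set_scope.
Section RealContinuity.
Variables (R : realType) (T : topologicalType).
Implicit Types f g : T -> R.

Lemma contD f g : continuous f -> continuous g -> continuous (fun x => f x + g x).
Proof. by move=> cf cg x; apply: cvgD; [exact: cf|exact: cg]. Qed.

Lemma contN f : continuous f -> continuous (fun x => - f x).
Proof. by move=> cf x; apply: cvgN; exact: cf. Qed.

Lemma contM f g : continuous f -> continuous g -> continuous (fun x => f x * g x).
Proof. by move=> cf cg x; apply: cvgM; [exact: cf|exact: cg]. Qed.

Lemma cont_norm f : continuous f -> continuous (fun x => `|f x|).
Proof. by move=> cf x; apply: cvg_norm; exact: cf. Qed.

Lemma cont_min f g : continuous f -> continuous g -> continuous (fun x => Num.min (f x) (g x)).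
Proof. by move=> cf cg x; apply: continuous_min; [exact: cf|exact: cg]. Qed.

Lemma cont_max f g : continuous f -> continuous g -> continuous (fun x => Num.max (f x) (g x)).
Proof. by move=> cf cg x; apply: continuous_max; [exact: cf|exact: cg]. Qed.

Lemma cont_cst (Y : topologicalType) (c : Y) : continuous (fun _ : T => c).
Proof. by move=> x; exact: cvg_cst. Qed.

Lemma cont_sum (I : Type) (r : seq I) (P : pred I) (F : I -> T -> R) :
  (forall i, continuous (F i)) -> continuous (fun x => \sum_(i <- r | P i) F i x).
Proof.
move=> cF; elim: r => [|i r IH].
  by under eq_fun do rewrite big_nil; exact: cont_cst.
under eq_fun do rewrite big_cons; case: (P i) => //.
exact: contD.
Qed.

End RealContinuity.

Lemma cont_comp (T U V : topologicalType) (f : T -> U) (g : U -> V) :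
  continuous f -> continuous g -> continuous (fun x => g (f x)).
Proof. by move=> cf cg x; apply: continuous_comp; [exact: cf|exact: cg]. Qed.

Lemma cont_pair (T U V : topologicalType) (f : T -> U) (g : T -> V) :
  continuous f -> continuous g -> continuous (fun x => (f x, g x)).
Proof. by move=> cf cg x; apply: cvg_pair; [exact: cf|exact: cg]. Qed.

Lemma cont_fst (T U V : topologicalType) (f : T -> U * V) :
  continuous f -> continuous (fun x => (f x).1).
Proof. by move=> cf; apply: (cont_comp cf) => x; exact: cvg_fst. Qed.

Lemma cont_snd (T U V : topologicalType) (f : T -> U * V) :
  continuous f -> continuous (fun x => (f x).2).
Proof. by move=> cf; apply: (cont_comp cf) => x; exact: cvg_snd. Qed.

Lemma cont_id (T : topologicalType) : continuous (fun x : T => x).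
Proof. by move=> x; exact: cvg_id. Qed.

Ltac cont := repeat match goal with
  | H : forall y, continuous_at y ?f |- forall y, continuous_at y ?f => exact: H
  | H : forall y, continuous_at y ?f |- forall y, continuous_at y (fun x => ?f x) => exact: H
  | |- forall y, continuous_at y (fun _ => ?c) => exact: cont_cst
  | |- forall y, continuous_at y (fun x => x) => exact: cont_id
  | |- forall y, continuous_at y fst => exact: (cont_fst (@cont_id _))
  | |- forall y, continuous_at y snd => exact: (cont_snd (@cont_id _))
  | |- forall y, continuous_at y (fun x => (@?f x + @?g x)%R) => apply: (@contD _ _ f g)
  | |- forall y, continuous_at y (fun x => (- @?f x)%R) => apply: (@contN _ _ f)
  | |- forall y, continuous_at y (fun x => (@?f x * @?g x)%R) => apply: (@contM _ _ f g)
  | |- forall y, continuous_at y (fun x => `|@?f x|%R) => apply: (@cont_norm _ _ f)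
  | |- forall y, continuous_at y (fun x => Num.min (@?f x) (@?g x)) => apply: (@cont_min _ _ f g)
  | |- forall y, continuous_at y (fun x => Num.max (@?f x) (@?g x)) => apply: (@cont_max _ _ f g)
  | |- forall y, continuous_at y (fun x => (@?f x, @?g x)) => apply: (@cont_pair _ _ _ f g)
  | |- forall y, continuous_at y (fun x => (@?f x).1) => apply: (@cont_fst _ _ _ f)
  | |- forall y, continuous_at y (fun x => (@?f x).2) => apply: (@cont_snd _ _ _ f)
  end.

Section Paste.
Variables (R : realType) (T Y : topologicalType).

(** Each piece has to be continuous only where it is used; this matters for pieces in polar
    coordinates, which may be discontinuous at the origin. *)
Lemma paste_at (h : T -> R) (f g : T -> Y) (x : T) :
  {for x, continuous h} ->
  (h x <= 0 -> {for x, continuous f}) -> (0 <= h x -> {for x, continuous g}) ->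
  (h x = 0 -> f x = g x) ->
  {for x, continuous (fun y => if h y <= 0 then f y else g y)}.
Proof.
move=> ch cf cg fg U /=; have [hx0|hx0|hx0] := ltgtP (h x) 0 => xU.
- have hy : \forall y \near x, h y < 0 by apply: (cvgr_lt (h x)); [exact: ch|].
  have fU : nbhs x (f @^-1` U) := cf (ltW hx0) _ xU.
  by apply: filterS2 hy fU => y /= hy fU; rewrite ltW.
- have hy : \forall y \near x, 0 < h y by apply: (cvgr_gt (h x)); [exact: ch|].
  have gU : nbhs x (g @^-1` U) := cg (ltW hx0) _ xU.
  by apply: filterS2 hy gU => y /= hy gU; rewrite leNgt hy.
- have [hx1 hx2] : h x <= 0 /\ 0 <= h x by rewrite hx0.
  have fU : nbhs x (f @^-1` U) := cf hx1 U xU; rewrite (fg hx0) in xU.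
  have gU : nbhs x (g @^-1` U) := cg hx2 U xU.
  by apply: filterS2 fU gU => y /= fU gU; case: ifP.
Qed.

Lemma paste (h : T -> R) (f g : T -> Y) :
  continuous h -> continuous f -> continuous g ->
  (forall x, h x = 0 -> f x = g x) ->
  continuous (fun y => if h y <= 0 then f y else g y).
Proof.
move=> ch cf cg fg x; apply: paste_at => //; [exact: ch| | |exact: fg].
  by move=> _; exact: cf.
by move=> _; exact: cg.
Qed.

(* The pieces [P 0], ..., [P N] are glued along [h]: [P k] is used where [k <= h <= k + 1], and the extreme pieces
   also beyond. *)
Fixpoint concat (h : T -> R) (P : nat -> T -> Y) N : T -> Y :=
  if N is k.+1 then fun x => if h x - k.+1%:R <= 0 then concat h P k x else P k.+1 x
  else P 0.

Lemma concatE (h : T -> R) (P : nat -> T -> Y) N k x : (forall k x, h x = k.+1%:R -> P k x = P k.+1 x) ->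
  (k <= N)%N -> k%:R <= h x -> (h x <= k.+1%:R \/ k = N) -> concat h P N x = P k x.
Proof.
move=> PP; elim: N k => [|N IH] k /=; first by rewrite leqn0 => /eqP->.
rewrite leq_eqVlt => /orP[/eqP->|kN] kh hk.
  rewrite subr_le0; case: ifP => // hN.
  have hE : h x = N.+1%:R by apply/eqP; rewrite eq_le hN.
  rewrite -(PP _ _ hE); apply: IH => //; first by rewrite hE ler_nat.
  by left; rewrite hE.
case: hk => [hk|kE]; last by rewrite kE ltnn in kN.
rewrite subr_le0 (le_trans hk) ?ler_nat//; apply: IH => //; by left.
Qed.

Lemma concat_continuous (h : T -> R) (P : nat -> T -> Y) N : continuous h -> (forall k, continuous (P k)) ->
  (forall k x, h x = k.+1%:R -> P k x = P k.+1 x) -> continuous (concat h P N).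
Proof.
move=> ch cP PP; elim: N => [|N IH]/=; first exact: cP.
apply: paste => //; first by cont.
move=> x /eqP; rewrite subr_eq0 => /eqP hx.
rewrite -(PP _ _ hx); apply: (concatE PP) => //; first by rewrite hx ler_nat.
by left; rewrite hx.
Qed.
End Paste.

(* Polar coordinates: at the origin [x0] the angle [u] is discontinuous and only the compactness of its range
   is used. *)
Lemma tube_at (R : realType) (T Y : topologicalType) (N : T * R -> Y) (u : T -> R) (a b : R) (x0 : T) :
  continuous N -> (forall x, a <= u x <= b) -> (forall w, N (x0, w) = N (x0, u x0)) ->
  {for x0, continuous (fun x => N (x, u x))}.
Proof.
move=> cN uab Nx0 U /= xU.
have /compact_near_coveringP cpt := @segment_compact R a b.
have H : \forall x \near x0, `[a, b] `<=` [set w | U (N (x, w))].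
  apply: (cpt T (nbhs x0) (fun x w => U (N (x, w))) _) => w _.
  have NU : nbhs (N (x0, w)) U by rewrite Nx0.
  have [[A B] /= [xA wB] AB] := cN (x0, w) U NU.
  exists (B, A) => //= -[w' x] /= [Bw Ax]; exact: (AB (x, w')).
apply: filterS H => x /(_ (u x)) /=.
by rewrite in_itv /= uab; exact.
Qed.

(** * Points of realizations *)

Section Points.
Variable R : realType.

Lemma Delta_vertex n : (delta_mx 0 0 : 'rV[R]_n.+1) \in @Delta_set R n.
Proof.
apply/mem_set; split=> [i|]; first by rewrite mxE ler0n.
rewrite (bigD1 0)//= big1 ?addr0 ?mxE ?eqxx// => i i0.
by rewrite mxE (negbTE i0) andbF.
Qed.

Definition to_Delta n (v : 'rV[R]_n.+1) : Delta R n :=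
  insubd (@exist _ (fun t => t \in @Delta_set R n) _ (Delta_vertex n) : Delta R n) v.

Lemma to_DeltaK n (v : 'rV[R]_n.+1) : @Delta_set R n v -> val (to_Delta v) = v.
Proof. by move=> vD; rewrite val_insubd mem_set. Qed.

Lemma to_Delta_val n (t : Delta R n) : to_Delta (val t) = t.
Proof. exact: valKd. Qed.

Lemma rV_continuous (T : topologicalType) n (g : T -> 'rV[R]_n) :
  (forall i, continuous (fun x => g x 0 i)) -> continuous g.
Proof.
move=> cg x U /= [P Px PU].
have : \forall y \near x, forall j, P 0 j (g y 0 j).
  apply: filter_forall => j; apply: (cg j); exact: Px.
by apply: filterS => y Py; apply: PU => i j; rewrite (ord1 i).
Qed.

Lemma to_Delta_continuous (T : topologicalType) n (g : T -> 'rV[R]_n.+1) :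
  (forall x, @Delta_set R n (g x)) -> (forall i, continuous (fun x => g x 0 i)) ->
  continuous (fun x => to_Delta (g x)).
Proof.
move=> gD cg; apply: continuous_comp_initial => /=.
rewrite (_ : _ \o _ = g); first exact: rV_continuous.
by apply/funext => x; exact: (to_DeltaK (gD x)).
Qed.

Section X.
Variable X : relSSet.

Lemma const_simp (x : vert X) n : [ffun _ : 'I_n.+1 => x] \in simp X n.
Proof.
rewrite (_ : [ffun _ => x] = [ffun i : 'I_n.+1 => [ffun _ : 'I_1 => x] ((fun=> ord0) i)]).
  by apply: simp_reindex => //; exact: simp_vert.
by apply/ffunP => i; rewrite !ffunE.
Qed.

(* Total versions of cells, which avoid carrying membership proofs; the defaults are never used. *)
Definition to_simplex n (u : {ffun 'I_n.+1 -> vert X}) : nsimplex X n :=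
  insubd (@exist _ (fun u => u \in simp X n) _ (const_simp (u ord0) n) : nsimplex X n) u.

Lemma to_simplexK n (u : {ffun 'I_n.+1 -> vert X}) :
  u \in simp X n -> val (to_simplex u) = u.
Proof. by move=> uX; rewrite val_insubd uX. Qed.

Definition pt n (u : {ffun 'I_n.+1 -> vert X}) (v : 'rV[R]_n.+1) : realization R X :=
  point_of (mkcell (to_simplex u) (to_Delta v)).

Lemma pt_val n (u : nsimplex X n) (t : Delta R n) :
  point_of (mkcell u t) = pt (val u) (val t).
Proof.
rewrite /pt to_Delta_val (_ : to_simplex (val u) = u)//.
by apply: val_inj; rewrite to_simplexK//; exact: valP.
Qed.

Lemma pt_surj (p : realization R X) :
  exists n (u : {ffun 'I_n.+1 -> vert X}) (v : 'rV[R]_n.+1),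
    [/\ u \in simp X n, @Delta_set R n v & p = pt u v].
Proof.
have : p = point_of (repr p) by rewrite /point_of reprK.
case: (repr p) => -[n u] t -> /=; exists n, (val u), (val t); split.
- exact: valP.
- by have /set_mem := valP t.
exact: pt_val.
Qed.

Lemma pt_continuous (T : topologicalType) n (u : {ffun 'I_n.+1 -> vert X})
    (g : T -> 'rV[R]_n.+1) :
  (forall x, @Delta_set R n (g x)) -> (forall i, continuous (fun x => g x 0 i)) ->
  continuous (fun x => pt u (g x)).
Proof.
move=> gD cg x; apply: (@continuous_comp _ _ _ (fun x => to_Delta (g x))
  (fun t => point_of (mkcell (to_simplex u) t))); first exact: to_Delta_continuous.
apply: (@continuous_comp _ _ _ (mkcell (to_simplex u)) (@point_of R X)).
  exact: existT_continuous.
exact: pi_continuous.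
Qed.

Lemma pt_glue m n (th : 'I_m.+1 -> 'I_n.+1) (u : {ffun 'I_n.+1 -> vert X})
    (w : {ffun 'I_m.+1 -> vert X}) (t : 'rV[R]_m.+1) (s : 'rV[R]_n.+1) :
  {homo th : i j / (i <= j)%N} -> u \in simp X n -> @Delta_set R m t ->
  (forall i, w i = u (th i)) -> (forall j, s 0 j = \sum_(i | th i == j) t 0 i) ->
  pt w t = pt u s.
Proof.
move=> hth uX tD wE sE; apply/point_ofP.
have wX : w \in simp X m.
  rewrite (_ : w = [ffun i => u (th i)]); first exact: simp_reindex.
  by apply/ffunP => i; rewrite ffunE.
have -> : to_simplex w = Defs.reindex hth (to_simplex u).
  by apply: val_inj; rewrite /= !to_simplexK//; apply/ffunP => i; rewrite ffunE.
have sP : s = pushforward_row th t by apply/rowP => j; rewrite sE mxE.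
have -> : to_Delta s = Defs.pushforward th (to_Delta t).
  apply: val_inj; rewrite /= (to_DeltaK tD) -sP to_DeltaK//.
  by have := pushforward_row_Delta th (to_Delta t); rewrite (to_DeltaK tD) -sP => /set_mem.
exact/rst_step/Glue.
Qed.

Definition vx1 (x : vert X) : {ffun 'I_1 -> vert X} := [ffun=> x].
Definition vx2 (x y : vert X) : {ffun 'I_2 -> vert X} := [ffun i : 'I_2 => nth x [:: x; y] i].
Definition vx3 (x y z : vert X) : {ffun 'I_3 -> vert X} := [ffun i : 'I_3 => nth x [:: x; y; z] i].
End X.

Lemma vx3_simp01 (X : relSSet) (x y z : vert X) : vx3 x y z \in simp X 2 -> vx2 x y \in simp X 1.
Proof.
move=> xyz; have -> : vx2 x y = [ffun i => vx3 x y z (widen_ord (leqnSn 2) i)].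
  by apply/ffunP => -[[|[|//]] ?]; rewrite !ffunE.
by apply: simp_reindex.
Qed.

Lemma vx3_simp12 (X : relSSet) (x y z : vert X) : vx3 x y z \in simp X 2 -> vx2 y z \in simp X 1.
Proof.
move=> xyz; have -> : vx2 y z = [ffun i => vx3 x y z (lift ord0 i)].
  by apply/ffunP => -[[|[|//]] ?]; rewrite !ffunE.
by apply: simp_reindex.
Qed.

Definition wt1 : 'rV[R]_1 := \row_i 1.
Definition wt2 (a b : R) : 'rV[R]_2 := \row_(i < 2) nth 0 [:: a; b] i.
Definition wt3 (a b c : R) : 'rV[R]_3 := \row_(i < 3) nth 0 [:: a; b; c] i.

Lemma wt2_Delta a b : 0 <= a -> 0 <= b -> a + b = 1 -> @Delta_set R 1 (wt2 a b).
Proof.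
move=> a0 b0 ab; split; first by move=> [[|[|//]] i2]; rewrite mxE.
by rewrite !big_ord_recl big_ord0 !mxE/= addr0.
Qed.

Lemma wt3_Delta a b c : 0 <= a -> 0 <= b -> 0 <= c -> a + b + c = 1 ->
  @Delta_set R 2 (wt3 a b c).
Proof.
move=> a0 b0 c0 abc; split; first by move=> [[|[|[|//]]] i2]; rewrite mxE.
by rewrite !big_ord_recl big_ord0 !mxE/= addr0 addrA.
Qed.

Lemma wt1_Delta : @Delta_set R 0 wt1.
Proof. by split=> [i|]; rewrite ?big_ord1 mxE. Qed.

Lemma wt3_continuous (T : topologicalType) (a b c : T -> R) :
  continuous a -> continuous b -> continuous c ->
  forall i, continuous (fun p => wt3 (a p) (b p) (c p) 0 i).
Proof.
move=> ca cb cc [[|[|[|//]]] i3].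
- by rewrite (_ : (fun p => _) = a)//; apply/funext => p; rewrite mxE.
- by rewrite (_ : (fun p => _) = b)//; apply/funext => p; rewrite mxE.
- by rewrite (_ : (fun p => _) = c)//; apply/funext => p; rewrite mxE.
Qed.

Section Faces.
Variables (X : relSSet) (x y z : vert X).

(** A face or degeneracy operator given by the list of its values. *)
Let homo_seq m n (s : seq nat) : sorted leq s -> size s = m.+1 -> all (leq^~ n) s ->
  exists th : 'I_m.+1 -> 'I_n.+1, {homo th : i j / (i <= j)%N} /\ (forall i, th i = nth 0%N s i :> nat) /\
    forall i j, (th i == j) = (nth 0%N s i == j :> nat).
Proof.
move=> so sz /allP al.
have thP (i : 'I_m.+1) : (nth 0 s i < n.+1)%N by rewrite ltnS; apply/al/mem_nth; rewrite sz.
exists (fun i => Ordinal (thP i)); split; last by split=> // i j; rewrite -val_eqE.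
move=> i j ij /=.
by apply: (sorted_leq_nth leq_trans leqnn) => //; rewrite inE sz.
Qed.

Ltac glue_tac m n s :=
  let th := fresh "th" in let h1 := fresh in let h2 := fresh in let h3 := fresh in
  have [th [h1 [h2 h3]]] := @homo_seq m n s isT erefl isT;
  apply: (pt_glue (th := th)) => //;
  [|by case=> [[|[|[|//]]] ?]; rewrite !ffunE h2
  |by case=> [[|[|[|//]]] ?]; rewrite big_mkcond !big_ord_recl big_ord0 !h3 /= !mxE /= ?addr0 ?add0r].

Lemma pt3_face01 a b : 0 <= a -> 0 <= b -> a + b = 1 -> vx3 x y z \in simp X 2 ->
  pt (vx2 x y) (wt2 a b) = pt (vx3 x y z) (wt3 a b 0).
Proof. by move=> a0 b0 ab xyz; glue_tac 1%N 2%N [:: 0; 1]%N; exact: wt2_Delta. Qed.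

Lemma pt3_face02 a b : 0 <= a -> 0 <= b -> a + b = 1 -> vx3 x y z \in simp X 2 ->
  pt (vx2 x z) (wt2 a b) = pt (vx3 x y z) (wt3 a 0 b).
Proof. by move=> a0 b0 ab xyz; glue_tac 1%N 2%N [:: 0; 2]%N; exact: wt2_Delta. Qed.

Lemma pt3_face12 a b : 0 <= a -> 0 <= b -> a + b = 1 -> vx3 x y z \in simp X 2 ->
  pt (vx2 y z) (wt2 a b) = pt (vx3 x y z) (wt3 0 a b).
Proof. by move=> a0 b0 ab xyz; glue_tac 1%N 2%N [:: 1; 2]%N; exact: wt2_Delta. Qed.

Lemma pt3_deg01 a b c : 0 <= a -> 0 <= b -> 0 <= c -> a + b + c = 1 -> vx2 x y \in simp X 1 ->
  pt (vx3 x x y) (wt3 a b c) = pt (vx2 x y) (wt2 (a + b) c).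
Proof. by move=> a0 b0 c0 abc xyz; glue_tac 2%N 1%N [:: 0; 0; 1]%N; exact: wt3_Delta. Qed.

Lemma pt3_deg12 a b c : 0 <= a -> 0 <= b -> 0 <= c -> a + b + c = 1 -> vx2 x y \in simp X 1 ->
  pt (vx3 x y y) (wt3 a b c) = pt (vx2 x y) (wt2 a (b + c)).
Proof. by move=> a0 b0 c0 abc xyz; glue_tac 2%N 1%N [:: 0; 1; 1]%N; exact: wt3_Delta. Qed.

Lemma pt2_face0 : vx2 x y \in simp X 1 -> pt (vx1 x) wt1 = pt (vx2 x y) (wt2 1 0).
Proof. by move=> xy; glue_tac 0%N 1%N [:: 0]%N; exact: wt1_Delta. Qed.

Lemma pt2_face1 : vx2 x y \in simp X 1 -> pt (vx1 y) wt1 = pt (vx2 x y) (wt2 0 1).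
Proof. by move=> xy; glue_tac 0%N 1%N [:: 1]%N; exact: wt1_Delta. Qed.

Lemma pt2_deg a b : 0 <= a -> 0 <= b -> a + b = 1 ->
  pt (vx2 x x) (wt2 a b) = pt (vx1 x) wt1.
Proof.
move=> a0 b0 ab; have xX : vx1 x \in simp X 0 by exact: simp_vert.
have [th [h1 [h2 h3]]] := @homo_seq 1 0 [:: 0; 0]%N isT erefl isT.
apply: (pt_glue (th := th)) => //; first exact: wt2_Delta.
  by case=> [[|[|//]] ?]; rewrite !ffunE.
by move=> j; rewrite (ord1 j) big_mkcond !big_ord_recl big_ord0 !(ord1 (th _)) /= !mxE /= addr0.
Qed.
End Faces.

Lemma realization_map_pt (X Y : relSSet) (f : simplicialMap X Y) n
    (u : {ffun 'I_n.+1 -> vert X}) v : u \in simp X n ->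
  realization_map R f (pt u v) = pt [ffun i => f (u i)] v.
Proof.
move=> uX; rewrite /pt realization_mapE /map_precell /=; congr (point_of (mkcell _ _)).
by apply: val_inj; rewrite to_simplexK ?vmap_simp//= to_simplexK.
Qed.

Lemma realization_map_continuous (X Y : relSSet) (f : simplicialMap X Y) :
  continuous (realization_map R f).
Proof.
apply/quotient_continuous.
rewrite (_ : _ \o _ = @point_of R Y \o @map_precell R X Y f); last first.
  by apply/funext => x /=; rewrite realization_mapE.
move=> x; apply: continuous_comp; last exact: pi_continuous.
apply: (@sigT_continuous _ _ _ (fun s t => mkcell (map_nsimplex f (tagged s)) t)) => -[m u].
exact: (@existT_continuous _ (fun s : {n : nat & nsimplex Y n} => Delta R (tag s)) (existT _ m (map_nsimplex f u))).
Qed.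
End Points.

(** * Points of |Sigma^2| as step functions *)

Section SignedMeasure.
Variable R : realType.

Definition psum n (t : 'rV[R]_n.+1) (k : nat) : R := \sum_(i < n.+1 | (i < k)%N) t 0 i.

Lemma psum0 n (t : 'rV[R]_n.+1) : psum t 0 = 0.
Proof. by rewrite /psum big_pred0. Qed.

Lemma psumT n (t : 'rV[R]_n.+1) : @Delta_set R n t -> psum t n.+1 = 1.
Proof. by move=> [_ <-]; apply: eq_bigl => i; rewrite ltn_ord. Qed.

Lemma psum_le n (t : 'rV[R]_n.+1) k l : @Delta_set R n t -> (k <= l)%N -> psum t k <= psum t l.
Proof.
move=> [t0 _] kl; rewrite /psum [leRHS](bigID (fun i : 'I_n.+1 => (i < k)%N)) /=.
rewrite -[leLHS]addr0 lerD ?sumr_ge0// le_eqVlt; apply/orP; left; apply/eqP; apply: eq_bigl => i.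
by case: (ltnP i k) => ik; rewrite ?andbF// andbT (leq_trans ik).
Qed.

Definition csign (b : bool) : R := if b then 1 else -1.

Lemma csignN b : csign (~~ b) = - csign b.
Proof. by case: b; rewrite /csign/= ?opprK. Qed.

(* A point of a cell [u_0, ..., u_n] is a step function on [0, 1] taking the colour u_k on an interval of
   length t_k; this is the integral of its sign against the derivative of phi. *)
Definition cell_int (phi : R -> R) n (u : 'I_n.+1 -> bool) (t : 'rV[R]_n.+1) : R :=
  \sum_(k < n.+1) csign (u k) * (phi (psum t k.+1) - phi (psum t k)).

Lemma initial_segment m n (th : 'I_m.+1 -> 'I_n.+1) (j : nat) :
  {homo th : i k / (i <= k)%N} ->
  exists2 a, (a <= m.+1)%N & forall i, (th i < j)%N = (i < a)%N.
Proof.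
move=> hth; pose P a := (m.+1 <= a)%N || (j <= th (inord a))%N.
have exP : exists a, P a by exists m.+1; rewrite /P leqnn.
exists (ex_minn exP); case: ex_minnP => a Pa amin.
  by apply: amin; rewrite /P leqnn.
move=> i; case: (ltnP i a) => ia.
  rewrite ltnNge; apply/negP => jth; move: ia; rewrite ltnNge => /negP; apply.
  by apply: amin; rewrite /P inord_val jth orbT.
apply/negbTE; rewrite -leqNgt; move: Pa => /orP[ma|].
  by have := leq_ltn_trans (leq_trans ma ia) (ltn_ord i); rewrite ltnn.
move=> /leq_trans; apply; apply: hth; rewrite inordK//.
exact: leq_ltn_trans ia (ltn_ord i).
Qed.

Lemma sum_initial (phi : R -> R) m n (th : 'I_m.+1 -> 'I_n.+1) (t : 'rV[R]_m.+1) (j : nat) :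
  {homo th : i k / (i <= k)%N} ->
  \sum_(i | (th i < j)%N) (phi (psum t i.+1) - phi (psum t i)) =
  phi (\sum_(i | (th i < j)%N) t 0 i) - phi 0.
Proof.
move=> hth; have [a am aP] := initial_segment j hth.
rewrite !(eq_bigl _ _ aP) -/(psum t a) -[in phi 0](psum0 t).
rewrite -(big_ord_widen _ (fun i => phi (psum t i.+1) - phi (psum t i)) am).
rewrite -(big_mkord xpredT (fun i => phi (psum t i.+1) - phi (psum t i))).
exact: (telescope_sumr (fun k => phi (psum t k)) (leq0n a)).
Qed.

(** The intervals in a fibre of [th] are consecutive and of one colour, so their increments of [phi]
    telescope. *)
Lemma cell_int_glue (phi : R -> R) m n (th : 'I_m.+1 -> 'I_n.+1)
    (u : 'I_n.+1 -> bool) (t : 'rV[R]_m.+1) : {homo th : i k / (i <= k)%N} ->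
  cell_int phi (u \o th) t = cell_int phi u (pushforward_row th t).
Proof.
move=> hth; rewrite /cell_int (partition_big th xpredT)//=; apply: eq_bigr => j _.
rewrite (eq_bigr (fun i : 'I_m.+1 => csign (u j) * (phi (psum t i.+1) - phi (psum t i)))); last first.
  by move=> i /eqP ->.
rewrite -big_distrr /=; congr (_ * _).
have pushE k : psum (pushforward_row th t) k = \sum_(i | (th i < k)%N) t 0 i.
  rewrite /psum [RHS](partition_big th (fun j => (j < k)%N))//=.
  apply: eq_bigr => l lk; rewrite mxE; apply: eq_bigl => i.
  by case: eqP => [->|]; rewrite ?lk// andbF.
rewrite !pushE; have := sum_initial phi t j.+1 hth.
rewrite (bigID (fun i => (th i < j)%N)) /=.
have -> : \sum_(i | (th i < j.+1)%N && (th i < j)%N) (phi (psum t i.+1) - phi (psum t i)) =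
  phi (\sum_(i | (th i < j)%N) t 0 i) - phi 0.
  rewrite -sum_initial//; apply: eq_bigl => i.
  by case: (ltnP (th i) j) => [/leqW ->|]; rewrite ?andbF.
have -> : \sum_(i | (th i < j.+1)%N && ~~ (th i < j)%N) (phi (psum t i.+1) - phi (psum t i)) =
  \sum_(i | th i == j) (phi (psum t i.+1) - phi (psum t i)).
  by apply: eq_bigl => i; rewrite -leqNgt ltnS -eqn_leq -val_eqE.
by move=> H; apply: (addrI (phi (\sum_(i | (th i < j)%N) t 0 i) - phi 0)); rewrite H; ring.
Qed.

Section Int.
Variable phi : R -> R.

Let cell_int' (x : precell R (Sigma 2)) : R :=
  cell_int phi (val (tagged (tag x))) (val (tagged x)).

Definition signed_int (p : realization R (Sigma 2)) : R := cell_int' (repr p).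

Let cell_int'_glue (x y : precell R (Sigma 2)) : clos_refl_sym_trans _ (@Defs.glue R (Sigma 2)) x y -> cell_int' x = cell_int' y.
Proof.
elim=> [a b [m n th hth u t]|//|//|a b c _ -> _ -> //].
rewrite /cell_int' /= -cell_int_glue//; apply: eq_bigr => i _.
by rewrite /= ffunE.
Qed.

Lemma signed_intE n (u : {ffun 'I_n.+1 -> vert (Sigma 2)}) (v : 'rV[R]_n.+1) :
  u \in simp (Sigma 2) n -> @Delta_set R n v -> signed_int (pt u v) = cell_int phi u v.
Proof.
move=> uS vD; rewrite /signed_int (cell_int'_glue (repr_point_of _)).
by rewrite -[in RHS](to_simplexK uS) -[in RHS](to_DeltaK vD).
Qed.

Lemma signed_int_act p :
  signed_int (realization_map R (act (Sigma 2)) p) = - signed_int p.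
Proof.
have [n [u [v [uS vD ->]]]] := pt_surj p.
rewrite realization_map_pt// !signed_intE//; last exact: vmap_simp.
rewrite /cell_int -sumrN; apply: eq_bigr => i _.
by rewrite ffunE /= csignN mulNr.
Qed.

Hypothesis cphi : continuous phi.

Lemma signed_int_continuous : continuous signed_int.
Proof.
apply/quotient_continuous.
rewrite (_ : _ \o _ = cell_int'); last first.
  by apply/funext => x; exact: cell_int'_glue (repr_point_of x).
apply: (@sigT_continuous _ (fun s : {n : nat & nsimplex (Sigma 2) n} => Delta R (tag s)) _
  (fun s t => cell_int phi (val (tagged s)) (val t))) => -[n u] /= t.
have cps k : continuous (fun t : Delta R n => psum (val t) k).
  apply: cont_sum => i.
  apply: (@cont_comp _ _ _ (fun t : Delta R n => val t) (fun v : 'rV[R]_n.+1 => v 0 i)).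
    exact: initial_continuous.
  exact: coord_continuous.
move: t; apply: cont_sum => k; apply: contM; first exact: cont_cst.
by apply: contD; last apply: contN; apply: (cont_comp (cps _) cphi).
Qed.
End Int.
End SignedMeasure.

(** * Majority colours on the four quarters of [0, 1] *)

Section Colour.
Variable R : realType.
Notation S := (realization R (Sigma 2)).
Notation nu := (realization_map R (act (Sigma 2))).

Definition clamp (a b x : R) := Num.max a (Num.min x b).

Lemma clamp_continuous a b : continuous (clamp a b).
Proof. by apply: cont_max; [exact: cont_cst|apply: cont_min; [exact: cont_id|exact: cont_cst]]. Qed.

Definition quarter (r : nat) : R := r%:R / 4.
Definition window (r : nat) : R -> R := clamp (quarter r) (quarter r.+1).

Lemma quarterS r : quarter r.+1 = quarter r + 4^-1.
Proof. by rewrite /quarter -natr1 mulrDl mul1r. Qed.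

Lemma quarter_gt0 r : 0 <= quarter r. Proof. by rewrite divr_ge0. Qed.

Lemma window_total r : (r < 4)%N -> window r 1 - window r 0 = 4^-1.
Proof.
move=> r4; have q0 := quarter_gt0 r.
have q1 : quarter r.+1 <= 1 by rewrite /quarter ler_pdivrMr// mul1r ler_nat.
have qS := quarterS r.
rewrite /window /clamp min_r// (@min_l _ _ 0); last by rewrite qS; lra.
rewrite max_r ?max_l//; first by rewrite qS; lra.
by rewrite qS; lra.
Qed.

Lemma window_flat r x y : x <= y -> y <= quarter r \/ quarter r.+1 <= x -> window r x = window r y.
Proof.
have qS := quarterS r.
by rewrite /window /clamp /Num.max /Num.min => xy [h|h]; repeat case: ifP; lra.
Qed.

Lemma csign_neq (b b' : bool) : b' != b -> csign R b * csign R b' = -1.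
Proof. by case: b; case: b' => //; rewrite /csign ?mulr1 ?mul1r. Qed.

(** If no interval of colour [b] met the window, the opposite colour would fill it and the product
    would be -1/4. Hence the weak inequality is enough, and ties do no harm. *)
Lemma cell_int_sign n (u : 'I_n.+1 -> bool) (t : 'rV[R]_n.+1) r b :
  @Delta_set R n t -> (r < 4)%N -> 0 <= csign R b * cell_int (window r) u t ->
  exists k : 'I_n.+1, [/\ u k = b, quarter r < psum t k.+1 & psum t k < quarter r.+1].
Proof.
move=> tD r4; apply: contraPP => /forallNP nex; apply/negP; rewrite -ltNge.
have -> : csign R b * cell_int (window r) u t =
    - \sum_(k < n.+1) (window r (psum t k.+1) - window r (psum t k)).
  rewrite /cell_int big_distrr /= -sumrN; apply: eq_bigr => k _; rewrite mulrA.
  have [ub|ub] := eqVneq (u k) b; last first.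
    by rewrite csign_neq// mulN1r.
  rewrite (@window_flat r (psum t k) (psum t k.+1)) ?subrr ?mulr0 ?oppr0//; first exact: psum_le.
  have := nex k; case: (ltP (quarter r) (psum t k.+1)) => h1; last by left.
  by case: (ltP (psum t k) (quarter r.+1)) => h2; [case|right].
rewrite -(big_mkord xpredT (fun k => window r (psum t k.+1) - window r (psum t k))).
by rewrite (telescope_sumr (fun k => window r (psum t k)) (leq0n _)) psumT// psum0 window_total//; lra.
Qed.

(** The four consecutive windows would supply intervals in weakly increasing order with alternating
    colours: three alternations, one more than [Sigma 2] allows. *)
Lemma cell_no_alternation n (u : {ffun 'I_n.+1 -> bool}) (t : 'rV[R]_n.+1) b :
  u \in simp (Sigma 2) n -> @Delta_set R n t ->
  (forall r, (r < 4)%N -> 0 <= csign R (b (+) odd r) * cell_int (window r) u t) -> False.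
Proof.
move=> uS tD pat.
have kP r : exists k : 'I_n.+1, (r < 4)%N ->
    [/\ u k = b (+) odd r, quarter r < psum t k.+1 & psum t k < quarter r.+1].
  case: (ltnP r 4) => r4; last by exists ord0.
  by have [k] := cell_int_sign tD r4 (pat r r4); exists k.
have [k {}kP] := choice kP.
have k_mono r : (r.+1 < 4)%N -> (k r <= k r.+1)%N.
  move=> r4; rewrite leqNgt; apply/negP => lt.
  have [_ _ h1] := kP r (ltnW r4); have [_ h2 _] := kP _ r4.
  by have := lt_trans (le_lt_trans (psum_le tD lt) h1) h2; rewrite ltxx.
pose th (i : 'I_4) := k i.
have th_homo : {homo th : i j / (i <= j)%N}.
  move=> i j; rewrite /th; have := ltn_ord j; elim: (j : nat) => [|l IH] l4.
    by rewrite leqn0 => /eqP ->.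
  rewrite leq_eqVlt => /orP[/eqP->//|]; rewrite ltnS => il.
  exact: leq_trans (IH (ltnW l4) il) (k_mono _ l4).
have := alternations_reindex (u : 'I_n.+1 -> bool) th_homo.
rewrite /alternations !big_ord_recl big_ord0 /th /= !inordK//.
have uk r : (r < 4)%N -> u (k r) = b (+) odd r by move=> /kP[].
rewrite /bump /= !add1n !uk//= => H.
by move: uS; rewrite inE /alternations leqNgt (leq_trans _ H)//; case: b {pat kP uk H}.
Qed.

Definition Lam r : S -> R := signed_int (window r).

Lemma Lam_continuous r : continuous (Lam r).
Proof. exact/signed_int_continuous/clamp_continuous. Qed.

Lemma Lam_act r p : Lam r (nu p) = - Lam r p.
Proof. exact: signed_int_act. Qed.

(** The inequality is strict, so the pattern remains excluded near [p]. *)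
Lemma Lam_no_alternation b p :
  exists2 r, (r < 4)%N & csign R (b (+) odd r) * Lam r p < 0.
Proof.
have [n [u [v [uS vD ->]]]] := pt_surj p.
apply: contrapT => nex; apply: (@cell_no_alternation n u v b) => // r r4.
rewrite leNgt; apply/negP => lt; apply: nex; exists r => //.
by rewrite /Lam signed_intE.
Qed.

(* Ties are broken by the first nonzero functional, which makes the colour odd. *)
Definition tie_break (p : S) : bool :=
  if Lam 0 p != 0 then 0 < Lam 0 p else if Lam 1 p != 0 then 0 < Lam 1 p
  else if Lam 2 p != 0 then 0 < Lam 2 p else 0 < Lam 3 p.

Definition colour r (p : S) : bool := if Lam r p != 0 then 0 < Lam r p else tie_break p.

Lemma gt0N (x : R) : x != 0 -> (0 < - x) = ~~ (0 < x).
Proof. by move=> x0; rewrite oppr_gt0 -leNgt le_eqVlt (negbTE x0). Qed.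

(** The functionals cannot all vanish, since zero signs are compatible with an alternating
    pattern. *)
Lemma tie_break_act p : tie_break (nu p) = ~~ tie_break p.
Proof.
rewrite /tie_break !Lam_act !oppr_eq0; case: ifP => [|/negbFE/eqP l0]; first exact: gt0N.
case: ifP => [|/negbFE/eqP l1]; first exact: gt0N.
case: ifP => [|/negbFE/eqP l2]; first exact: gt0N.
apply: gt0N.
apply/eqP => l3; have [[|[|[|[|//]]]] _] := Lam_no_alternation true p;
  by rewrite ?l0 ?l1 ?l2 ?l3 mulr0 ltxx.
Qed.

Lemma colour_act r p : colour r (nu p) = ~~ colour r p.
Proof.
by rewrite /colour Lam_act oppr_eq0; case: ifP; [exact: gt0N|rewrite tie_break_act].
Qed.

Lemma colour_sign r p : 0 <= csign R (colour r p) * Lam r p.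
Proof.
rewrite /colour; case: eqVneq => [->|l0]; first by rewrite mulr0.
by rewrite /= /csign; case: ltP => h; rewrite ?mul1r ?mulN1r ?oppr_ge0// ltW.
Qed.

Definition yellow : S := pt (vx1 (X := Sigma 2) false) (wt1 R).

Lemma colour_yellow r : (r < 4)%N -> colour r yellow = false.
Proof.
move=> r4; rewrite /colour.
have -> : Lam r yellow = - 4^-1.
  rewrite /Lam signed_intE; [|exact: simp_vert|exact: wt1_Delta].
  by rewrite /cell_int big_ord1 psumT ?psum0 ?window_total ?ffunE ?mulN1r//; exact: wt1_Delta.
by rewrite oppr_eq0 invr_eq0 pnatr_eq0 /= oppr_gt0 ltNge invr_ge0 ler0n.
Qed.
End Colour.

(** * The Borsuk-Ulam theorem *)

Section BorsukUlam.
Variable R : realType.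
Notation S := (realization R (Sigma 2)).
Notation nu := (realization_map R (act (Sigma 2))).

Definition maxnorm (x y : R) := Num.max `|x| `|y|.

Lemma maxnorm_le x y e : (maxnorm x y <= e) = (`|x| <= e) && (`|y| <= e).
Proof. by rewrite ge_max. Qed.

Lemma maxnorm_ge x y e : (e <= maxnorm x y) = (e <= `|x|) || (e <= `|y|).
Proof. by rewrite le_max. Qed.

(** At each point both alternating patterns are excluded by functionals of the strictly wrong sign.
    This persists nearby, and compactness gives a uniform mesh, as for a Lebesgue number. *)
Lemma fine_mesh (K : R * R * R -> S) : continuous K ->
  exists2 N, (0 < N)%N & forall x y t, `|x| <= 1 -> `|y| <= 1 -> 0 <= t <= 1 ->
  forall v : nat -> R * R * R,
  (forall r, (r < 4)%N -> [/\ `|x - (v r).1.1| <= N%:R^-1, `|y - (v r).1.2| <= N%:R^-1 & `|t - (v r).2| <= N%:R^-1]) ->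
  ~~ alternating4 (colour 0 (K (v 0))) (colour 1 (K (v 1))) (colour 2 (K (v 2))) (colour 3 (K (v 3))).
Proof.
move=> cK.
pose near_by (N : nat) (p q : R * R * R) := [/\ `|p.1.1 - q.1.1| <= N%:R^-1, `|p.1.2 - q.1.2| <= N%:R^-1 & `|p.2 - q.2| <= N%:R^-1].
pose good (N : nat) (p : R * R * R) := (0 < N)%N /\ forall v : nat -> R * R * R, (forall r, (r < 4)%N -> near_by N p (v r)) ->
  ~~ alternating4 (colour 0 (K (v 0))) (colour 1 (K (v 1))) (colour 2 (K (v 2))) (colour 3 (K (v 3))).
have cpt : compact ((`[-1, 1] `*` `[-1, 1]) `*` `[0, 1] : set (R * R * R)).
  by apply: compact_setX; [apply: compact_setX|]; exact: segment_compact.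
move/compact_near_coveringP : cpt => /(_ nat \oo (fun N p => good N p) _) H.
have : \forall N \near \oo, (`[-1, 1] `*` `[-1, 1]) `*` `[0, 1] `<=` good N.
  apply: H => p _.
  have [r1 r1_4 neg1] := Lam_no_alternation true (K p).
  have [r2 r2_4 neg2] := Lam_no_alternation false (K p).
  have cL r b : continuous (fun q => csign R b * Lam r (K q)).
    by apply: contM; [exact: cont_cst|apply: (cont_comp cK); exact: Lam_continuous].
  have n1 : \forall q \near p, csign R (true (+) odd r1) * Lam r1 (K q) < 0.
    by apply: (cvgr_lt _ (cL r1 _ p)).
  have n2 : \forall q \near p, csign R (false (+) odd r2) * Lam r2 (K q) < 0.
    by apply: (cvgr_lt _ (cL r2 _ p)).
  have [e /= e0 be] := iffLR (nbhs_ballP _ _) (filterI n1 n2).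
  have e2 : 0 < e / 2 by rewrite divr_gt0.
  (* Half of the radius is for the point of the box, the other half for the mesh. *)
  exists (ball p (e / 2), [set N | (0 < N)%N /\ N%:R^-1 < e / 2]) => /=.
    split; first exact: nbhsx_ballx.
    near=> N; split; first by near: N; exists 1%N.
    rewrite invf_plt ?posrE//; last by rewrite ltr0n; near: N; exists 1%N.
    by near: N; exact: nbhs_infty_gtr.
  move=> -[q N] /= [pq [N0 Ne]]; split => // v vq.
  have vb r : (r < 4)%N -> ball p e (v r).
    move=> r4; have [h1 h2 h3] := vq r r4.
    rewrite (_ : e = e / 2 + e / 2); last by rewrite -splitr.
    apply: (ball_triangle pq).
    by split; first split; rewrite /ball /= (le_lt_trans _ Ne).
  have [s1 s2] := (fun r r4 => (be _ (vb r r4)).1, fun r r4 => (be _ (vb r r4)).2).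
  apply/negP; rewrite /alternating4 => /and3P[a1 a2 a3].
  have col r : (r < 4)%N -> colour r (K (v r)) = colour 0 (K (v 0)) (+) odd r.
    by move: a1 a2 a3; case: r => [|[|[|[|//]]]] /=; do 4!case: colour.
  case c0 : (colour 0 (K (v 0))) col => col.
    by have := colour_sign r1 (K (v r1)); rewrite (col _ r1_4) leNgt (s1 r1 r1_4).
  by have := colour_sign r2 (K (v r2)); rewrite (col _ r2_4) leNgt (s2 r2 r2_4).
move=> [N _ /(_ N (leqnn N))] /= NP.
have [N0 _] : good N (0, 0, 0) by apply: NP; rewrite /= !in_itv/= !lexx ler01 lerN10.
exists N => // x y t x1 y1 t01 v vP.
have [_] : good N (x, y, t) by apply: NP; rewrite /= !in_itv/= -!ler_norml x1 y1.
by apply.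
Unshelve. all: end_near.
Qed.

(** The box with its ends glued and each vertical segment over the boundary of the square collapsed
    is S^3. Cut along the inner square [maxnorm x y <= 1/2], it becomes a ball whose boundary
    consists of two copies of this square, exchanged by the antipode. So [K] is one half of an
    antipodal map from S^3 to |Sigma^2|. *)
Theorem Borsuk_Ulam_square (K : R * R * R -> S) : continuous K ->
  (forall x y t : R, 1 <= maxnorm x y -> 0 <= t <= 1 -> K (x, y, t) = yellow R) ->
  (forall x y, 2^-1 <= maxnorm x y -> K (x, y, 1) = K (x, y, 0)) ->
  (forall x y, maxnorm x y <= 2^-1 -> K (x, y, 1) = nu (K (- x, - y, 0))) -> False.
Proof.
move=> cK Kbnd Kout Kin; have [N N0 mesh] := fine_mesh cK.
(* Steps of length 1/(2N): indices 0 to 4N cover [-1, 1], with N to 3N covering [-1/2, 1/2], and 0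
   to 2N cover [0, 1]. *)
pose M : R := (2 * N)%:R.
have M0 : 0 < M by rewrite ltr0n muln_gt0.
pose X (i : nat) : R := (i%:R - M) / M.
pose Tm (k : nat) : R := k%:R / M.
pose pos (v : nat * nat * nat) := (X v.1.1, X v.1.2, Tm v.2).
have XN i : (i <= 4 * N)%N -> X (4 * N - i)%N = - X i.
  by move=> iN; rewrite /X natrB// -mulNr opprB /M !natrM; congr (_ / _); ring.
have Xabs i e : `|X i| <= e <-> `|i%:R - M| <= e * M.
  by rewrite /X normrM normfV (gtr0_norm M0) ler_pdivrMr.
have ME : M = 2 * N%:R by rewrite /M natrM.
have NR0 : 0 < N%:R :> R by rewrite ltr0n.
pose c v := colour (ntype v) (K (pos v)).
apply: (@grid_parity N (2 * N) c) => //.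
- by rewrite oddM.
- move=> i j k iN jN kN v0 v1 v2 v3 /and5P[c0 c1 c2 c3 _] t0 t1 t2 t3.
  rewrite /c t0 t1 t2 t3.
  apply: (mesh (X i) (X j) (Tm k) _ _ _ (nth (0, 0, 0) [:: pos v0; pos v1; pos v2; pos v3])).
  + apply/Xabs; rewrite mul1r ler_norml ME; move: iN; rewrite -(ltr_nat R) natrM; have : (0 : R) <= i%:R by []; lra.
  + apply/Xabs; rewrite mul1r ler_norml ME; move: jN; rewrite -(ltr_nat R) natrM; have : (0 : R) <= j%:R by []; lra.
  + by rewrite divr_ge0 ?(ltW M0)//= ler_pdivrMr// mul1r ler_nat ltnW.
  have step a b : (a <= b <= a.+1)%N -> `|a%:R / M - b%:R / M| <= N%:R^-1.
    move=> /andP[ab ba]; rewrite -mulrBl normrM normfV (gtr0_norm M0) ler_pdivrMr//.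
    rewrite ME mulrCA mulVf ?gt_eqF// mulr1.
    by rewrite -normrN opprB ger0_norm ?subr_ge0 ?ler_nat// lerBlDl -natrD ler_nat; lia.
  have Xstep a b : (a <= b <= a.+1)%N -> `|X a - X b| <= N%:R^-1.
    by move=> /step; rewrite /X !mulrBl opprB addrA subrK.
  by case=> [|[|[|[|//]]]] _ /=; [move: c0|move: c1|move: c2|move: c3] => /and3P[? ? ?];
    split; by [exact: Xstep|exact: step].
- move=> i j k iN jN kN ij; rewrite /c /pos /=.
  have -> : K (X i, X j, Tm k) = yellow R.
    apply: Kbnd; last by rewrite divr_ge0 ?(ltW M0)//= ler_pdivrMr// mul1r ler_nat.
    have X0 : X 0 = -1 by rewrite /X sub0r mulNr mulfV ?gt_eqF.
    have X4 : X (4 * N)%N = 1 by rewrite -[(4 * N)%N]subn0 XN// X0 opprK.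
    by rewrite maxnorm_ge; case/or4P: ij => /eqP ->; rewrite ?X0 ?X4 ?normrN normr1 lexx ?orbT.
  by apply: colour_yellow; rewrite /ntype /=; do 3!case: odd.
- move=> i j iN jN ij; rewrite /c /ntype /pos /= oddM /= /Tm mul0r mulfV ?gt_eqF//.
  rewrite Kout// maxnorm_ge.
  have half l : (l <= N)%N || (3 * N <= l)%N -> 2^-1 <= `|X l|.
    rewrite /X normrM normfV (gtr0_norm M0) ler_pdivlMr// ME mulrA mulVf ?mul1r// ler_normr.
    by move=> /orP[]; rewrite -(ler_nat R) ?natrM => h; apply/orP; [right|left]; lra.
  by apply/orP; case/or4P: ij => ij; [left|left|right|right]; apply: half; rewrite ij ?orbT.
- move=> i j iN jN; rewrite /c /ntype /pos /= /Tm mul0r mulfV ?gt_eqF//.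
  rewrite !XN ?opprK; try lia.
  rewrite Kin; last first.
    rewrite maxnorm_le; apply/andP; split; apply/Xabs; rewrite ler_norml ME mulrA mulVf ?mul1r//.
      by move: iN; rewrite -!(ler_nat R) natrM => /andP[]; lra.
    by move: jN; rewrite -!(ler_nat R) natrM => /andP[]; lra.
  (* Reflection keeps parities, and the heights 0 and 2N are both even, so corresponding vertices
     use the same window. *)
  have od l : (l <= 4 * N)%N -> odd (4 * N - l)%N = odd l by move=> lN; rewrite oddB// oddM.
  by rewrite colour_act !oddM /= !od//; lia.
Qed.
End BorsukUlam.

(** * Hemispheres of |Sigma^2| *)

Section SphereCoordinates.
Variable R : realType.
Notation S := (realization R (Sigma 2)).
Notation nu := (realization_map R (act (Sigma 2))).

Lemma Sigma2_simp n (u : {ffun 'I_n.+1 -> bool}) : (n <= 2)%N -> u \in simp (Sigma 2) n.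
Proof.
move=> n2; rewrite inE /alternations (leq_trans _ n2)//.
by rewrite -[leqRHS]card_ord -sum1_card leq_sum// => i _; case: (_ != _).
Qed.

Lemma clamp_itv (a b x : R) : a <= b -> a <= clamp a b x <= b.
Proof. by move=> ab; rewrite /clamp le_max lexx/= ge_max ab ge_min lexx orbT. Qed.

Lemma clamp_id (a b x : R) : a <= x <= b -> clamp a b x = x.
Proof. by move=> /andP[ax xb]; rewrite /clamp min_l// max_r. Qed.

Lemma clamp_ge (a b x : R) : a <= b <= x -> clamp a b x = b.
Proof. by move=> /andP[ab bx]; rewrite /clamp min_r// max_r. Qed.

Lemma clamp_le (a b x : R) : a <= b -> x <= a -> clamp a b x = a.
Proof. by move=> ab xa; rewrite /clamp min_l ?max_l// (le_trans xa). Qed.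

Definition wt_blue (x s : R) := (1 + x) / 2 * Num.min 1 (2 - 2 * s).
Definition hemi_wt (x s : R) : 'rV[R]_3 :=
  wt3 (wt_blue x s * (1 - Num.min s 2^-1)) (1 - wt_blue x s) (wt_blue x s * Num.min s 2^-1).
Definition hemi_wt' (x s : R) : 'rV[R]_3 :=
  wt3 (wt_blue x s * Num.min s 2^-1) (1 - wt_blue x s) (wt_blue x s * (1 - Num.min s 2^-1)).

(** |Sigma^2| has two nondegenerate triangles, this one and its antipode. The edge between the two
    blue vertices is degenerate and collapses, which leaves a disk bounded by the equator. *)
Definition BYB : {ffun 'I_3 -> vert (Sigma 2)} := vx3 (X := Sigma 2) true false true.

(* The equator (for [s = 0]) is first folded onto the arc of points with equal outer weights ([s = 1/2]) and
   this arc is then contracted to the yellow vertex ([s = 1]). *)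
Definition hemisphere (x y s : R) : S :=
  if - y <= 0 then pt BYB (hemi_wt x s) else pt BYB (hemi_wt' x s).

Lemma wt_blue_itv x s : x ^+ 2 <= 1 -> 0 <= s <= 1 -> 0 <= wt_blue x s <= 1.
Proof.
move=> x1 /andP[s0 s1].
have [{}x1 x0] : x <= 1 /\ -1 <= x by split; nra.
have /andP[k0 k1] : 0 <= Num.min 1 (2 - 2 * s) <= 1 by rewrite le_min ge_min lexx ler01 /=; lra.
by rewrite /wt_blue; apply/andP; split; [rewrite mulr_ge0//|rewrite mulr_ile1//]; lra.
Qed.

Lemma hemi_wt_Delta x s : x ^+ 2 <= 1 -> 0 <= s <= 1 -> @Delta_set R 2 (hemi_wt x s).
Proof.
move=> x1 s01; have /andP[b0 b1] := wt_blue_itv x1 s01; move: s01 => /andP[s0 s1].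
have /andP[m0 m1] : 0 <= Num.min s 2^-1 <= 2^-1 by rewrite le_min ge_min lexx s0 orbT andbT/=; lra.
by apply: wt3_Delta; [apply: mulr_ge0|rewrite subr_ge0|apply: mulr_ge0|ring] => //; lra.
Qed.

Lemma hemi_wt'_Delta x s : x ^+ 2 <= 1 -> 0 <= s <= 1 -> @Delta_set R 2 (hemi_wt' x s).
Proof.
move=> x1 s01; have /andP[b0 b1] := wt_blue_itv x1 s01; move: s01 => /andP[s0 s1].
have /andP[m0 m1] : 0 <= Num.min s 2^-1 <= 2^-1 by rewrite le_min ge_min lexx s0 orbT andbT/=; lra.
by apply: wt3_Delta; [apply: mulr_ge0|rewrite subr_ge0|apply: mulr_ge0|ring] => //; lra.
Qed.

Lemma pt_blue_pole (s : R) : 0 <= s <= 1 ->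
  pt BYB (wt3 (1 - s) 0 s) = pt (vx1 (X := Sigma 2) true) (wt1 R).
Proof.
move=> /andP[s0 s1]; rewrite /BYB -pt3_face02 ?subr_ge0 ?subrK//; last exact: Sigma2_simp.
by rewrite pt2_deg ?subr_ge0 ?subrK.
Qed.

Lemma pt_yellow_pole : pt BYB (wt3 (0 : R) 1 0) = yellow R.
Proof.
rewrite /BYB -pt3_face12 ?addr0//; last exact: Sigma2_simp.
by rewrite -pt2_face0//; exact: Sigma2_simp.
Qed.

Section Continuity.
Variables (T : topologicalType) (X Y Sg : T -> R).
Hypotheses (cX : continuous X) (cY : continuous Y) (cS : continuous Sg).
Hypothesis XY : forall p, X p ^+ 2 + Y p ^+ 2 = 1.

Let X1 p : X p ^+ 2 <= 1.
Proof. by rewrite -(XY p) lerDl sqr_ge0. Qed.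

Lemma hemisphere_continuous : (forall p, 0 <= Sg p <= 1) ->
  continuous (fun p => hemisphere (X p) (Y p) (Sg p)).
Proof.
move=> S01; rewrite /hemisphere.
have c2 : continuous (fun p => wt_blue (X p) (Sg p)) by rewrite /wt_blue; cont.
apply: paste; first by cont.
- apply: pt_continuous => [p|]; first exact: hemi_wt_Delta.
  by apply: wt3_continuous; cont.
- apply: pt_continuous => [p|]; first exact: hemi_wt'_Delta.
  by apply: wt3_continuous; cont.
move=> p /eqP; rewrite oppr_eq0 => /eqP Y0.
(* At [x = 1] all weight is blue up to [s = 1/2], where the collapsed edge identifies the two
   formulas; afterwards the outer weights are equal. At [x = -1] all weight is yellow. *)
have := XY p; rewrite Y0 expr0n addr0 => /eqP; rewrite sqrf_eq1 => /orP[]/eqP Xp.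
  rewrite /hemi_wt /hemi_wt' Xp; have -> : wt_blue 1 (Sg p) = Num.min 1 (2 - 2 * Sg p).
    by rewrite /wt_blue (_ : (1 + 1) / 2 = 1) ?mul1r//; lra.
  have /andP[s0 s1] := S01 p; have [s2|s2] := leP (Sg p) 2^-1.
    rewrite min_l; last by lra.
    rewrite subrr !mul1r pt_blue_pole//.
    rewrite -[X in wt3 X](subKr 1) pt_blue_pole//; lra.
  by rewrite (_ : 1 - 2^-1 = 2^-1)//; lra.
rewrite /hemi_wt /hemi_wt' Xp; have -> : wt_blue (-1) (Sg p) = 0.
  by rewrite /wt_blue addrN mul0r mul0r.
by rewrite !mul0r.
Qed.
End Continuity.

(** A map on the suspension of the circle, with the yellow vertex at height 1 and the blue one at
    height -1. Both vertices lie on the equator, so it is not injective; what counts is its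
    symmetry, its equator and its ends. *)
Definition sphere (x y s : R) : S :=
  if - s <= 0 then hemisphere x y (clamp 0 1 s)
  else nu (hemisphere (- x) (- y) (clamp 0 1 (- s))).

Lemma nuK : involutive nu.
Proof.
move=> p; have [n [u [v [uS vD ->]]]] := pt_surj p.
rewrite !realization_map_pt//; last exact: vmap_simp.
by congr (pt _ _); apply/ffunP => i; rewrite !ffunE /= negbK.
Qed.

Lemma edge_pt b (s : R) (hs : 0 <= s <= 1) :
  realization_map R Sigma_incl (edge_point b hs) =
  pt (vx2 (X := Sigma 2) b (~~ b)) (wt2 (1 - s) s).
Proof.
rewrite /edge_point realization_mapE /map_precell pt_val.
have -> : val (map_nsimplex Sigma_incl (tagged (tag (mkcell (edge b) (segment hs))))) =
    vx2 (X := Sigma 2) b (~~ b).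
  by apply/ffunP => -[[|[|//]] i2]; rewrite !ffunE.
have -> // : val (tagged (mkcell (edge b) (segment hs))) = wt2 (1 - s) s.
by apply/rowP => -[[|[|//]] i2]; rewrite !mxE.
Qed.

Lemma iotaE (z : circle R) : let x := complex.Re (val z) in
  Defs.iota z = if 0 <= complex.Im (val z)
    then pt (vx2 (X := Sigma 2) true false) (wt2 ((1 + x) / 2) ((1 - x) / 2))
    else pt (vx2 (X := Sigma 2) false true) (wt2 ((1 - x) / 2) ((1 + x) / 2)).
Proof.
move=> x; have H := edge_pt (0 <= complex.Im (val z)) (circle_weight_subproof z (0 <= complex.Im (val z))).
transitivity (pt (vx2 (X := Sigma 2) (0 <= complex.Im (val z)) (~~ (0 <= complex.Im (val z))))
  (wt2 (1 - (1 - (-1) ^+ (~~ (0 <= complex.Im (val z))) * complex.Re (val z)) / 2)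
    ((1 - (-1) ^+ (~~ (0 <= complex.Im (val z))) * complex.Re (val z)) / 2))); first exact: H.
rewrite -/x; case: (0 <= complex.Im (val z)) => /=; rewrite ?expr0 ?expr1 ?mul1r ?mulN1r ?opprK.
  by have -> : 1 - (1 - x) / 2 = (1 + x) / 2 by field.
by have -> : 1 - (1 + x) / 2 = (1 - x) / 2 by field.
Qed.

Lemma circle_normE (z : circle R) : complex.Re (val z) ^+ 2 + complex.Im (val z) ^+ 2 = 1.
Proof.
have := valP z; case: (val z) => x y /=; rewrite normc_def /= => /eqP[/(congr1 (fun u => u ^+ 2))].
by rewrite sqr_sqrtr ?addr_ge0 ?sqr_ge0// expr1n.
Qed.

Lemma hemisphere_equator x y : x ^+ 2 + y ^+ 2 = 1 ->
  hemisphere x y 0 = if 0 <= y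
    then pt (vx2 (X := Sigma 2) true false) (wt2 ((1 + x) / 2) ((1 - x) / 2))
    else pt (vx2 (X := Sigma 2) false true) (wt2 ((1 - x) / 2) ((1 + x) / 2)).
Proof.
move=> xy; rewrite /hemisphere oppr_le0.
have [x1 x0] : x <= 1 /\ -1 <= x by split; nra.
have wE : wt_blue x 0 = (1 + x) / 2 by rewrite /wt_blue mulr0 subr0 min_l ?mulr1//; lra.
have m0 : Num.min 0 2^-1 = 0 :> R by rewrite min_l.
have e : 1 - (1 + x) / 2 = (1 - x) / 2 by field.
case: ifP => _; rewrite /hemi_wt /hemi_wt' wE m0 !subr0 mulr0 mulr1 e /BYB.
  rewrite -pt3_face01 ?Sigma2_simp//; [lra|lra|by field].
rewrite -pt3_face12 ?Sigma2_simp//; [lra|lra|by field].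
Qed.

Lemma sphere_iota (z : circle R) :
  Defs.iota z = sphere (complex.Re (val z)) (complex.Im (val z)) 0.
Proof.
rewrite /sphere oppr0 lexx clamp_id ?lexx ?ler01// hemisphere_equator ?circle_normE//.
exact: iotaE.
Qed.

Lemma pt2_act b (p q : R) :
  nu (pt (vx2 (X := Sigma 2) b (~~ b)) (wt2 p q)) = pt (vx2 (X := Sigma 2) (~~ b) b) (wt2 p q).
Proof.
rewrite realization_map_pt ?Sigma2_simp//; congr (pt _ _).
by apply/ffunP => -[[|[|//]] i2]; rewrite !ffunE /= ?negbK.
Qed.

Lemma hemisphere_equator_act x y : x ^+ 2 + y ^+ 2 = 1 ->
  nu (hemisphere (- x) (- y) 0) = hemisphere x y 0.
Proof.
move=> xy; rewrite !hemisphere_equator ?sqrrN// oppr_ge0 opprK.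
have e2 : (1 + 1) / 2 = 1 :> R by field.
have [y0|y0|y0] := ltgtP y 0; rewrite ?(pt2_act false) ?(pt2_act true)//.
move: xy; rewrite y0 expr0n addr0 => /eqP; rewrite sqrf_eq1 => /orP[]/eqP ->.
  by rewrite subrr mul0r e2 -pt2_face1 -?pt2_face0 ?Sigma2_simp.
by rewrite opprK subrr mul0r e2 -pt2_face0 -?pt2_face1 ?Sigma2_simp.
Qed.

Lemma sphere_act x y s : x ^+ 2 + y ^+ 2 = 1 -> nu (sphere x y s) = sphere (- x) (- y) (- s).
Proof.
move=> xy; rewrite /sphere !opprK oppr_le0; have [s0|s0|->] := ltgtP s 0.
- by rewrite nuK.
- by [].
by rewrite oppr0 clamp_id ?lexx ?ler01// -hemisphere_equator_act ?nuK.
Qed.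

Lemma sphere_top x y s : 1 <= s -> sphere x y s = yellow R.
Proof.
move=> s1; rewrite /sphere oppr_le0 (le_trans ler01 s1) clamp_ge ?ler01//.
rewrite /hemisphere /hemi_wt /hemi_wt'.
have -> : wt_blue x 1 = 0 by rewrite /wt_blue mulr1 subrr min_r// mulr0.
by rewrite !mul0r subr0 if_same pt_yellow_pole.
Qed.

Lemma sphere_continuous (T : topologicalType) (X Y Sg : T -> R) :
  continuous X -> continuous Y -> continuous Sg -> (forall p, X p ^+ 2 + Y p ^+ 2 = 1) ->
  continuous (fun p => sphere (X p) (Y p) (Sg p)).
Proof.
move=> cX cY cS XY; rewrite /sphere; apply: paste; first by cont.
- apply: hemisphere_continuous => //; first exact: (cont_comp cS (@clamp_continuous R 0 1)).
  by move=> p; rewrite clamp_itv.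
- apply: (cont_comp _ (@realization_map_continuous R _ _ (act (Sigma 2)))).
  apply: hemisphere_continuous; [by cont|by cont| |by move=> p; rewrite !sqrrN|by move=> p; rewrite clamp_itv].
  exact: (cont_comp (contN cS) (@clamp_continuous R 0 1)).
move=> p /eqP; rewrite oppr_eq0 => /eqP ->.
by rewrite oppr0 clamp_id ?lexx ?ler01// hemisphere_equator_act.
Qed.
End SphereCoordinates.

(** * Squares and annuli in |Gamma_L^n| *)

Section ConcatFacts.
Variables (R : realType) (T Y : topologicalType).

Lemma eq_concat (h : T -> R) (P : nat -> T -> Y) N x x' : h x = h x' ->
  (forall k, P k x = P k x') -> concat h P N x = concat h P N x'.
Proof. by move=> hx PP; elim: N => [|N IH] //=; rewrite hx IH PP. Qed.

Lemma concat_const (A : Type) (F : Y -> A) (h : T -> R) (P : nat -> T -> Y) N x c :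
  (forall k, F (P k x) = c) -> F (concat h P N x) = c.
Proof. by move=> Pc; elim: N => [|N IH] //=; case: ifP. Qed.

Lemma concat_indep (A : Type) (F : Y -> A) (h : T -> R) (P : nat -> T -> Y) N x x' : h x = h x' ->
  (forall k, F (P k x) = F (P k x')) -> F (concat h P N x) = F (concat h P N x').
Proof. by move=> hx PP; elim: N => [|N IH] //=; rewrite hx; case: ifP. Qed.
End ConcatFacts.

Section Square.
Variables (R : realType) (X : relSSet) (p00 p10 p01 p11 : vert X).

(** The product of two edges, cut along the diagonal from [p00] to [p11]; the weights have one
    formula for both triangles. *)
Definition square_wt (y y' : R) : 'rV[R]_3 := wt3 (1 - Num.max y y') `|y - y'| (Num.min y y').
Definition square (y y' : R) : realization R X :=
  if y' - y <= 0 then pt (vx3 p00 p10 p11) (square_wt y y') else pt (vx3 p00 p01 p11) (square_wt y y').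

Lemma square_wt_le (y y' : R) : y' <= y -> square_wt y y' = wt3 (1 - y) (y - y') y'.
Proof. by move=> yy'; rewrite /square_wt max_l// min_r// ger0_norm// subr_ge0. Qed.

Lemma square_wt_ge (y y' : R) : y <= y' -> square_wt y y' = wt3 (1 - y') (y' - y) y.
Proof. by move=> yy'; rewrite /square_wt max_r// min_l// distrC ger0_norm// subr_ge0. Qed.

Lemma square_wt_Delta (y y' : R) : 0 <= y <= 1 -> 0 <= y' <= 1 -> @Delta_set R 2 (square_wt y y').
Proof.
move=> /andP[y0 y1] /andP[y'0 y'1]; have [yy'|/ltW yy'] := leP y y'.
  by rewrite square_wt_ge//; apply: wt3_Delta; rewrite ?subr_ge0//; ring.
by rewrite square_wt_le//; apply: wt3_Delta; rewrite ?subr_ge0//; ring.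
Qed.

Hypotheses (h1 : vx3 p00 p10 p11 \in simp X 2) (h2 : vx3 p00 p01 p11 \in simp X 2).

Lemma square_continuous (T : topologicalType) (y y' : T -> R) :
  continuous y -> continuous y' -> (forall p, 0 <= y p <= 1) -> (forall p, 0 <= y' p <= 1) ->
  continuous (fun p => square (y p) (y' p)).
Proof.
move=> cy cy' y01 y'01; have cw i : continuous (fun p => square_wt (y p) (y' p) 0 i).
  by rewrite /square_wt; apply: wt3_continuous; cont.
apply: paste; first by cont.
- by apply: (@pt_continuous _ _ _ _ _ (fun p => square_wt (y p) (y' p))) => // p; exact: square_wt_Delta.
- by apply: (@pt_continuous _ _ _ _ _ (fun p => square_wt (y p) (y' p))) => // p; exact: square_wt_Delta.
move=> p /eqP; rewrite subr_eq0 => /eqP ->; rewrite square_wt_le// subrr.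
by have /andP[y0 y1] := y01 p; rewrite -!pt3_face02// ?subr_ge0 ?subrK.
Qed.

Lemma square_left (y' : R) : 0 <= y' <= 1 -> square 0 y' = pt (vx2 p00 p01) (wt2 (1 - y') y').
Proof.
move=> /andP[y0 y1]; rewrite /square subr0; case: ifP => y'0.
  have -> : y' = 0 by apply/eqP; rewrite eq_le y'0.
  have f01 := vx3_simp01 h2; have f01' := vx3_simp01 h1.
  rewrite square_wt_le// !subr0 -pt2_face0//.
  by rewrite -pt3_face01 ?addr0// -pt2_face0.
by rewrite square_wt_ge// subr0 -pt3_face01// ?subr_ge0 ?subrK.
Qed.

Lemma square_right (y' : R) : 0 <= y' <= 1 -> square 1 y' = pt (vx2 p10 p11) (wt2 (1 - y') y').
Proof.
move=> /andP[y0 y1]; rewrite /square subr_le0 y1 square_wt_le// subrr.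
by rewrite -pt3_face12// ?subr_ge0 ?subrK.
Qed.

Lemma square_bottom (y : R) : 0 <= y <= 1 -> square y 0 = pt (vx2 p00 p10) (wt2 (1 - y) y).
Proof.
move=> /andP[y0 y1]; rewrite /square sub0r oppr_le0 y0 square_wt_le// subr0.
by rewrite -pt3_face01// ?subr_ge0 ?subrK.
Qed.

Lemma square_top (y : R) : 0 <= y <= 1 -> square y 1 = pt (vx2 p01 p11) (wt2 (1 - y) y).
Proof.
move=> /andP[y0 y1]; rewrite /square subr_le0; case: ifP => y'1.
  have -> : y = 1 by apply/eqP; rewrite eq_le y1.
  have f12 := vx3_simp12 h2; have f12' := vx3_simp12 h1.
  rewrite square_wt_le// !subrr -pt2_face1//.
  by rewrite -pt3_face12 ?add0r// -pt2_face1.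
by rewrite square_wt_ge// subrr -pt3_face12// ?subr_ge0 ?subrK.
Qed.
End Square.

(** Both triangles are mapped to degenerate ones, because [f] does not change in the second
    direction. *)
Lemma square_map (R : realType) (X Y : relSSet) (f : simplicialMap X Y)
  (p00 p10 p01 p11 : vert X) (c d : vert Y) (y y' : R) :
  vx3 p00 p10 p11 \in simp X 2 -> vx3 p00 p01 p11 \in simp X 2 ->
  f p00 = c -> f p01 = c -> f p10 = d -> f p11 = d ->
  0 <= y <= 1 -> 0 <= y' <= 1 ->
  realization_map R f (square p00 p10 p01 p11 y y') = pt (vx2 c d) (wt2 (1 - y) y).
Proof.
move=> h1 h2 f00 f01 f10 f11 y01 y'01.
have cd : vx2 c d \in simp Y 1.
  have -> : vx2 c d = [ffun i => f (vx2 p00 p10 i)].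
    by apply/ffunP => -[[|[|//]] ?]; rewrite !ffunE.
  exact: vmap_simp (vx3_simp01 h1).
move: y01 y'01 => /andP[y0 y1] /andP[y'0 y'1].
rewrite /square subr_le0; case: ifPn => [yy'|]; last rewrite -ltNge => /ltW yy'.
  rewrite realization_map_pt// square_wt_le//.
  have -> : [ffun i => f (vx3 p00 p10 p11 i)] = vx3 c d d.
    by apply/ffunP => -[[|[|[|//]]] ?]; rewrite !ffunE.
  by rewrite pt3_deg12 ?subr_ge0 ?subrK//; ring.
rewrite realization_map_pt// square_wt_ge//.
have -> : [ffun i => f (vx3 p00 p01 p11 i)] = vx3 c c d.
  by apply/ffunP => -[[|[|[|//]]] ?]; rewrite !ffunE.
rewrite pt3_deg01 ?subr_ge0//; last by ring.
by rewrite (_ : 1 - y' + (y' - y) = 1 - y)//; ring.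
Qed.

Section ConcatMore.
Variables (R : realType) (T Y : topologicalType).

Lemma concat_ext (h : T -> R) (P P' : nat -> T -> Y) N x :
  (forall k, P k x = P' k x) -> concat h P N x = concat h P' N x.
Proof. by move=> PP; elim: N => [|N IH] /=; rewrite ?IH ?PP. Qed.

Lemma concat_map (Y' : topologicalType) (F : Y -> Y') (h : T -> R) (P : nat -> T -> Y) N x :
  F (concat h P N x) = concat h (fun k x => F (P k x)) N x.
Proof. by elim: N => [|N IH] //=; case: ifP. Qed.

Lemma concat_ind (Pr : Y -> Prop) (h : T -> R) (P : nat -> T -> Y) N x :
  (forall k, Pr (P k x)) -> Pr (concat h P N x).
Proof. by move=> PP; elim: N => [|N IH] //=; case: ifP. Qed.
End ConcatMore.

Lemma square_swap (R : realType) (X : relSSet) (p00 p10 p01 p11 : vert X) (y y' : R) :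
  vx3 p00 p10 p11 \in simp X 2 -> vx3 p00 p01 p11 \in simp X 2 ->
  0 <= y <= 1 -> square p00 p10 p01 p11 y y' = square p00 p01 p10 p11 y' y.
Proof.
move=> h1 h2 /andP[y0 y1]; rewrite /square !subr_le0 /square_wt distrC maxC minC.
case: ltgtP => // ->.
by rewrite subrr normr0 ?maxxx ?minxx -!pt3_face02// ?subr_ge0 ?subrK.
Qed.

Lemma nat_floor (R : realType) (u : R) N : (0 < N)%N -> 0 <= u <= N%:R ->
  exists2 a, (a < N)%N & a%:R <= u <= a.+1%:R.
Proof.
case: N => [//|N] _; elim: N => [|N IH] /andP[u0 uN]; first by exists 0%N; rewrite ?u0.
have [uN1|/ltW uN1] := leP u N.+1%:R.
  by have [|a aN ua] := IH; [rewrite u0|exists a => //; exact: ltnW].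
by exists N.+1; rewrite ?uN1.
Qed.

(** * The product of an edge path and the circle of a coordinate *)

Section GammaLoop.
Variables (R : realType) (L : nat).
Hypotheses (L4 : (4 %| L)%N) (L_ge4 : (4 <= L)%N).
Variables (n : nat) (i : 'I_n) (s : {ffun 'I_n -> 'Z_L}).
Notation V := {ffun 'I_n -> 'Z_L}.
Notation X := (power n (Gamma L4)).

(* The edge path: the step from an even index to the next is a move up, the other steps are moves down. *)
Definition vtx (k : nat) (w : 'Z_L) : V :=
  let sk := [ffun j => s j + (k./2)%:R] in if odd k then odpoint i sk w else evpoint i sk w.

Lemma vtx_i k w : vtx k w i = w.
Proof. by rewrite /vtx; case: odd; rewrite !ffunE ltnn eqxx. Qed.

Lemma vtx_neq k w w' j : j != i -> vtx k w j = vtx k w' j.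
Proof. by move=> ji; rewrite /vtx; case: odd; rewrite !ffunE (negbTE ji). Qed.

Lemma gle_vtx k w j : gle (vtx (evn k) w j) (vtx (odn k) w j).
Proof.
rewrite /vtx /evn /odn; case ok: (odd k); rewrite /= ok /= !ffunE.
  rewrite uphalf_half ok add1n mulrSr addrA.
  have [_|_] := ltnP j i; first exact: gle_odzS.
  by have [_|_] := eqVneq j i; [exact: gle_refl|exact: gle_evzS].
rewrite uphalf_half ok add0n.
have [_|_] := ltnP j i; first exact: gle_odz.
by have [_|_] := eqVneq j i; [exact: gle_refl|exact: gle_evz].
Qed.

Lemma odd_Zp_nat a : odd (a%:R : 'Z_L) = odd a.
Proof. by rewrite val_Zp_nat ?odd_modL// (leq_trans _ L_ge4). Qed.

Lemma gle_natr a : gle ((evn a)%:R : 'Z_L) (odn a)%:R.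
Proof.
rewrite /evn /odn; case oa: (odd a); rewrite mulrSr.
  by have := gle_odzS L4 L_ge4 (a%:R); rewrite /odz odd_Zp_nat oa.
by have := gle_odz L4 L_ge4 (a%:R); rewrite /odz odd_Zp_nat oa.
Qed.

Lemma gle_corner k (b c : 'Z_L) : gle b c -> forall j, gle (vtx (evn k) b j) (vtx (odn k) c j).
Proof.
move=> bc j; have [->|ji] := eqVneq j i; first by rewrite !vtx_i.
by rewrite (vtx_neq (odn k) c b ji) gle_vtx.
Qed.

Lemma gle_side k (b c : 'Z_L) : gle b c -> forall j, gle (vtx k b j) (vtx k c j).
Proof.
move=> bc j; have [->|ji] := eqVneq j i; first by rewrite !vtx_i.
by rewrite (vtx_neq k c b ji) gle_refl.
Qed.

Lemma power_simp3 (x y z : V) : (forall j, gle (x j) (y j)) -> (forall j, gle (y j) (z j)) ->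
  (forall j, gle (x j) (z j)) -> vx3 (X := X) x y z \in simp X 2.
Proof.
move=> xy yz xz; rewrite inE; apply/forallP => j; rewrite inE; apply/'forall_forallP => a b.
apply/implyP; rewrite !ffunE; have r := gle_refl.
case: a => [[|[|[|//]]] ?]; case: b => [[|[|[|//]]] ?]; rewrite //= => _.
all: by have := (xy j, yz j, xz j, r L (x j), r L (y j), r L (z j)); rewrite /gle => -[[[[[? ?] ?] ?] ?] ?].
Qed.

Lemma odd_half : odd L./2 = false.
Proof.
case/dvdnP: L4 => q ->; rewrite (_ : (q * 4 = q.*2.*2)%N) ?doubleK ?odd_double//.
by rewrite -!muln2 -mulnA.
Qed.

(** Divisibility of [L] by 4 makes [L./2] even, so that the shift commutes with [evz] and [odz]. *)
Lemma vtx_half k w : vtx (k + L) (w + L./2%:R) = act X (vtx k w).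
Proof.
have eL : odd L = false := evenL L4.
have h2 : ~~ odd (L./2%:R : 'Z_L).
  by rewrite odd_Zp_nat odd_half.
have hk : ((k + L)./2)%:R = (k./2)%:R + L./2%:R :> 'Z_L by rewrite halfD eL andbF add0n natrD.
apply/ffunP => j; rewrite [RHS]ffunE /= /Gamma_act_fun /vtx oddD eL addbF hk.
case: (odd k); rewrite !ffunE addrA.
  have [_|_] := ltnP j i; first by rewrite (odzD L4 L_ge4 _ h2).
  by have [_|_] := eqVneq j i.
have [_|_] := ltnP j i; first by [].
by have [_|_] := eqVneq j i => //; rewrite (evzD L4 L_ge4 _ h2).
Qed.

(** The position is measured from the even end, so it runs backwards on the edges of odd index and
    lowest corners stay lowest. *)
Definition edge_pos (k : nat) (Z : R) : R := clamp 0 1 `|Z - (evn k)%:R|.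

Lemma edge_pos_itv k Z : 0 <= edge_pos k Z <= 1.
Proof. by rewrite clamp_itv. Qed.

Lemma edge_pos_end k : edge_pos k k.+1%:R = (~~ odd k)%:R.
Proof.
rewrite /edge_pos /evn; case: (odd k) => /=.
  by rewrite subrr normr0 clamp_le.
by rewrite -natrB// subSnn normr1 clamp_ge// ler01 lexx.
Qed.

Lemma edge_pos_start k : edge_pos k k%:R = (odd k)%:R.
Proof.
rewrite /edge_pos /evn; case: (odd k) => /=; last by rewrite subrr normr0 clamp_le.
by rewrite distrC -natrB// subSnn normr1 clamp_ge// ler01 lexx.
Qed.

Lemma edge_pos_continuous k : continuous (edge_pos k).
Proof. by apply: (cont_comp _ (@clamp_continuous R 0 1)); cont. Qed.

Definition tile (k a : nat) (p : R * R) : realization R X :=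
  square (X := X) (vtx (evn k) (evn a)%:R) (vtx (odn k) (evn a)%:R)
    (vtx (evn k) (odn a)%:R) (vtx (odn k) (odn a)%:R) (edge_pos k p.1) (edge_pos a p.2).

Lemma tile_simp1 k a : vx3 (X := X) (vtx (evn k) (evn a)%:R) (vtx (odn k) (evn a)%:R)
  (vtx (odn k) (odn a)%:R) \in simp X 2.
Proof.
apply: power_simp3; [exact: gle_vtx| |exact: gle_corner (gle_natr a)].
exact: gle_side (gle_natr a).
Qed.

Lemma tile_simp2 k a : vx3 (X := X) (vtx (evn k) (evn a)%:R) (vtx (evn k) (odn a)%:R)
  (vtx (odn k) (odn a)%:R) \in simp X 2.
Proof.
apply: power_simp3; [|exact: gle_vtx|exact: gle_corner (gle_natr a)].
exact: gle_side (gle_natr a).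
Qed.

Lemma tile_continuous k a : continuous (tile k a).
Proof.
apply: square_continuous; [exact: tile_simp1|exact: tile_simp2| | |move=> p|move=> p].
- by apply: (cont_comp _ (@edge_pos_continuous k)); cont.
- by apply: (cont_comp _ (@edge_pos_continuous a)); cont.
- exact: edge_pos_itv.
- exact: edge_pos_itv.
Qed.

Lemma tile_top k a p : p.2 = a.+1%:R -> tile k a p = tile k a.+1 p.
Proof.
move=> p2; rewrite /tile p2 edge_pos_end edge_pos_start /=.
case oa: (odd a) => /=.
  rewrite !square_bottom ?edge_pos_itv ?tile_simp1 ?tile_simp2//.
  by rewrite /evn /= oa.
rewrite !square_top ?edge_pos_itv ?tile_simp1 ?tile_simp2//.
by rewrite /odn /= oa.
Qed.

Lemma tile_right k a p : p.1 = k.+1%:R -> tile k a p = tile k.+1 a p.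
Proof.
move=> p1; rewrite /tile p1 edge_pos_end edge_pos_start /=.
case ok: (odd k) => /=.
  rewrite !square_left ?edge_pos_itv ?tile_simp1 ?tile_simp2//.
  by rewrite /evn /= ok.
rewrite !square_right ?edge_pos_itv ?tile_simp1 ?tile_simp2//.
by rewrite /odn /= ok.
Qed.

Definition strip (k : nat) : R * R -> realization R X := concat snd (tile k) L.-1.
Lemma strip_right k p : p.1 = k.+1%:R -> strip k p = strip k.+1 p.
Proof. by move=> p1; apply: concat_ext => a; exact: tile_right. Qed.

(** The first argument runs from 0 to [L] over half of the path, the second once around the circle;
    the pieces are numbered from 0, hence [L.-1]. *)
Definition annulus : R * R -> realization R X := concat fst strip L.-1.

Lemma annulus_continuous : continuous annulus.
Proof.
apply: concat_continuous => [|k|k p p1].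
- by apply: cont_fst; exact: cont_id.
- apply: concat_continuous => [|a|a p p2]; [by apply: cont_snd; exact: cont_id|exact: tile_continuous|exact: tile_top].
- exact: strip_right.
Qed.

Let L1 : (0 < L)%N. Proof. exact: leq_trans L_ge4. Qed.

Lemma stripE k a p : (a < L)%N -> a%:R <= p.2 <= a.+1%:R -> strip k p = tile k a p.
Proof.
move=> aL /andP[ap pa]; apply: concatE => //; [exact: tile_top|by rewrite -ltnS prednK|by left].
Qed.

Lemma annulus_start a u : (a < L)%N -> a%:R <= u <= a.+1%:R -> annulus (0, u) =
  pt (vx2 (X := X) (vtx 0 (evn a)%:R) (vtx 0 (odn a)%:R)) (wt2 (1 - edge_pos a u) (edge_pos a u)).
Proof.
move=> aL au; rewrite /annulus (concatE (k := 0%N))//=.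
- rewrite (stripE _ aL)// /tile /= (edge_pos_start 0) /= square_left ?edge_pos_itv//.
    exact: (tile_simp1 0).
  exact: (tile_simp2 0).
- exact: strip_right.
- by left.
Qed.

Lemma annulus_end a u : (a < L)%N -> a%:R <= u <= a.+1%:R -> annulus (L%:R, u) =
  pt (vx2 (X := X) (vtx L (evn a)%:R) (vtx L (odn a)%:R)) (wt2 (1 - edge_pos a u) (edge_pos a u)).
Proof.
move=> aL au; have oL : odd L.-1 by have := evenL L4; rewrite -[in odd L](prednK L1) /= => /negbFE.
rewrite /annulus (concatE (k := L.-1))//=.
- have := tile_simp1 L.-1 a; have := tile_simp2 L.-1 a.
  have e1 : evn L.-1 = L by rewrite /evn oL prednK.
  rewrite (stripE _ aL)// /tile /= -[in L%:R](prednK L1) edge_pos_end oL /= e1 => h2 h1.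
  by rewrite square_left ?edge_pos_itv.
- exact: strip_right.
- by rewrite ler_nat leq_pred.
- by right.
Qed.

Lemma annulus_periodic Z : annulus (Z, 0) = annulus (Z, L%:R).
Proof.
apply: eq_concat => // k; rewrite (@stripE k 0)//= ?lexx ?ler01//.
have oL : odd L.-1 by have := evenL L4; rewrite -[in odd L](prednK L1) /= => /negbFE.
rewrite (@stripE k L.-1)//= ?prednK ?lexx ?ler_nat ?leq_pred//.
have := tile_simp1 k L.-1; have := tile_simp2 k L.-1.
rewrite /tile /= (edge_pos_start 0) -[in L%:R](prednK L1) edge_pos_end oL /=.
have -> : evn L.-1 = L by rewrite /evn oL prednK.
have -> : L%:R = 0 :> 'Z_L by rewrite pchar_Zp// (leq_trans _ L_ge4).
by move=> h2 h1; rewrite !square_bottom ?edge_pos_itv ?(tile_simp1 k 0).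
Qed.

Lemma evn_shift a : (evn (a + L./2))%:R = (evn a)%:R + L./2%:R :> 'Z_L.
Proof.
have h2 := odd_half.
by rewrite /evn oddD h2 addbF -natrD; case: ifP.
Qed.

Lemma odn_shift a : (odn (a + L./2))%:R = (odn a)%:R + L./2%:R :> 'Z_L.
Proof.
have h2 := odd_half.
by rewrite /odn oddD h2 addbF -natrD; case: ifP.
Qed.

Lemma edge_pos_shift a u : edge_pos (a + L./2) (u + L./2%:R) = edge_pos a u.
Proof.
have h2 := odd_half.
rewrite /edge_pos /evn oddD h2 addbF; congr (clamp _ _ `|_|).
by case: ifP => _; rewrite -?addSn natrD; ring.
Qed.

Lemma edge_simp k a : vx2 (X := X) (vtx k (evn a)%:R) (vtx k (odn a)%:R) \in simp X 1.
Proof.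
have := power_simp3 (gle_side k (gle_natr a)) (gle_side k (gle_refl _)) (gle_side k (gle_natr a)).
exact: vx3_simp01.
Qed.

(** By [vtx_half] the half path ends at the antipode of its start, with the circle turned by half.
    Two equations for [u] in half of the circle avoid reduction modulo [L]. *)
Lemma annulus_act u : 0 <= u <= (L./2)%:R ->
  annulus (L%:R, u + L./2%:R) = realization_map R (act X) (annulus (0, u)) /\
  annulus (L%:R, u) = realization_map R (act X) (annulus (0, u + L./2%:R)).
Proof.
have L2 : (0 < L./2)%N by rewrite half_gt0 (leq_trans _ L_ge4).
move=> /(nat_floor L2)[a aL2 au].
have LL : (L./2 + L./2)%N = L by rewrite addnn -[RHS]odd_double_half (evenL L4).
have aL : (a < L)%N by rewrite (leq_trans aL2)// -[leqRHS]LL leq_addr.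
have aL' : (a + L./2 < L)%N by rewrite -[ltnRHS]LL ltn_add2r.
have au' : (a + L./2)%:R <= u + L./2%:R <= (a + L./2).+1%:R.
  by rewrite -addSn !natrD !lerD2r.
have vxact k w w' : [ffun j => act X (vx2 (X := X) (vtx k w) (vtx k w') j)] =
    vx2 (X := X) (vtx (k + L) (w + L./2%:R)) (vtx (k + L) (w' + L./2%:R)).
  by apply/ffunP => -[[|[|//]] ?]; rewrite [LHS]ffunE !ffunE /= vtx_half.
rewrite (annulus_end aL' au') (annulus_start aL au) (annulus_end aL au) (annulus_start aL' au').
rewrite !realization_map_pt ?edge_simp// !vxact add0n !edge_pos_shift !evn_shift !odn_shift.
have hz : L./2%:R + L./2%:R = 0 :> 'Z_L by rewrite -natrD LL pchar_Zp// (leq_trans _ L_ge4).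
by rewrite -!addrA !hz !addr0.
Qed.
End GammaLoop.

(** * Planar coordinates of |Gamma_L| *)

Section ComplexContinuity.
Variables (R : realType) (T : topologicalType).
Local Open Scope complex_scope.
Implicit Types F G : T -> R[i].

Definition ccontinuous F :=
  continuous (fun p => complex.Re (F p)) /\ continuous (fun p => complex.Im (F p)).

Lemma ccontM F G : ccontinuous F -> ccontinuous G -> ccontinuous (fun p => F p * G p).
Proof.
move=> [fr fi] [gr gi]; split.
  rewrite (_ : (fun p => _) = (fun p => complex.Re (F p) * complex.Re (G p) - complex.Im (F p) * complex.Im (G p))).
    by cont.
  by apply/funext => p; case: (F p); case: (G p).
rewrite (_ : (fun p => _) = (fun p => complex.Re (F p) * complex.Im (G p) + complex.Im (F p) * complex.Re (G p))).
  by cont.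
by apply/funext => p; case: (F p); case: (G p).
Qed.

Lemma ccont_prod (K : Type) (r : seq K) (P : pred K) (F : K -> T -> R[i]) :
  (forall k, ccontinuous (F k)) -> ccontinuous (fun p => \prod_(k <- r | P k) F k p).
Proof.
move=> cF; elim: r => [|k r IH].
  under eq_fun do rewrite big_nil; split; exact: cont_cst.
under eq_fun do rewrite big_cons; case: (P k) => //.
exact: ccontM.
Qed.

Lemma div_normc (z : R[i]) (r := Num.sqrt (complex.Re z ^+ 2 + complex.Im z ^+ 2)) :
  z / `|z| = (complex.Re z / r) +i* (complex.Im z / r).
Proof.
rewrite normc_def -/r -fmorphV /=; case: z @r => x y r; set a := r^-1.
by apply/eqP; rewrite eq_complex /= !mulr0 subr0 add0r !eqxx.
Qed.

Lemma ccont_normalize F : ccontinuous F -> (forall p, F p != 0) ->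
  ccontinuous (fun p => F p / `|F p|).
Proof.
move=> [fr fi] F0.
have cN : continuous (fun p => (Num.sqrt (complex.Re (F p) ^+ 2 + complex.Im (F p) ^+ 2))^-1).
  move=> p; apply: cvgV.
    rewrite sqrtr_eq0 -ltNge; have := F0 p; case: (F p) => x y /=.
    rewrite eq_complex /= negb_and => xy; rewrite lt_neqAle addr_ge0 ?sqr_ge0// andbT eq_sym.
    by rewrite paddr_eq0 ?sqr_ge0// !sqrf_eq0 negb_and.
  apply: (cvg_comp (fun p => complex.Re (F p) ^+ 2 + complex.Im (F p) ^+ 2)); last exact: sqrt_continuous.
  have c : continuous (fun p => complex.Re (F p) * complex.Re (F p) + complex.Im (F p) * complex.Im (F p)) by cont.
  exact: c.
split.
  rewrite (_ : (fun p => _) = (fun p => complex.Re (F p) * (Num.sqrt (complex.Re (F p) ^+ 2 + complex.Im (F p) ^+ 2))^-1)).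
    by cont.
  by apply/funext => p; rewrite div_normc.
rewrite (_ : (fun p => _) = (fun p => complex.Im (F p) * (Num.sqrt (complex.Re (F p) ^+ 2 + complex.Im (F p) ^+ 2))^-1)).
  by cont.
by apply/funext => p; rewrite div_normc.
Qed.
End ComplexContinuity.

Section Planar.
Variables (R : realType) (L : nat).
Hypotheses (L4 : (4 %| L)%N) (L_ge4 : (4 <= L)%N).
Local Open Scope complex_scope.

Let L0 : (L%:R : R) != 0.
Proof. by rewrite pnatr_eq0 -lt0n (leq_trans _ L_ge4). Qed.

Lemma polygon_vertex_nat (k : nat) : polygon_vertex R (k%:R : 'Z_L) =
  cos (2 * pi * k%:R / L%:R) +i* sin (2 * pi * k%:R / L%:R).
Proof.
rewrite /polygon_vertex val_Zp_nat; last by rewrite (leq_trans _ L_ge4).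
have -> : 2 * pi * k%:R / L%:R = 2 * pi * (k %% L)%:R / L%:R + (pi *+ 2) *+ (k %/ L) :> R.
  rewrite [in LHS](divn_eq k L) natrD natrM -[in RHS]mulr_natr -[in RHS]mulr_natr.
  by field.
by rewrite (periodicn (@cosD2pi R)) (periodicn (@sinD2pi R)).
Qed.

Lemma polygon_vertex_half (a : 'Z_L) : polygon_vertex R (a + L./2%:R) = - polygon_vertex R a.
Proof.
rewrite -[in LHS](natr_Zp a) -natrD polygon_vertex_nat.
have -> : 2 * pi * (a + L./2)%:R / L%:R = 2 * pi * a%:R / L%:R + pi :> R.
  have h : (L%:R : R) = L./2%:R * 2.
    by rewrite -natrM muln2 -[in LHS](odd_double_half L) (evenL L4).
  have h0 : (L./2%:R : R) != 0 by have := L0; rewrite h mulf_eq0 negb_or => /andP[].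
  by rewrite natrD h; field.
by rewrite cosDpi sinDpi /polygon_vertex; apply/eqP; rewrite eq_complex /= !eqxx.
Qed.

Lemma polygon_angle : 0 <= cos (2 * pi / L%:R : R).
Proof.
apply: cos_ge0_pihalf; apply/andP; split.
  by rewrite (@le_trans _ _ 0)// ?oppr_le0 divr_ge0 ?mulr_ge0 ?pi_ge0.
rewrite ler_pdivrMr; last by rewrite ltr0n (leq_trans _ L_ge4).
have : (4 : R) <= L%:R by rewrite ler_nat.
by have := @pi_ge0 R; nra.
Qed.

Definition cdot (z w : R[i]) : R := complex.Re z * complex.Re w + complex.Im z * complex.Im w.

Lemma polygon_vertex_norm (a : 'Z_L) : cdot (polygon_vertex R a) (polygon_vertex R a) = 1.
Proof. by rewrite /cdot /= -!expr2 cos2Dsin2. Qed.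

Lemma polygon_vertex_adjacent (a : 'Z_L) : 0 <= cdot (polygon_vertex R (a + 1)) (polygon_vertex R a).
Proof.
rewrite -[a](natr_Zp a) -mulrSr !polygon_vertex_nat /cdot /= -cosB.
have -> : 2 * pi * a.+1%:R / L%:R - 2 * pi * a%:R / L%:R = 2 * pi / L%:R :> R.
  by rewrite -natr1; field.
exact: polygon_angle.
Qed.

Lemma cdotC z w : cdot z w = cdot w z.
Proof. by rewrite /cdot mulrC [X in _ + X]mulrC. Qed.

Lemma polygon_vertex_gle (a b : 'Z_L) : gle a b -> 0 <= cdot (polygon_vertex R a) (polygon_vertex R b).
Proof.
rewrite /gle /Gamma_prec => /orP[/eqP->|/and3P[_ _ /orP[]]]; first by rewrite polygon_vertex_norm.
  by rewrite subr_eq => /eqP->; rewrite addrC polygon_vertex_adjacent.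
by rewrite subr_eq addrC => /eqP->; rewrite cdotC -{1}[b](subrK 1) polygon_vertex_adjacent.
Qed.

Definition planar (p : realization R (Gamma L4)) : R[i] := polygon_point (repr p).

Lemma planar_pt n (u : {ffun 'I_n.+1 -> vert (Gamma L4)}) (v : 'rV[R]_n.+1) :
  u \in simp (Gamma L4) n -> @Delta_set R n v ->
  planar (pt u v) = \sum_k (v 0 k)%:C * polygon_vertex R (u k).
Proof.
move=> uS vD; rewrite /planar (polygon_point_glue (repr_point_of _)).
by rewrite -[in RHS](to_simplexK uS) -[in RHS](to_DeltaK vD).
Qed.

Lemma planar_continuous : ccontinuous planar.
Proof.
have c (part : R[i] -> R) : (forall z w, part (z + w) = part z + part w) ->
    (forall (x : R) z, part (x%:C * z) = x * part z) -> part 0 = 0 ->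
    continuous (fun p => part (planar p)).
  move=> pD pZ p0; apply/quotient_continuous.
  rewrite (_ : _ \o _ = fun x => part (polygon_point x)); last first.
    by apply/funext => x; congr part; exact: (polygon_point_glue (repr_point_of x)).
  apply: (@sigT_continuous _ (fun s : {n : nat & nsimplex (Gamma L4) n} => Delta R (tag s)) _
    (fun s t => part (\sum_k ((val t) 0 k)%:C * polygon_vertex R (val (tagged s) k)))) => -[n u] /=.
  rewrite (_ : (fun t => _) = fun t : Delta R n => \sum_k ((val t) 0 k * part (polygon_vertex R (val u k)))).
    apply: cont_sum => k; apply: contM; last exact: cont_cst.
    apply: (@cont_comp _ _ _ (fun t : Delta R n => val t) (fun v : 'rV[R]_n.+1 => v 0 k)).
      exact: initial_continuous.
    exact: coord_continuous.
  apply/funext => t; rewrite (big_morph part pD p0).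
  by apply: eq_bigr => k _; rewrite pZ.
split; apply: c => //; first 1 last.
- by move=> x [a b] /=; rewrite mul0r subr0.
- by move=> [? ?] [? ?].
- by move=> x [a b] /=; rewrite mul0r addr0.
- by move=> [? ?] [? ?].
Qed.

Lemma planar_act p : planar (realization_map R (act (Gamma L4)) p) = - planar p.
Proof.
have [n [u [v [uS vD ->]]]] := pt_surj p.
rewrite realization_map_pt// !planar_pt//; last exact: (vmap_simp (act (Gamma L4))).
by rewrite -sumrN; apply: eq_bigr => k _; rewrite ffunE polygon_vertex_half mulrN.
Qed.

(** For [4 <= L] adjacent vertices of the polygon enclose at most a right angle, so the squared norm
    is at least (1 - y)^2 + y^2. *)
Lemma planar_edge_neq0 (a b : 'Z_L) (y : R) : gle a b -> 0 <= y <= 1 ->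
  vx2 (X := Gamma L4) a b \in simp (Gamma L4) 1 ->
  planar (pt (vx2 (X := Gamma L4) a b) (wt2 (1 - y) y)) != 0.
Proof.
move=> ab /andP[y0 y1] abS; rewrite planar_pt//; last by apply: wt2_Delta; rewrite ?subr_ge0 ?subrK.
rewrite !big_ord_recl big_ord0 !mxE !ffunE /= addr0; apply/eqP => E.
have := polygon_vertex_gle ab; have := polygon_vertex_norm a; have := polygon_vertex_norm b.
move: E; rewrite /cdot; case: (polygon_vertex R a) => a1 a2; case: (polygon_vertex R b) => b1 b2 /=.
move=> /eqP; rewrite eq_complex /= !mul0r !subr0 !addr0 => /andP[/eqP E1 /eqP E2] nb na ab0.
have : ((1 - y) * a1 + y * b1) ^+ 2 + ((1 - y) * a2 + y * b2) ^+ 2 = 0 by rewrite E1 E2 expr0n addr0.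
have -> : ((1 - y) * a1 + y * b1) ^+ 2 + ((1 - y) * a2 + y * b2) ^+ 2 =
  (1 - y) ^+ 2 * (a1 * a1 + a2 * a2) + y ^+ 2 * (b1 * b1 + b2 * b2) +
  2 * (y * (1 - y)) * (a1 * b1 + a2 * b2) by ring.
rewrite na nb !mulr1 => E.
have : 0 <= 2 * (y * (1 - y)) * (a1 * b1 + a2 * b2) by rewrite !mulr_ge0// subr_ge0.
have := sqr_ge0 (1 - 2 * y); nra.
Qed.
End Planar.

(** * The annulus in the coordinates of the torus *)

Lemma realization_map_comm (R : realType) (X Y : relSSet) (f : simplicialMap X Y)
    (g : simplicialMap X X) (h : simplicialMap Y Y) (p : realization R X) :
  (forall x, f (g x) = h (f x)) ->
  realization_map R f (realization_map R g p) = realization_map R h (realization_map R f p).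
Proof.
move=> fg; have [n [u [v [uS vD ->]]]] := pt_surj p.
rewrite !realization_map_pt//; [|exact: vmap_simp..].
by congr (pt _ _); apply/ffunP => k; rewrite !ffunE.
Qed.

Section LoopDirection.
Variables (R : realType) (L : nat).
Hypotheses (L4 : (4 %| L)%N) (L_ge4 : (4 <= L)%N).
Variables (n : nat) (i : 'I_n) (s : {ffun 'I_n -> 'Z_L}).
Notation X := (power n (Gamma L4)).
Local Notation g := (annulus (R := R) L4 i s).

(** In each tile the colours of the corners depend only on the position along the path, so
    [square_map] applies. *)
Lemma annulus_colour (f : simplicialMap X (Sigma 2)) :
  (forall k w w', f (vtx i s k w) = f (vtx i s k w')) ->
  forall Z u u', realization_map R f (g (Z, u)) = realization_map R f (g (Z, u')).
Proof.
move=> fc Z u u'; apply: concat_indep => // k.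
pose c := pt (vx2 (X := Sigma 2) (f (vtx i s (evn k) 0)) (f (vtx i s (odn k) 0)))
  (wt2 (1 - edge_pos k Z) (edge_pos k Z)).
have cE v : realization_map R f (strip L4 i s k (Z, v)) = c.
  apply: concat_const => a; rewrite /tile.
  by apply: square_map; [exact: tile_simp1|exact: tile_simp2|exact: fc|exact: fc|exact: fc|exact: fc|exact: edge_pos_itv|exact: edge_pos_itv].
by rewrite !cE.
Qed.

Notation pr k := (realization_map R (Defs.proj (Gamma L4) k)).

Lemma pr_tile_neq j k a p : j != i -> pr j (tile L4 i s k a p) =
  pt (vx2 (X := Gamma L4) (vtx i s (evn k) 0 j) (vtx i s (odn k) 0 j))
    (wt2 (1 - edge_pos k p.1) (edge_pos k p.1)).
Proof.
move=> ji; apply: square_map; [exact: tile_simp1|exact: tile_simp2| | | | |exact: edge_pos_itv|exact: edge_pos_itv];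
  exact: vtx_neq.
Qed.

Lemma pr_tile_eq k a p : pr i (tile L4 i s k a p) =
  pt (vx2 (X := Gamma L4) (evn a)%:R (odn a)%:R) (wt2 (1 - edge_pos a p.2) (edge_pos a p.2)).
Proof.
(* The coordinate [i] moves in the second direction, whereas [square_map] keeps the first. *)
rewrite /tile square_swap; [|exact: tile_simp1|exact: tile_simp2|exact: edge_pos_itv].
apply: square_map; [exact: tile_simp2|exact: tile_simp1| | | | |exact: edge_pos_itv|exact: edge_pos_itv];
  exact: vtx_i.
Qed.

Lemma pr_annulus_neq j Z u u' : j != i -> pr j (g (Z, u)) = pr j (g (Z, u')).
Proof.
move=> ji; apply: concat_indep => // k.
pose c := pt (vx2 (X := Gamma L4) (vtx i s (evn k) 0 j) (vtx i s (odn k) 0 j))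
    (wt2 (1 - edge_pos k Z) (edge_pos k Z)).
have cE v : pr j (strip L4 i s k (Z, v)) = c.
  by apply: concat_const => a; rewrite pr_tile_neq.
by rewrite !cE.
Qed.

Lemma pr_annulus_eq Z Z' u : pr i (g (Z, u)) = pr i (g (Z', u)).
Proof.
pose c := concat (snd : R * R -> R) (fun a p => pt (vx2 (X := Gamma L4) (evn a)%:R (odn a)%:R)
  (wt2 (1 - edge_pos a p.2) (edge_pos a p.2))) L.-1 (Z, u).
have cE Y k : pr i (strip L4 i s k (Y, u)) = c.
  rewrite /strip concat_map /c; transitivity (concat (snd : R * R -> R)
    (fun a p => pt (vx2 (X := Gamma L4) (evn a)%:R (odn a)%:R) (wt2 (1 - edge_pos a p.2) (edge_pos a p.2))) L.-1 (Y, u)).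
    by apply: concat_ext => a; exact: pr_tile_eq.
  by apply: eq_concat => // a.
transitivity c; first by apply: concat_const.
by symmetry; apply: concat_const.
Qed.

Lemma gle_simp2 (a b : 'Z_L) : gle a b -> vx2 (X := Gamma L4) a b \in simp (Gamma L4) 1.
Proof.
move=> ab; rewrite inE; apply/'forall_forallP => c d; apply/implyP; rewrite !ffunE.
by case: c => [[|[|//]] ?]; case: d => [[|[|//]] ?] //= _; rewrite ?eqxx.
Qed.

Lemma planar_annulus_neq0 j p : planar (pr j (g p)) != 0.
Proof.
apply: (concat_ind (Pr := fun q => planar (pr j q) != 0)) => k.
apply: (concat_ind (Pr := fun q => planar (pr j q) != 0)) => a.
have [->|ji] := eqVneq j i.
  rewrite pr_tile_eq; apply: planar_edge_neq0 => //; [exact: gle_natr|exact: edge_pos_itv|].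
  exact/gle_simp2/gle_natr.
rewrite pr_tile_neq//; apply: planar_edge_neq0 => //; [exact: gle_vtx|exact: edge_pos_itv|].
exact/gle_simp2/gle_vtx.
Qed.

Definition direction (I : {set 'I_n}) (p : R * R) : circle R := circle_prod I (Gamma_torus (g p)).

Lemma Gamma_torusE j p : val (Gamma_torus (g p) j) = planar (pr j (g p)) / `|planar (pr j (g p))|.
Proof.
rewrite /Gamma_torus /Gamma_circle -/(planar _) val_insubd normrM normfV normr_id mulfV ?eqxx//.
by rewrite normr_eq0 planar_annulus_neq0.
Qed.

Lemma directionE I p : val (direction I p) =
  \prod_(j in I) (planar (pr j (g p)) / `|planar (pr j (g p))|).
Proof. by rewrite /=; apply: eq_bigr => j _; rewrite Gamma_torusE. Qed.

Lemma direction_continuous I : ccontinuous (fun p => val (direction I p)).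
Proof.
rewrite (_ : (fun p => _) = (fun p => \prod_(j in I) (planar (pr j (g p)) / `|planar (pr j (g p))|))).
  apply: ccont_prod => j; apply: ccont_normalize; last by move=> p; exact: planar_annulus_neq0.
  have cg : continuous (fun p => pr j (g p)).
    apply: (cont_comp _ (@realization_map_continuous R _ _ (Defs.proj (Gamma L4) j))).
    exact: annulus_continuous.
  have [cr ci] := @planar_continuous R L L4.
  by split; [exact: (cont_comp cg cr)|exact: (cont_comp cg ci)].
by apply/funext => p; rewrite directionE.
Qed.

Lemma pr_act j p : pr j (realization_map R (act X) p) = realization_map R (act (Gamma L4)) (pr j p).
Proof. by apply: realization_map_comm => x; rewrite /= ffunE. Qed.

(** Half of the path turns each coordinate other than [i] by half a turn, while the coordinate [i]
    depends on [u] alone. *)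
Lemma planar_end j u : planar (pr j (g (L%:R, u))) =
  (if j == i then 1 else -1) * planar (pr j (g (0, u))).
Proof.
have [->|ji] := eqVneq j i; first by rewrite mul1r (pr_annulus_eq _ 0).
rewrite mulN1r (pr_annulus_neq _ u (0 + L./2%:R) ji) (pr_annulus_neq _ u 0 ji).
have [|-> _] := @annulus_act R L L4 L_ge4 n i s 0; first by rewrite lexx ler0n.
by rewrite pr_act planar_act.
Qed.

(** The signs from the |I| - 1 coordinates other than [i] cancel because |I| is odd. *)
Lemma direction_end (I : {set 'I_n}) (u : R) : i \in I -> odd #|I| -> direction I (L%:R, u) = direction I (0, u).
Proof.
move=> iI oI; apply: val_inj; rewrite !directionE !(big_setD1 i iI) /= !planar_end//.
rewrite eqxx mul1r; congr (_ * _).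
under eq_bigr => j.
  rewrite in_setD1 => /andP[/negbTE ji _]; rewrite planar_end// ji mulN1r normrN mulNr; over.
rewrite prodrN; have -> : #|I :\ i| = #|I|.-1 by rewrite (cardsD1 i I) iI.
by rewrite -signr_odd; have := oI; case: #|I| => //= k /negbTE ->; rewrite expr0 mul1r.
Qed.

Lemma direction_half (I : {set 'I_n}) (u : R) : i \in I -> 0 <= u <= (L./2)%:R ->
  val (direction I (0, u + L./2%:R)) = - val (direction I (0, u)).
Proof.
move=> iI uL; rewrite !directionE !(big_setD1 i iI) /=.
have -> : planar (pr i (g (0, u + L./2%:R))) = - planar (pr i (g (0, u))).
  rewrite (pr_annulus_eq _ L%:R).
  by have [-> _] := annulus_act L4 L_ge4 i s uL; rewrite pr_act planar_act.
rewrite normrN !mulNr; congr (- (_ * _)); apply: eq_bigr => j.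
by rewrite in_setD1 => /andP[ji _]; rewrite (pr_annulus_neq _ _ u ji).
Qed.
End LoopDirection.

(** * Second homotopy groups *)

Section PlaneSpheres.
Variable R : realType.
Notation nrm p := (maxnorm p.1 p.2).

Lemma within_comp (T U W : topologicalType) (A : set U) (g : T -> U) (H : U -> W) :
  {within A, continuous H} -> continuous g -> (forall x, A (g x)) -> continuous (fun x => H (g x)).
Proof.
move=> /subspace_continuousP cH cg Ag x B HB.
have : nbhs (g x) [set y | A y -> B (H y)] := cH _ (Ag x) B HB.
move=> /cg /= gx; have gx' : nbhs x (g @^-1` [set y | A y -> B (H y)]) := gx.
by apply: filterS gx' => y /= /(_ (Ag y)).
Qed.

Section Based.
Variables (Y : topologicalType) (y0 : Y).
Implicit Types A B : R * R -> Y.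

(* Based spheres are encoded as maps of the plane that are constant outside the open square [|x|, |y| < 1]. *)
Definition plane_sphere A := continuous A /\ forall p, 1 <= nrm p -> A p = y0.

Definition plane_homotopic A B := exists K : R * R * R -> Y,
  [/\ continuous K, forall p t, 1 <= nrm p -> K (p, t) = y0,
      forall p, K (p, 0) = A p & forall p, K (p, 1) = B p].

Lemma plane_homotopic_refl A : plane_sphere A -> plane_homotopic A A.
Proof.
move=> [cA A0]; exists (fun q => A q.1); split=> //; last by move=> p t /A0.
by apply: (cont_comp _ cA); cont.
Qed.

Lemma plane_homotopic_sym A B : plane_homotopic A B -> plane_homotopic B A.
Proof.
move=> [K [cK K0 KA KB]]; exists (fun q => K (q.1, 1 - q.2)); split.
- by apply: (cont_comp _ cK); cont.
- by move=> p t; exact: K0.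
- by move=> p; rewrite subr0.
- by move=> p; rewrite subrr.
Qed.

Lemma plane_homotopic_trans A B C : plane_homotopic A B -> plane_homotopic B C ->
  plane_homotopic A C.
Proof.
move=> [K [cK K0 KA KB]] [K' [cK' K'0 K'B K'C]].
exists (fun q => if q.2 - 2^-1 <= 0 then K (q.1, 2 * q.2) else K' (q.1, 2 * q.2 - 1)); split.
- apply: paste; first by cont.
  + by apply: (cont_comp _ cK); cont.
  + by apply: (cont_comp _ cK'); cont.
  move=> [p t] /= /eqP; rewrite subr_eq0 => /eqP ->.
  by rewrite mulfV// subrr KB K'B.
- by move=> p t p1; rewrite K0// K'0// if_same.
- by move=> p /=; rewrite sub0r oppr_le0 invr_ge0 ler0n mulr0 KA.
- move=> p /=; rewrite ifF ?mulr1; last by apply/negbTE; rewrite -ltNge; lra.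
  by rewrite (_ : 2 - 1 = 1) ?K'C//; ring.
Qed.
End Based.

Definition cube_row (p : R * R) : 'rV[R]_2 :=
  wt2 (clamp 0 1 ((p.1 + 1) / 2)) (clamp 0 1 ((p.2 + 1) / 2)).

Lemma cube_row_subproof p : cube_row p \in [set s : 'rV[R]_2 | forall i, 0 <= s 0 i <= 1].
Proof. by apply/mem_set => -[[|[|//]] ?]; rewrite mxE clamp_itv. Qed.

Definition to_cube (p : R * R) : cube R 2 := exist _ (cube_row p) (cube_row_subproof p).
Definition of_cube (s : cube R 2) : R * R :=
  (2 * val s 0 ord0 - 1, 2 * val s 0 (lift ord0 ord0) - 1).

Lemma to_cube_continuous : continuous to_cube.
Proof.
apply: continuous_comp_initial; apply: rV_continuous => -[[|[|//]] k2].
  rewrite (_ : (fun p => _) = (fun p => clamp 0 1 ((p.1 + 1) / 2))).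
    by apply: (cont_comp _ (@clamp_continuous R 0 1)); cont.
  by apply/funext => p; rewrite mxE.
rewrite (_ : (fun p => _) = (fun p => clamp 0 1 ((p.2 + 1) / 2))).
  by apply: (cont_comp _ (@clamp_continuous R 0 1)); cont.
by apply/funext => p; rewrite mxE.
Qed.

Lemma of_cube_continuous : continuous of_cube.
Proof.
have cc i : continuous (fun s : cube R 2 => val s 0 i).
  apply: (@cont_comp _ _ _ (fun t : cube R 2 => val t) (fun v : 'rV[R]_2 => v 0 i)).
    exact: initial_continuous.
  exact: coord_continuous.
have c0 := cc ord0; have c1 := cc (lift ord0 ord0).
by apply: cont_pair; apply: contD; [apply: contM; [exact: cont_cst|exact: c0]|exact: cont_cst
  |apply: contM; [exact: cont_cst|exact: c1]|exact: cont_cst].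
Qed.

Lemma of_cubeK s : to_cube (of_cube s) = s.
Proof.
apply: val_inj; apply/rowP => k; have /set_mem sP := valP s.
rewrite mxE; case: k => [[|[|//]] k2] /=; rewrite subrK mulrC mulKf// clamp_id//.
  by rewrite (_ : Ordinal k2 = ord0)//; apply: val_inj.
by rewrite (_ : Ordinal k2 = lift ord0 ord0)//; apply: val_inj.
Qed.

Lemma clamp_affine (x : R) : `|x| <= 1 -> 2 * clamp 0 1 ((x + 1) / 2) - 1 = x.
Proof. by rewrite ler_norml => /andP[x0 x1]; rewrite clamp_id; [field|apply/andP; split; lra]. Qed.

Lemma to_cubeK p : nrm p <= 1 -> of_cube (to_cube p) = p.
Proof.
rewrite maxnorm_le => /andP[p1 p2]; case: p p1 p2 => x y /= x1 y1.
by rewrite /of_cube /= !mxE /= !clamp_affine.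
Qed.

Lemma to_cube_boundary p : 1 <= nrm p -> cube_boundary (to_cube p).
Proof.
have c01 (x : R) : 1 <= `|x| -> clamp 0 1 ((x + 1) / 2) = 0 \/ clamp 0 1 ((x + 1) / 2) = 1.
  rewrite ler_normr => /orP[h|h]; [right|left]; last by apply: clamp_le; lra.
  by apply: clamp_ge; rewrite ler01 /=; lra.
rewrite maxnorm_ge => /orP[/c01|/c01] h.
  by exists ord0; rewrite mxE.
by exists (lift ord0 ord0); rewrite mxE.
Qed.

Lemma of_cube_boundary s : cube_boundary s -> 1 <= nrm (of_cube s).
Proof.
move=> [k sk]; rewrite maxnorm_ge /of_cube /=.
have n1 (x : R) : x = 0 \/ x = 1 -> 1 <= `|2 * x - 1|.
  by case=> ->; rewrite ?mulr0 ?sub0r ?normrN ?normr1// mulr1 (_ : 2 - 1 = 1) ?normr1//; ring.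
apply/orP; case: k sk => [[|[|//]] k2] sk; [left|right]; apply: n1.
  by rewrite (_ : ord0 = Ordinal k2)//; apply: val_inj.
by rewrite (_ : lift ord0 ord0 = Ordinal k2)//; apply: val_inj.
Qed.

Section Transfer.
Variables (Y : topologicalType) (y0 : Y).

Lemma sphere_map_plane (a : cube R 2 -> Y) :
  sphere_map y0 a -> plane_sphere y0 (a \o to_cube).
Proof.
move=> [ca a0]; split=> [|p p1 /=]; first exact: (cont_comp to_cube_continuous ca).
exact/a0/to_cube_boundary.
Qed.

Lemma plane_sphere_map (A : R * R -> Y) :
  plane_sphere y0 A -> sphere_map y0 (A \o of_cube).
Proof.
move=> [cA A0]; split=> [|s sb /=]; first exact: (cont_comp of_cube_continuous cA).
exact/A0/of_cube_boundary.
Qed.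

Lemma plane_sphereK (A : R * R -> Y) : plane_sphere y0 A -> (A \o of_cube) \o to_cube = A.
Proof.
move=> [_ A0]; apply/funext => p /=; have [p1|p1] := leP (nrm p) 1; first by rewrite to_cubeK.
by rewrite !A0 ?(ltW p1)//; apply/of_cube_boundary/to_cube_boundary/ltW.
Qed.

Lemma sphere_homotopic_plane (a b : cube R 2 -> Y) :
  sphere_homotopic y0 a b -> plane_homotopic y0 (a \o to_cube) (b \o to_cube).
Proof.
move=> [H [[cH Ha Hb] H0]]; exists (fun q => H (to_cube q.1, clamp 0 1 q.2)); split.
- apply: (within_comp cH (g := fun q : R * R * R => (to_cube q.1, clamp 0 1 q.2))).
    apply: cont_pair; first by apply: (cont_comp _ to_cube_continuous); cont.
    by apply: (cont_comp _ (@clamp_continuous R 0 1)); cont.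
  by move=> q; split => //=; rewrite in_itv /= clamp_itv.
- by move=> p t p1 /=; apply: H0; [exact: to_cube_boundary|rewrite clamp_itv].
- by move=> p /=; rewrite clamp_id ?lexx ?ler01.
- by move=> p /=; rewrite clamp_id ?lexx ?ler01.
Qed.

Lemma plane_sphere_homotopic (a b : cube R 2 -> Y) :
  plane_homotopic y0 (a \o to_cube) (b \o to_cube) -> sphere_homotopic y0 a b.
Proof.
move=> [K [cK K0 Ka Kb]]; exists (fun q => K (of_cube q.1, q.2)); split; last first.
  by move=> s t sb _; apply/K0/of_cube_boundary.
split=> [|s|s]; [|exact: (etrans (Ka _) (congr1 a (of_cubeK s)))|exact: (etrans (Kb _) (congr1 b (of_cubeK s)))].
apply: continuous_subspaceT; apply: (cont_comp _ cK); apply: cont_pair.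
  by apply: (cont_comp _ of_cube_continuous); cont.
by cont.
Qed.
End Transfer.

Section IsoPi2.
Variables (X Y : topologicalType) (j : X -> Y).
Hypotheses (cj : continuous j) (pi2 : iso_on_homotopy_group R 2 j).
Variable x0 : X.

Lemma plane_homotopic_map (A B : R * R -> X) :
  plane_homotopic x0 A B -> plane_homotopic (j x0) (j \o A) (j \o B).
Proof.
move=> [K [cK K0 KA KB]]; exists (j \o K); split.
- exact: (cont_comp cK cj).
- by move=> p t /K0 /= ->.
- by move=> p /=; rewrite KA.
- by move=> p /=; rewrite KB.
Qed.

Lemma pi2_surj (A : R * R -> Y) : plane_sphere (j x0) A ->
  exists2 B : R * R -> X, plane_sphere x0 B & plane_homotopic (j x0) (j \o B) A.
Proof.
move=> As; have [_ _ /(_ (sphere_class (j x0) (A \o of_cube)))] := pi2 x0.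
case=> [|_ [b bs <-]]; first by exists (A \o of_cube) => //; exact: plane_sphere_map.
rewrite predeqE => /(_ (A \o of_cube)) [_].
case=> [|a [sa _] [_ h]].
  split; first exact: plane_sphere_map.
  apply: plane_sphere_homotopic; rewrite (plane_sphereK As); exact: plane_homotopic_refl.
exists (a \o to_cube); first exact: sphere_map_plane.
by have := sphere_homotopic_plane h; rewrite (plane_sphereK As).
Qed.

(** Classes are sets of maps: injectivity needs equality of the two image sets, and equality of the
    classes is turned back into a homotopy by the member [b]. *)
Lemma pi2_inj (A B : R * R -> X) : plane_sphere x0 A -> plane_sphere x0 B ->
  plane_homotopic (j x0) (j \o A) (j \o B) -> plane_homotopic x0 A B.
Proof.
move=> As Bs AB; have [_ inj _] := pi2 x0.
pose a := A \o of_cube; pose b := B \o of_cube.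
have sub (A1 A2 : R * R -> X) : plane_sphere x0 A1 -> plane_sphere x0 A2 ->
    plane_homotopic (j x0) (j \o A1) (j \o A2) ->
    homotopy_group_map x0 j (sphere_class x0 (A1 \o of_cube)) `<=`
    homotopy_group_map x0 j (sphere_class x0 (A2 \o of_cube)).
  move=> A1s A2s A12 c [a' [_ /sphere_homotopic_plane h] [cs /sphere_homotopic_plane h']].
  exists (A2 \o of_cube).
    split; first exact: plane_sphere_map.
    by apply: plane_sphere_homotopic; rewrite (plane_sphereK A2s); exact: plane_homotopic_refl.
  split=> //; apply: plane_sphere_homotopic.
  have -> : (j \o (A2 \o of_cube)) \o to_cube = j \o A2 by rewrite -compA (plane_sphereK A2s).
  apply: plane_homotopic_trans h'; apply: plane_homotopic_trans (plane_homotopic_map h).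
  by rewrite (plane_sphereK A1s); apply: plane_homotopic_sym.
have := inj (sphere_class x0 a) (sphere_class x0 b).
rewrite !inE => /(_ _ _ _) E.
have {}E : sphere_class x0 a = sphere_class x0 b.
  apply: E; [by exists a => //; exact: plane_sphere_map|by exists b => //; exact: plane_sphere_map|].
  by apply/seteqP; split; apply: sub => //; exact: plane_homotopic_sym.
have : sphere_class x0 b b.
  split; first exact: plane_sphere_map.
  by apply: plane_sphere_homotopic; rewrite (plane_sphereK Bs); exact: plane_homotopic_refl.
rewrite -E => -[_ /sphere_homotopic_plane].
by rewrite (plane_sphereK As) (plane_sphereK Bs).
Qed.
End IsoPi2.
End PlaneSpheres.

(** * Polar coordinates in the plane *)

Lemma pair_at (T U V : topologicalType) (f : T -> U) (g : T -> V) x :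
  {for x, continuous f} -> {for x, continuous g} -> {for x, continuous (fun q => (f q, g q))}.
Proof. by move=> cf cg; exact: (cvg_pair cf cg). Qed.

Section Polar.
Variables (R : realType) (l : R).
Hypothesis l0 : 0 < l.
Notation nrm p := (maxnorm p.1 p.2).

(** An angle for the l^1-norm, rational instead of trigonometric, with [2 * l] as the full turn. At
    the origin division by zero gives [l / 2], where only the range matters. *)
Definition half_angle (p : R * R) : R := l * (1 - p.1 / (`|p.1| + `|p.2|)) / 2.
Definition angle (p : R * R) : R := if - p.2 <= 0 then half_angle p else 2 * l - half_angle p.

Lemma l1norm_gt0 (p : R * R) : p != (0, 0) -> 0 < `|p.1| + `|p.2|.
Proof.
case: p => x y; rewrite xpair_eqE negb_and => xy.
by rewrite lt_neqAle addr_ge0// andbT eq_sym paddr_eq0// !normr_eq0 negb_and.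
Qed.

Lemma half_angle_itv p : 0 <= half_angle p <= l.
Proof.
have : `|p.1 / (`|p.1| + `|p.2|)| <= 1.
  have [->|/l1norm_gt0 p0] := eqVneq p (0, 0); first by rewrite mul0r normr0.
  by rewrite normrM normfV (gtr0_norm p0) ler_pdivrMr// mul1r lerDl.
rewrite ler_norml => /andP[h1 h2]; rewrite /half_angle; apply/andP; split.
  by rewrite divr_ge0// mulr_ge0 ?(ltW l0)// subr_ge0.
rewrite ler_pdivrMr// ler_pM2l//; lra.
Qed.

Lemma angle_itv p : 0 <= angle p <= 2 * l.
Proof. by have /andP[h0 h1] := half_angle_itv p; rewrite /angle; case: ifP => _; apply/andP; split; lra. Qed.

Lemma half_angleN p : half_angle (- p.1, - p.2) = l - half_angle p.
Proof.
rewrite /half_angle /= !normrN mulNr; move: (p.1 / _) => q; by field.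
Qed.

Lemma half_angle_axis p : p != (0, 0) -> p.2 = 0 ->
  (half_angle p = 0 /\ 0 < p.1) \/ (half_angle p = l /\ p.1 < 0).
Proof.
move=> p0 p2; have := l1norm_gt0 p0; rewrite /half_angle p2 normr0 addr0 normr_gt0 => p1.
have [h|h|h] := ltgtP p.1 0; last by rewrite h eqxx in p1.
  by right; split=> //; rewrite ltr0_norm// invrN mulrN mulfV// opprK; field.
by left; split=> //; rewrite gtr0_norm// mulfV// subrr mulr0 mul0r.
Qed.

Lemma angleN p : p != (0, 0) ->
  (0 <= angle p <= l /\ angle (- p.1, - p.2) = angle p + l) \/
  (0 <= angle (- p.1, - p.2) <= l /\ angle p = angle (- p.1, - p.2) + l).
Proof.
move=> p0; rewrite /angle half_angleN /= opprK !oppr_le0.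
have /andP[h0 h1] := half_angle_itv p.
have [y0|y0|y0] := ltgtP p.2 0.
- by right; split; [apply/andP; split; lra|lra].
- by left; split; [apply/andP; split; lra|lra].
have [[-> _]|[-> _]] := half_angle_axis p0 y0.
  by left; split; [rewrite lexx (ltW l0)|rewrite subr0 add0r].
by right; split; [rewrite subrr lexx (ltW l0)|rewrite subrr add0r].
Qed.

(** The jump of the angle across the positive first axis, from 0 to [2 * l], is repaired by the
    periodicity of [N]. *)
Lemma polar_continuous (T Y : topologicalType) (P : T -> R * R) (N : T * R -> Y) (x : T) :
  continuous P -> continuous N -> (forall q, N (q, 0) = N (q, 2 * l)) -> P x != (0, 0) ->
  {for x, continuous (fun q => N (q, angle (P q)))}.
Proof.
move=> cP cN N0 Px.
have -> : (fun q => N (q, angle (P q))) = (fun q => if - (P q).2 <= 0 then N (q, half_angle (P q))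
    else N (q, 2 * l - half_angle (P q))).
  by apply/funext => q; rewrite /angle; case: ifP.
have cV : {for x, continuous (fun q => (`|(P q).1| + `|(P q).2|)^-1)}.
  apply: cvgV; first by rewrite gt_eqF// l1norm_gt0.
  have c : continuous (fun q => `|(P q).1| + `|(P q).2|) by cont.
  exact: c.
have cA : {for x, continuous (fun q => half_angle (P q))}.
  rewrite /half_angle; apply: cvgM; last exact: cvg_cst.
  apply: cvgM; first exact: cvg_cst.
  apply: cvgB; first exact: cvg_cst.
  apply: cvgM; last exact: cV.
  have c : continuous (fun q => (P q).1) by cont.
  exact: c.
apply: paste_at.
- have c : continuous (fun q => - (P q).2) by cont.
  exact: c.
- move=> _; apply: (@continuous_comp _ _ _ (fun q => (q, half_angle (P q))) N); last exact: cN.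
  by apply: pair_at; [exact: cvg_id|exact: cA].
- move=> _; apply: (@continuous_comp _ _ _ (fun q => (q, 2 * l - half_angle (P q))) N); last exact: cN.
  apply: pair_at; first exact: cvg_id.
  by apply: cvgB; [exact: cvg_cst|exact: cA].
move=> /eqP; rewrite oppr_eq0 => /eqP y0.
have [[-> _]|[-> _]] := half_angle_axis Px y0; first by rewrite subr0 N0.
by rewrite (_ : 2 * l - l = l)//; ring.
Qed.

Lemma nrm_scale c (p : R * R) : 0 <= c -> nrm (c * p.1, c * p.2) = c * nrm p.
Proof. by move=> c0; rewrite /maxnorm /= !normrM (ger0_norm c0) maxr_pMr. Qed.

Lemma nrmN (p : R * R) : nrm (- p.1, - p.2) = nrm p.
Proof. by rewrite /maxnorm /= !normrN. Qed.

Lemma nrm_continuous (T : topologicalType) (P : T -> R * R) : continuous P -> continuous (fun x => nrm (P x)).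
Proof. by move=> cP; rewrite /maxnorm; cont. Qed.
End Polar.

(** * The homotopy over the annulus *)

Section NoHomotopy.
Variable R : realType.
Notation S := (realization R (Sigma 2)).
Notation nu := (realization_map R (act (Sigma 2))).
Notation nrm p := (maxnorm p.1 p.2).

Variables (X : topologicalType) (nuX : X -> X) (l : R).
Hypothesis l0 : 0 < l.

(* [(Z, u) |-> g (Z, u)] is the half [0 <= Z <= 2 l] of a torus and [(dx, dy)] the direction of the equatorial
   loop at the end of the homotopy. *)
Variables (g : R * R -> X) (dx dy : R * R -> R).
Hypotheses (cg : continuous g) (cdx : continuous dx) (cdy : continuous dy).
Hypothesis g_periodic : forall Z, g (Z, 0) = g (Z, 2 * l).
Hypothesis g_act : forall u, 0 <= u <= l ->
  g (2 * l, u + l) = nuX (g (0, u)) /\ g (2 * l, u) = nuX (g (0, u + l)).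
Hypothesis d_norm : forall p, dx p ^+ 2 + dy p ^+ 2 = 1.
Hypothesis d_periodic : forall Z, dx (Z, 0) = dx (Z, 2 * l) /\ dy (Z, 0) = dy (Z, 2 * l).
Hypothesis d_end : forall u, dx (2 * l, u) = dx (0, u) /\ dy (2 * l, u) = dy (0, u).
Hypothesis d_half : forall u, 0 <= u <= l ->
  dx (0, u + l) = - dx (0, u) /\ dy (0, u + l) = - dy (0, u).

Variables (Y : topologicalType) (tau : Y -> Y) (j : S -> Y).
Hypotheses (ctau : continuous tau) (cj : continuous j) (j_eq : forall x, j (nu x) = tau (j x)).
Hypothesis pi2 : iso_on_homotopy_group R 2 j.

Variable H : X * R -> Y.
Hypothesis cH : {within [set: X] `*` `[0, 1], continuous H}.
Hypothesis H0 : forall Z u u', H (g (Z, u), 0) = H (g (Z, u'), 0).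
Hypothesis H1 : forall p, H (g p, 1) = j (sphere (dx p) (dy p) 0).
Hypothesis H_eq : forall x t, 0 <= t <= 1 -> H (nuX x, t) = tau (H (x, t)).

Let Zt (t : R) : R := 2 * l * clamp 0 1 t.
(** A radial scale taking [0, 1/4], [1/4, 1/2], [1/2, 1] to [0, 2], [2, 3], [3, 4]. At scales 0 to 1
    the homotopy [H] runs; then the height [sig] goes from 0 to 1 - 2t at scale 2, back to 0 at
    scale 3 and to 1 at scale 4. *)
Let eta (r : R) : R := Num.min (8 * r) (Num.min (4 * r + 1) (2 * r + 2)).
Let sig (t e : R) : R := (1 - 2 * clamp 0 1 t) * Num.max 0 (1 - `|e - 2|) + Num.max 0 (e - 3).

(** The angle is a separate argument: [Ball] is continuous in it, although the angle of [p] is not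
    continuous in [p]. *)
Let Ball (q : (R * R * R) * R) : Y :=
  let: ((p, t), u) := q in let e := eta (nrm p) in
  if e - 1 <= 0 then H (g (Zt t, u), clamp 0 1 e)
  else j (sphere (dx (Zt t, u)) (dy (Zt t, u)) (sig t e)).

Let E (q : R * R * R) : Y := Ball (q, angle l q.1).

Let cZ (T : topologicalType) (f : T -> R) : continuous f -> continuous (fun x => Zt (f x)).
Proof.
by move=> cf; apply: contM; [exact: cont_cst|exact: (cont_comp cf (@clamp_continuous R 0 1))].
Qed.

Let ceta (T : topologicalType) (f : T -> R) : continuous f -> continuous (fun x => eta (f x)).
Proof. by move=> cf; rewrite /eta; cont. Qed.

Let csig (T : topologicalType) (f h : T -> R) : continuous f -> continuous h ->
  continuous (fun x => sig (f x) (h x)).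
Proof.
move=> cf ch; have cc := cont_comp cf (@clamp_continuous R 0 1).
by rewrite /sig; cont.
Qed.

Let csphere (T : topologicalType) (P : T -> R * R) (s : T -> R) : continuous P -> continuous s ->
  continuous (fun x => sphere (dx (P x)) (dy (P x)) (s x)).
Proof.
move=> cP cs; apply: sphere_continuous => //; [exact: (cont_comp cP cdx)|exact: (cont_comp cP cdy)].
Qed.

Let cBall : continuous Ball.
Proof.
have cn : continuous (fun q : (R * R * R) * R => nrm q.1.1) by apply: nrm_continuous; cont.
have ce := ceta cn; have cu : continuous (fun q : (R * R * R) * R => q.2) by cont.
have ct : continuous (fun q : (R * R * R) * R => q.1.2) by cont.
have cP : continuous (fun q : (R * R * R) * R => (Zt q.1.2, q.2)).
  by apply: cont_pair => //; exact: cZ.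
have -> : Ball = fun q => if eta (nrm q.1.1) - 1 <= 0
    then H (g (Zt q.1.2, q.2), clamp 0 1 (eta (nrm q.1.1)))
    else j (sphere (dx (Zt q.1.2, q.2)) (dy (Zt q.1.2, q.2)) (sig q.1.2 (eta (nrm q.1.1)))).
  by apply/funext => -[[p t] u].
apply: paste; first by cont.
- apply: (within_comp cH (g := fun q : (R * R * R) * R => (g (Zt q.1.2, q.2), clamp 0 1 (eta (nrm q.1.1))))).
    by apply: cont_pair; [exact: (cont_comp cP cg)|exact: (cont_comp ce (@clamp_continuous R 0 1))].
  by move=> q; split => //=; rewrite in_itv /= clamp_itv.
- by apply: (cont_comp _ cj); apply: csphere => //; exact: csig.
move=> [[p t] u] /= /eqP; rewrite subr_eq0 => /eqP ->.
rewrite clamp_id ?ler01 ?lexx// H1 /sig.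
have -> : (1 : R) - 2 = -1 by ring.
by rewrite normrN1 subrr maxxx mulr0 add0r max_l//; lra.
Qed.

Let Ball_periodic q : Ball (q, 0) = Ball (q, 2 * l).
Proof.
by case: q => [p t] /=; rewrite g_periodic; have [-> ->] := d_periodic (Zt t).
Qed.

Let eta0 : eta 0 = 0.
Proof. by rewrite /eta !mulr0 !add0r min_l// le_min; apply/andP; split; lra. Qed.

Let cE : continuous E.
Proof.
move=> [p t]; have [p0|p0] := eqVneq p (0, 0).
  apply: (@tube_at R _ Y Ball (fun q => angle l q.1) 0 (2 * l) (p, t)) => // [q|w].
    exact: angle_itv.
  rewrite /Ball p0 /= /maxnorm normr0 maxxx eta0 sub0r lerN10 clamp_id ?lexx ?ler01//.
have cP : continuous (fun q : R * R * R => q.1) by cont.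
exact: (@polar_continuous R l _ _ (fun q : R * R * R => q.1) Ball (p, t) cP cBall Ball_periodic p0).
Qed.

Let eta_ge1 (r : R) : 1 <= r -> 4 <= eta r.
Proof. by move=> r1; rewrite /eta !le_min; apply/and3P; split; lra. Qed.

Let E_bnd p t : 1 <= nrm p -> E (p, t) = j (yellow R).
Proof.
move=> /eta_ge1 e4; rewrite /E /Ball /= ifF; last by apply/negbTE; rewrite -ltNge; lra.
rewrite sphere_top// /sig max_l; last by rewrite ger0_norm; lra.
by rewrite mulr0 add0r max_r; lra.
Qed.

Let W0 (p : R * R) : S := sphere (dx (0, angle l p)) (dy (0, angle l p))
  (Num.max (2 - 4 * nrm p) (2 * nrm p - 1)).
Let W1 (p : R * R) : S := sphere (dx (0, angle l p)) (dy (0, angle l p))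
  (Num.min (4 * nrm p - 2) (2 * nrm p - 1)).

(* [Om0 a] is [a] surrounded by the upper hemisphere twice, with opposite orientations; in [Om1 a] the inner
   part [|p| <= 1/2] of [Om0 a] is replaced by its antipode.  [E] is a homotopy between these for the disk
   [a0] swept out by [H], so its preimage under [pi_2 j] contradicts the Borsuk-Ulam theorem. *)
Let om0 (b : R * R -> S) p := if nrm p - 4^-1 <= 0 then b (4 * p.1, 4 * p.2) else W0 p.
Let om1 (b : R * R -> S) p := if nrm p - 4^-1 <= 0 then nu (b (- (4 * p.1), - (4 * p.2))) else W1 p.
Let Om0 (a : R * R -> Y) p := if nrm p - 4^-1 <= 0 then a (4 * p.1, 4 * p.2) else j (W0 p).
Let Om1 (a : R * R -> Y) p := if nrm p - 4^-1 <= 0 then tau (a (- (4 * p.1), - (4 * p.2))) else j (W1 p).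

Let j_om0 b : j \o om0 b = Om0 (j \o b).
Proof. by apply/funext => p; rewrite /om0 /Om0 /=; case: ifP. Qed.

Let j_om1 b : j \o om1 b = Om1 (j \o b).
Proof. by apply/funext => p; rewrite /om1 /Om1 /=; case: ifP => // _; rewrite j_eq. Qed.

(** The rescaled core [|p| <= 1/4] at time 0; its rim has height 1 and is thus sent to the base
    point. *)
Let a0 (p : R * R) : Y := if nrm p - 1 <= 0 then E ((4^-1 * p.1, 4^-1 * p.2), 0) else j (yellow R).

Let c0 : clamp 0 1 (0 : R) = 0. Proof. by rewrite clamp_id ?lexx ?ler01. Qed.
Let c1 : clamp 0 1 (1 : R) = 1. Proof. by rewrite clamp_id ?lexx ?ler01. Qed.
Let Z0 : Zt 0 = 0. Proof. by rewrite /Zt c0 mulr0. Qed.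
Let Z1 : Zt 1 = 2 * l. Proof. by rewrite /Zt c1 mulr1. Qed.

Let quarter_neq0 (p : R * R) : 0 < nrm p -> p != (0, 0).
Proof. by apply: contraTneq => ->; rewrite -leNgt /= /maxnorm normr0 maxxx. Qed.

Let sig_ge (t e : R) : 2 <= e -> sig t e = (1 - 2 * clamp 0 1 t) * Num.max 0 (3 - e) + Num.max 0 (e - 3).
Proof.
move=> e2; rewrite /sig ger0_norm ?subr_ge0//; congr (_ * Num.max _ _ + _); ring.
Qed.

Let E_outer p t : 4^-1 <= nrm p -> E (p, t) = j (sphere (dx (Zt t, angle l p)) (dy (Zt t, angle l p))
   ((1 - 2 * clamp 0 1 t) * Num.max 0 (2 - 4 * nrm p) + Num.max 0 (2 * nrm p - 1))).
Proof.
move=> p4; have [p2|/ltW p2] := leP (nrm p) 2^-1.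
  have e : eta (nrm p) = 4 * nrm p + 1.
    by rewrite /eta (@min_l _ _ (4 * nrm p + 1)) ?min_r//; lra.
  rewrite /E /Ball /= e ifF; last by apply/negbTE; rewrite -ltNge; lra.
  rewrite sig_ge; last by lra.
  have -> : 3 - (4 * nrm p + 1) = 2 - 4 * nrm p by ring.
  by rewrite (@max_l _ _ 0 (4 * nrm p + 1 - 3)) ?(@max_l _ _ 0 (2 * nrm p - 1))//; lra.
have e : eta (nrm p) = 2 * nrm p + 2.
  by rewrite /eta (@min_r _ _ (4 * nrm p + 1)) ?min_r//; lra.
rewrite /E /Ball /= e ifF; last by apply/negbTE; rewrite -ltNge; lra.
rewrite sig_ge; last by lra.
rewrite (@max_l _ _ 0 (3 - (2 * nrm p + 2))); last by lra.
rewrite (@max_l _ _ 0 (2 - 4 * nrm p)); last by lra.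
by rewrite (_ : 2 * nrm p + 2 - 3 = 2 * nrm p - 1)//; ring.
Qed.

Let E0 p : E (p, 0) = Om0 a0 p.
Proof.
rewrite /Om0 subr_le0; case: (leP (nrm p) 4^-1) => [p4|/ltW p4]; last first.
  rewrite E_outer// Z0 c0 mulr0 subr0 mul1r; congr (j (sphere _ _ _)).
  have [p2|/ltW p2] := leP (nrm p) 2^-1.
    by rewrite max_r ?max_l ?addr0; lra.
  by rewrite max_l ?max_r ?add0r; lra.
rewrite /a0 ifT; last by rewrite (@nrm_scale R 4 p)// subr_le0; lra.
by rewrite /= !mulKf//; case: (p).
Qed.

Let d_anti p : p != (0, 0) ->
  dx (0, angle l p) = - dx (0, angle l (- p.1, - p.2)) /\
  dy (0, angle l p) = - dy (0, angle l (- p.1, - p.2)).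
Proof.
move=> p0; have [[a01 ->]|[a01 ->]] := angleN l0 p0; last exact: d_half.
by have [-> ->] := d_half a01; rewrite !opprK.
Qed.

Let E_anti p : nrm p <= 4^-1 -> E (p, 1) = tau (E ((- p.1, - p.2), 0)).
Proof.
move=> p4; have e8 : eta (nrm p) = 8 * nrm p.
  by rewrite /eta min_l// le_min; apply/andP; split; lra.
rewrite /E /Ball nrmN Z0 Z1; case: ifP => e1.
  (* At the origin the angle does not change with the sign of [p], but [H0] removes the dependence
     on it. *)
  have [p0|p0] := eqVneq p (0, 0).
    rewrite p0 /= /maxnorm normr0 maxxx eta0 c0.
    rewrite (H0 (2 * l) _ (0 + l)) (H0 0 _ 0).
    have [|-> _] := @g_act 0; first by rewrite lexx (ltW l0).
    by rewrite H_eq ?lexx ?ler01.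
  rewrite -H_eq ?clamp_itv//; congr (H (_, _)).
  have [[a01 ->]|[a01 ->]] := angleN l0 p0; first by have [_ ->] := g_act a01.
  by have [-> _] := g_act a01.
have p0 : p != (0, 0).
  by apply/eqP => p0; move: e1; rewrite p0 /= /maxnorm normr0 maxxx eta0 sub0r lerN10.
rewrite -j_eq sphere_act//; congr (j _).
have [-> ->] := d_end (angle l p); have [-> ->] := d_anti p0; congr (sphere _ _ _).
rewrite /sig e8 c0 c1 (@max_l _ _ 0 (8 * nrm p - 3)); last by lra.
by rewrite !addr0 mulr0 subr0 mul1r; ring.
Qed.

Let E1 p : E (p, 1) = Om1 a0 p.
Proof.
rewrite /Om1 subr_le0; case: (leP (nrm p) 4^-1) => [p4|/ltW p4]; last first.
  rewrite E_outer// Z1 c1; have [-> ->] := d_end (angle l p); congr (j (sphere _ _ _)).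
  have [p2|/ltW p2] := leP (nrm p) 2^-1.
    by rewrite max_r ?max_l ?min_l ?addr0; lra.
  by rewrite max_l ?max_r ?min_r ?mulr0 ?add0r; lra.
rewrite /a0 ifT; last by rewrite (@nrmN R (4 * p.1, 4 * p.2)) (@nrm_scale R 4 p)// subr_le0; lra.
by rewrite E_anti//= !mulrN !mulKf.
Qed.

Section PasteCore.
Variables (T Z : topologicalType) (P : T -> R * R) (B : T -> Z) (W : R * R -> Z).
Hypotheses (cP : continuous P) (cB : continuous B).
Hypothesis cW : forall p, p != (0, 0) -> {for p, continuous W}.
Hypothesis BW : forall x, nrm (P x) = 4^-1 -> B x = W (P x).

Lemma core_continuous : continuous (fun x => if nrm (P x) - 4^-1 <= 0 then B x else W (P x)).
Proof.
move=> x; apply: (@paste_at R T Z (fun x => nrm (P x) - 4^-1) B (fun x => W (P x)) x).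
- have c : continuous (fun x => nrm (P x) - 4^-1).
    by apply: contD; [exact: nrm_continuous|exact: cont_cst].
  exact: c.
- by move=> _; exact: cB.
- move=> x4; apply: continuous_comp; first exact: cP.
  by apply/cW/quarter_neq0; move: x4; rewrite subr_ge0; apply: lt_le_trans.
- by move=> /eqP; rewrite subr_eq0 => /eqP; exact: BW.
Qed.
End PasteCore.

Let cW (h : R -> R) p : continuous h -> p != (0, 0) ->
  {for p, continuous (fun p => sphere (dx (0, angle l p)) (dy (0, angle l p)) (h (nrm p)))}.
Proof.
move=> ch p0.
pose N (q : (R * R) * R) := sphere (dx (0, q.2)) (dy (0, q.2)) (h (nrm q.1)).
have cN : continuous N.
  apply: (csphere (P := fun q : (R * R) * R => (0, q.2))); first by cont.
  by apply: (cont_comp _ ch); apply: nrm_continuous; cont.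
have Np q : N (q, 0) = N (q, 2 * l) by rewrite /N /=; have [-> ->] := d_periodic 0.
exact: (@polar_continuous R l _ _ id N p (@cont_id _) cN Np p0).
Qed.

Let cW0 p : p != (0, 0) -> {for p, continuous W0}.
Proof. by apply: (cW (h := fun r => Num.max (2 - 4 * r) (2 * r - 1))); cont. Qed.

Let cW1 p : p != (0, 0) -> {for p, continuous W1}.
Proof. by apply: (cW (h := fun r => Num.min (4 * r - 2) (2 * r - 1))); cont. Qed.

Let W0_core p : nrm p = 4^-1 -> W0 p = yellow R.
Proof. by move=> p4; rewrite /W0 sphere_top// p4 le_max; apply/orP; left; lra. Qed.

Let W1_core p : nrm p = 4^-1 -> W1 p = nu (yellow R).
Proof.
move=> p4; rewrite /W1 p4 min_l; last by lra.
rewrite -(@sphere_top R (- dx (0, angle l p)) (- dy (0, angle l p)) 1)// sphere_act ?sqrrN// !opprK.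
by congr (sphere _ _ _); lra.
Qed.

Let W0_bnd p : 1 <= nrm p -> W0 p = yellow R.
Proof. by move=> p1; rewrite /W0 sphere_top// le_max; apply/orP; right; lra. Qed.

Let W1_bnd p : 1 <= nrm p -> W1 p = yellow R.
Proof. by move=> p1; rewrite /W1 sphere_top// le_min; apply/andP; split; lra. Qed.

Let nrm4 (p : R * R) : nrm p = 4^-1 -> nrm (4 * p.1, 4 * p.2) = 1.
Proof. by move=> p4; rewrite (@nrm_scale R 4 p)// p4 mulfV. Qed.

Let nrm4N (p : R * R) : nrm p = 4^-1 -> nrm (- (4 * p.1), - (4 * p.2)) = 1.
Proof. by move=> p4; rewrite (@nrmN R (4 * p.1, 4 * p.2)) nrm4. Qed.

Let out (p : R * R) : 1 <= nrm p -> (nrm p - 4^-1 <= 0) = false.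
Proof. by move=> p1; apply/negbTE; rewrite -ltNge; lra. Qed.

Let om0_sphere b : plane_sphere (yellow R) b -> plane_sphere (yellow R) (om0 b).
Proof.
move=> [cb b0]; split=> [|p p1]; last by rewrite /om0 out// W0_bnd.
apply: (core_continuous (P := id) (B := fun p => b (4 * p.1, 4 * p.2)) (W := W0)).
- exact: cont_id.
- by apply: (cont_comp _ cb); cont.
- exact: cW0.
- by move=> p p4; rewrite W0_core// b0// nrm4.
Qed.

Let om1_sphere b : plane_sphere (yellow R) b -> plane_sphere (yellow R) (om1 b).
Proof.
move=> [cb b0]; split=> [|p p1]; last by rewrite /om1 out// W1_bnd.
apply: (core_continuous (P := id) (B := fun p => nu (b (- (4 * p.1), - (4 * p.2)))) (W := W1)).
- exact: cont_id.
- apply: (cont_comp _ (@realization_map_continuous R _ _ (act (Sigma 2)))).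
  by apply: (cont_comp _ cb); cont.
- exact: cW1.
- by move=> p p4; rewrite W1_core// b0// nrm4N.
Qed.

Let Om0_homotopic a a' : plane_homotopic (j (yellow R)) a a' ->
  plane_homotopic (j (yellow R)) (Om0 a) (Om0 a').
Proof.
move=> [K [cK K0 Ka Ka']].
exists (fun q => if nrm q.1 - 4^-1 <= 0 then K ((4 * q.1.1, 4 * q.1.2), q.2) else j (W0 q.1)); split.
- apply: (core_continuous (P := fun q : R * R * R => q.1) (W := j \o W0)
    (B := fun q => K ((4 * q.1.1, 4 * q.1.2), q.2))).
  + by cont.
  + by apply: (cont_comp _ cK); cont.
  + by move=> p p0; apply: continuous_comp; [exact: cW0|exact: cj].
  + by move=> q q4 /=; rewrite W0_core// K0// nrm4.
- by move=> p t p1 /=; rewrite out// W0_bnd.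
- by move=> p; rewrite /Om0 Ka.
- by move=> p; rewrite /Om0 Ka'.
Qed.

Let Om1_homotopic a a' : plane_homotopic (j (yellow R)) a a' ->
  plane_homotopic (j (yellow R)) (Om1 a) (Om1 a').
Proof.
move=> [K [cK K0 Ka Ka']].
exists (fun q => if nrm q.1 - 4^-1 <= 0 then tau (K ((- (4 * q.1.1), - (4 * q.1.2)), q.2)) else j (W1 q.1)); split.
- apply: (core_continuous (P := fun q : R * R * R => q.1) (W := j \o W1)
    (B := fun q => tau (K ((- (4 * q.1.1), - (4 * q.1.2)), q.2)))).
  + by cont.
  + by apply: (cont_comp _ ctau); apply: (cont_comp _ cK); cont.
  + by move=> p p0; apply: continuous_comp; [exact: cW1|exact: cj].
  + by move=> q q4 /=; rewrite W1_core// K0 ?nrm4N// j_eq.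
- by move=> p t p1 /=; rewrite out// W1_bnd.
- by move=> p; rewrite /Om1 Ka.
- by move=> p; rewrite /Om1 Ka'.
Qed.

Let a0_rim p : nrm p = 1 -> E ((4^-1 * p.1, 4^-1 * p.2), 0) = j (yellow R).
Proof.
move=> p1; have p4 : nrm (4^-1 * p.1, 4^-1 * p.2) = 4^-1 by rewrite (@nrm_scale R 4^-1 p)// p1 mulr1.
rewrite E_outer ?p4// c0 mulr0 subr0 mul1r sphere_top//.
by rewrite max_r ?max_l; lra.
Qed.

Let a0_sphere : plane_sphere (j (yellow R)) a0.
Proof.
split=> [|p p1].
  apply: paste.
  - by apply: contD; [apply: nrm_continuous; cont|exact: cont_cst].
  - by apply: (cont_comp _ cE); cont.
  - exact: cont_cst.
  - by move=> p /eqP; rewrite subr_eq0 => /eqP; exact: a0_rim.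
rewrite /a0 subr_le0; case: ifP => // p1'; apply: a0_rim.
by apply/eqP; rewrite eq_le p1'.
Qed.

Lemma no_homotopy : False.
Proof.
have [b bs jb] := pi2_surj pi2 a0_sphere.
have EE : plane_homotopic (j (yellow R)) (Om0 a0) (Om1 a0).
  exists E; split; [exact: cE|exact: E_bnd|exact: E0|exact: E1].
have h : plane_homotopic (j (yellow R)) (j \o om0 b) (j \o om1 b).
  rewrite j_om0 j_om1; apply: plane_homotopic_trans (Om0_homotopic jb) _.
  apply: plane_homotopic_trans EE _.
  exact/Om1_homotopic/plane_homotopic_sym.
have [K [cK K0 Ka Kb]] := pi2_inj cj pi2 (om0_sphere bs) (om1_sphere bs) h.
(* From radius 1/2 on both ends have height 2|p| - 1; between 1/4 and 1/2 the heights 2 - 4|p| and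
   4|p| - 2 are opposite, as are the cores. *)
apply: (Borsuk_Ulam_square cK) => [x y t xy _|x y xy|x y xy]; first exact: K0.
  rewrite Ka Kb /om0 /om1 ifF /=; last by apply/negbTE; rewrite -ltNge; lra.
  rewrite ifF /=; last by apply/negbTE; rewrite -ltNge; lra.
  by rewrite /W0 /W1 /=; congr (sphere _ _ _); rewrite max_r ?min_r; lra.
rewrite Ka Kb /om0 /om1 /= (@nrmN R (x, y)) /= !mulrN; case: ifP => // xy4.
have p0 : (x, y) != (0, 0).
  by apply: quarter_neq0; move: xy4 => /negbT; rewrite -ltNge /=; lra.
rewrite /W0 /W1 /= (@nrmN R (x, y)) sphere_act//.
have [-> ->] := d_anti p0; congr (sphere _ _ _).
by rewrite min_l ?max_l /=; lra.
Qed.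
End NoHomotopy.

Theorem theorem5p1 (R : realType) :
  exists C : R, 0 < C /\
    forall (Y : topologicalType) (tau : Y -> Y)
      (j : realization R (Sigma 2) -> Y),
    Sigma2_extension tau j ->
    forall (L : nat) (L4 : (4 %| L)%N) (n : nat) (I : {set 'I_n})
      (f : simplicialMap (power n (Gamma L4)) (Sigma 2)),
    (4 <= L)%N -> (1 <= n)%N -> odd #|I| ->
    equivariant (act (power n (Gamma L4))) (act (Sigma 2)) f ->
    equivariantly_homotopic R
      (realization_map R (act (power n (Gamma L4)))) tau
      (fun p => j (realization_map R f p))
      (fun p => monomial_map j I (Gamma_torus p)) ->
    #|I|%:R <= C * L%:R ^+ 2.

Proof.
exists 8; split=> [|Y tau j Yext L L4 n I f L_ge4 _ oI f_eq [H [[cH Ha Hb] H_eq]]]; first by [].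
rewrite leNgt; apply/negP => big.
have bigI : (8 * L ^ 2 < #|I|)%N by rewrite -(ltr_nat R) natrM natrX.
have [i iI [s fs]] := insensitive_direction L_ge4 f bigI.
have fc k w w' : f (vtx i s k w) = f (vtx i s k w').
  by rewrite /vtx; have [h1 h2] := fs (k./2)%:R w w'; case: (odd k).
have [[ctau _ j_eq [cj _ _] _] _ pi2] := Yext.
(* The half path and the circle both have length [2 * l], so [l] is half a turn of the circle. *)
pose l : R := (L./2)%:R.
have l2 : 2 * l = L%:R.
  by rewrite /l -natrM mul2n -[in RHS](odd_double_half L) (evenL L4).
have l0 : 0 < l by rewrite ltr0n half_gt0 (leq_trans _ L_ge4).
pose d p := val (direction (R := R) L4 i s I p).
have [cdx cdy] := @direction_continuous R L L4 L_ge4 n i s I.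
apply: (@no_homotopy R _ (realization_map R (act (power n (Gamma L4)))) l l0
  (annulus L4 i s) (fun p => complex.Re (d p)) (fun p => complex.Im (d p))
  (@annulus_continuous R L L4 L_ge4 n i s) cdx cdy _ _ _ _ _ _ Y tau j ctau cj _ pi2 H cH) => //.
- by move=> Z; rewrite l2; exact: annulus_periodic.
- by move=> u uL; rewrite l2; exact: annulus_act.
- by move=> p; exact: circle_normE.
- by move=> Z; rewrite l2 /d /direction annulus_periodic.
- by move=> u; rewrite l2 /d direction_end.
- move=> u uL; rewrite /d direction_half//.
  by case: (val _) => a b.
- by move=> Z u u'; rewrite !Ha (annulus_colour _ fc Z u u').
- by move=> p; rewrite Hb /monomial_map sphere_iota.
- by move=> x t t01; exact: (H_eq t t01 x).
Qed.
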